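(* Let $N\ge2$ and let $\Omega\subset\mathbb{R}^N$ be a bounded and smooth domain. Suppose the distance function to the boundary $\rho(x)=\inf_{y\in\partial\Omega}|y-x|$ of $\Omega$ has infinitely many maximum points. Then there exist infinitely many positive functions $u\in C(\overline\Omega)\cap W_0^{1,\infty}(\Omega)$ satisfying $$0<u(x)\le1=\|u\|_\infty\ \text{ for }x\in\Omega,\quad\text{and}\quad\|\nabla u\|_\infty=\min\left\{\|\nabla\phi\|_\infty:\phi\in W_0^{1,\infty}(\Omega)\text{ and }\|\phi\|_\infty=1\right\}.$$ Moreover, each one of these functions assumes its maximum value $1$ only at one point, which is also a maximum point of the distance function $\rho$. In particular, there exist infinitely many nonradial functions satisfying the displayed conditions for the annulus $\Omega=\Omega_{a,b}:=\{x\in\mathbb{R}^N:0<a<|x|<b\}$.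
   Context: $\|\cdot\|_\infty$ denotes the norm of $L^\infty(\Omega)$. The ''Moreover'' sentence refers to the infinitely many functions whose existence is asserted: i.e., there is an infinite family of functions satisfying the displayed conditions, each member of which attains the value $1$ at exactly one point, that point being a maximum point of $\rho$. *)

(* Defs.v *)
From HB Require Import structures.
From mathcomp Require Import all_boot all_order all_algebra.
From mathcomp Require Import all_classical all_reals all_analysis.

Set Implicit Arguments.
Unset Strict Implicit.
Unset Printing Implicit Defensive.

Import Order.TTheory GRing.Theory Num.Theory.
Import numFieldNormedType.Exports.

Local Open Scope classical_set_scope.
Local Open Scope ring_scope.

(* R^n is 'rV[R]_n with the library topology.  The library norm on 'rV[R]_n is
   the sup norm (same topology), hence the separate Euclidean norm enorm. *)

Definition measure_rV_display : measure_display.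
Proof. exact: default_measure_display. Qed.

(* The sigma-algebra on 'rV[R]_n is generated by the coordinate maps, as the
   library does for n.-tuple R; it is the Borel sigma-algebra of R^n. *)
Section measurable_rV.
Context (R : realType) (n : nat).

Let coord (i : 'I_n) (x : 'rV[R]_n) : R := x ord0 i.

Let rV_set0 : g_sigma_preimage coord set0.
Proof. exact: sigma_algebra0. Qed.

Let rV_setC A : g_sigma_preimage coord A -> g_sigma_preimage coord (~` A).
Proof. exact: sigma_algebraC. Qed.

Let rV_bigcup (F : (set 'rV[R]_n)^nat) :
  (forall i, g_sigma_preimage coord (F i)) ->
  g_sigma_preimage coord (\bigcup_i (F i)).
Proof. exact: sigma_algebra_bigcup. Qed.

HB.instance Definition _ := @isMeasurable.Build measure_rV_display
  'rV[R]_n (g_sigma_preimage coord) rV_set0 rV_setC rV_bigcup.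

End measurable_rV.

Lemma measurable_coord_rV (R : realType) (n : nat) (i : 'I_n) :
  measurable_fun [set: 'rV[R]_n] (fun x => x ord0 i).
Proof.
move=> _ Y mY; rewrite setTI; apply: sub_sigma_algebra => /=.
rewrite -bigcup_seq/=; exists i => /=; first by rewrite mem_index_enum.
by exists Y => //; rewrite setTI.
Qed.

Lemma measurable_fun_rV (R : realType) (d : measure_display)
    (T : measurableType d) (n : nat) (f : T -> 'rV[R]_n) :
  (forall i, measurable_fun [set: T] (fun x => f x ord0 i)) ->
  measurable_fun [set: T] f.
Proof.
case: n f => [|n] f mf.
  apply: measurability => //= A [B].
  by rewrite big_ord0.
apply: measurability => //= A [B].
rewrite -bigcup_mkord_ord => -[i _ [C mC <-]] <-.
by rewrite setTI; exact: mf.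
Qed.

(* (v, t) |-> (t, v_0, ..., v_(n-1)) *)
Definition rV_cons (R : realType) (n : nat)
    (p : 'rV[R]_n * measurableTypeR R) : 'rV[R]_n.+1 :=
  row_mx (p.2 : R)%:M p.1.

Lemma measurable_rV_cons (R : realType) (n : nat) :
  measurable_fun [set: 'rV[R]_n * measurableTypeR R] (@rV_cons R n).
Proof.
apply: measurable_fun_rV => i; rewrite /rV_cons.
rewrite (_ : (fun p => _) = fun p : 'rV[R]_n * measurableTypeR R =>
    if @fintype.split 1 n i is inr j then p.1 ord0 j else p.2); last first.
  apply/funext => p; rewrite mxE; case: (fintype.split _) => // j.
  by rewrite (ord1 j) mxE eqxx mulr1n.
case: (fintype.split _) => [_|j]; first exact: measurable_snd.
apply: (@measurableT_comp _ _ _ _ _ _ (fun v : 'rV[R]_n => v ord0 j)) => //.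
exact: measurable_coord_rV.
Qed.

(* Lebesgue measure on R^n (on Borel sets), as an iterated product: the bundled
   measure pushforward (lebesgue_rV R n' \x lebesgue_measure) (@rV_cons R n').
   The canonical instance is written out because its measurability argument
   cannot be inferred. *)
Fixpoint lebesgue_rV (R : realType) (n : nat) :
    {measure set 'rV[R]_n -> \bar R} :=
  if n is n'.+1
  then measure_function_pushforward__canonical__measure_function_Measure
         (lebesgue_rV R n' \x @lebesgue_measure R)%E (@measurable_rV_cons R n')
  else dirac (0 : 'rV[R]_0).

Section euclidean_geometry.
Context (R : realType) (n : nat).
Implicit Types (x y : 'rV[R]_n) (Omega : set 'rV[R]_n) (f : 'rV[R]_n -> R).

Definition enorm x : R := Num.sqrt (\sum_(i < n) x ord0 i ^+ 2).

Definition boundary Omega : set 'rV[R]_n := closure Omega `\` Omega^°.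

Definition boundary_dist Omega x : R :=
  inf [set enorm (y - x) | y in boundary Omega].

Definition max_points_dist Omega : set 'rV[R]_n :=
  [set x | Omega x /\
    forall y, Omega y -> boundary_dist Omega y <= boundary_dist Omega x].

Definition annulus (a b : R) : set 'rV[R]_n := [set x | a < enorm x < b].

Definition domain Omega := [/\ open Omega, connected Omega & Omega !=set0].

Definition partial (i : 'I_n) f : 'rV[R]_n -> R :=
  fun x => 'D_(delta_mx ord0 i) f x.

Fixpoint Ck (k : nat) f : Prop :=
  continuous f /\
  if k is k'.+1 then
    forall i : 'I_n,
      (forall x, derivable f x (delta_mx ord0 i)) /\ Ck k' (partial i f)
  else True.

Definition smooth f := forall k, Ck k f.

End euclidean_geometry.

(* C^oo boundary: near each boundary point, up to relabelling and reorienting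
   the coordinate axes, Omega is the strict epigraph of a C^oo function of the
   n - 1 remaining coordinates (col' i y is y without its i-th coordinate). *)
Definition smooth_boundary (R : realType) (n : nat) (Omega : set 'rV[R]_n) :=
  forall x, boundary Omega x ->
  exists (r : R) (i : 'I_n) (s : bool) (gamma : 'rV[R]_n.-1 -> R),
    [/\ 0 < r, smooth gamma &
      forall y, enorm (y - x) < r ->
        (Omega y <-> gamma (col' i y) < (-1) ^+ s * y ord0 i)].

Section sobolev.
Context (R : realType) (n : nat) (Omega : set 'rV[R]_n).
Implicit Types (u phi : 'rV[R]_n -> R) (g : 'rV[R]_n -> 'rV[R]_n).
Implicit Types p : \bar R.

Local Notation mu := (lebesgue_rV R n).

(* Functions on Omega are represented by total functions, of which only the
   values on Omega are used below. *)

Definition test_function phi :=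
  [/\ smooth phi, compact (closure [set x | phi x != 0]) &
    closure [set x | phi x != 0] `<=` Omega].

Definition locally_integrable_on u :=
  measurable_fun Omega u /\
  forall K, compact K -> K `<=` Omega -> mu.-integrable K (EFin \o u).

Definition is_weak_gradient u g :=
  [/\ locally_integrable_on u,
    forall i, locally_integrable_on (fun x => g x ord0 i) &
    forall phi i, test_function phi ->
      \int[mu]_(x in Omega) (u x * partial i phi x) =
      - \int[mu]_(x in Omega) (g x ord0 i * phi x)].

(* The weak gradient is unique up to a.e. equality on Omega; this picks a
   representative of it when it exists. *)
Definition weak_gradient u : 'rV[R]_n -> 'rV[R]_n :=
  xget (fun=> 0) [set g | is_weak_gradient u g].

Definition Lp_norm p u : \bar R := 'N[mu]_p[EFin \o (u \_ Omega)]%E.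

Definition grad_norm p u : \bar R := Lp_norm p (@enorm R n \o weak_gradient u).

Definition sobolev p u :=
  [/\ measurable_fun Omega u, (Lp_norm p u < +oo)%E,
    exists g, is_weak_gradient u g & (grad_norm p u < +oo)%E].

Definition sobolev_norm p u : \bar R := (Lp_norm p u + grad_norm p u)%E.

(* Closure of C_c^oo(Omega) in W^{1,p}(Omega), to be used for finite p only. *)
Definition sobolev0 p u :=
  sobolev p u /\
  forall e : R, 0 < e -> exists2 phi, test_function phi &
    (sobolev_norm p (u \- phi)%R < e%:E)%E.

(* W_0^{1,oo}(Omega) = W^{1,oo}(Omega) `&` W_0^{1,1}(Omega); the closure of
   C_c^oo(Omega) in W^{1,oo}(Omega) would only contain C^1 functions. *)
Definition sobolev0_infty u := sobolev +oo%E u /\ sobolev0 1%E u.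

Definition is_minimum (S : set (\bar R)) (m : \bar R) :=
  S m /\ forall y, S y -> (m <= y)%E.

Definition extremal u :=
  [/\ {within closure Omega, continuous u},
    sobolev0_infty u,
    forall x, Omega x -> 0 < u x <= 1,
    Lp_norm +oo u = 1%E &
    is_minimum
      [set grad_norm +oo phi | phi in
        [set phi | sobolev0_infty phi /\ Lp_norm +oo phi = 1%E]]
      (grad_norm +oo u)].

(* Infinitely many elements of F remain distinct as functions on the closure
   of Omega. *)
Definition infinitely_many_on_closure (F : set ('rV[R]_n -> R)) :=
  infinite_set [set u \_ (closure Omega) | u in F].

Definition radial u := exists h : R -> R, forall x, Omega x -> u x = h (enorm x).

End sobolev.

(* Main.v *)
(* If phi is in W_0^{1,oo} and |grad phi| <= L a.e., then for every vector v one
   has |phi(x)| <= L |v| for almost every x in Omega such that x + v is outside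
   Omega (differentiate the integral over a translated set for the test functions
   approximating phi in W^{1,1}, and use the translation invariance of Lebesgue
   measure).  Taking countably many v and letting |v| decrease to the distance
   from x to the complement, |phi|_oo = 1 forces L >= 1/M, M being the maximum of
   the distance function.

   Conversely let x0 be a maximum point of the distance function, and let
   u = max(1 - |x - x0|/M, w), where w is a sum of countably many tiny smooth
   bumps whose positivity sets cover Omega, with w <= 1/2 and |grad w| <= 1/M.
   Then u > 0 on Omega, u = 1 only at x0, and |grad u| <= 1/M; thus u is extremal,
   and distinct maximum points give distinct extremals.  The smoothness of the
   boundary only serves to know that the exterior of Omega accumulates at every
   boundary point.

   In the annulus the maximum points form the sphere of radius (a + b)/2; a radial
   u would take the value 1 also at -x0. *)

Require Import Defs.
From HB Require Import structures.
From mathcomp Require Import all_boot all_order all_algebra.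
From mathcomp Require Import all_classical all_reals all_analysis.
From mathcomp Require Import measurable_realfun ess_sup_inf.
From mathcomp Require Import ring lra.

Set Implicit Arguments.
Unset Strict Implicit.
Unset Printing Implicit Defensive.

Import Order.TTheory GRing.Theory Num.Theory.
Import numFieldNormedType.Exports.

Local Open Scope classical_set_scope.
Local Open Scope ring_scope.

(** * Borel sets and Lebesgue measure on R^n *)

(** An element of W_0^{1,oo} is only a class of functions and has no values along a segment to the
    boundary, so the bound by L |v| cannot be read off a path; integrals over translated sets
    replace the path. The approximating test functions converge in W^{1,1} only, so their gradients
    may exceed L. What survives is that the excess (|grad psi| - L)^+ is small in L^1. The resulting
    bound holds a.e. for each single v, hence can be used for countably many v at once: this is why
    open exterior sets, which rational vectors must hit, are wanted near the boundary.

    For the upper bound, the gradient of a maximum with an infinite sum is not computed by Lipschitz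
    arguments. A sequence of test functions, with uniformly bounded values and partials that
    converge at every point, yields by dominated convergence both the weak gradient and membership
    in W_0^{1,1}. Convergence of the partials on the tie set of cone and w is what dictates a
    smoothed positive part vanishing slightly above 0. All smoothing comes from one family of real
    functions, [flat], closed under differentiation. *)

Section borel_rV.
Context (R : realType) (n : nat).
Local Notation V := 'rV[R]_n.

Lemma ball_rVE (x y : V) r : 0 < r ->
  ball x r y <-> forall i, `|x ord0 i - y ord0 i| < r.
Proof.
move=> r0; split=> [[_ h] i|h]; first exact: h.
by split=> // i j; rewrite (ord1 i); exact: h.
Qed.

Lemma ball_rV_measurable (x : V) r : measurable (ball x r).
Proof.
have [r0|r0] := ltP 0 r; last first.
  rewrite (_ : ball x r = set0); first exact: measurable0.
  by apply/seteqP; split=> // y [] /(le_lt_trans r0); rewrite ltxx.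
rewrite (_ : ball x r = \bigcap_(i in [set: 'I_n])
    ((fun y : V => y ord0 i) @^-1` ball (x ord0 i) r)).
  apply: fin_bigcap_measurable => // i _; rewrite -[X in measurable X]setTI.
  by apply: measurable_coord_rV => //; exact: measurable_ball.
apply/seteqP; split=> y; first by move=> [_ h] i _; exact: h.
by move=> h; apply/ball_rVE => // i; exact: h.
Qed.

(** Balls with rational centre and radius 1/(k+1) form a countable base: a radius below e / 2 and a
    rational centre that close to x keep the ball inside the e-ball of x. *)
Lemma rat_ball (x : V) (A : set V) : nbhs x A ->
  exists (q : 'rV[rat]_n) (k : nat),
    ball (map_mx ratr q : V) k.+1%:R^-1 x /\
    ball (map_mx ratr q : V) k.+1%:R^-1 `<=` A.
Proof.
move=> /nbhs_ballP[e /= e0 eA].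
have [k k2] : exists k : nat, k.+1%:R^-1 < e / 2.
  have := @near_infty_natSinv_lt R (PosNum (divr_gt0 e0 (@ltr0Sn R 1))).
  by move=> [k _ /(_ _ (leqnn _))] /=; exists k.
have k0 : (0 : R) < k.+1%:R^-1 by rewrite invr_gt0.
have qP i : exists q : rat, `|ratr q - x ord0 i| < k.+1%:R^-1.
  have /rat_in_itvoo[q] : x ord0 i - k.+1%:R^-1 < x ord0 i + k.+1%:R^-1.
    by rewrite ltrD2l gtrN.
  by rewrite in_itv/= -ltr_distl => ?; exists q.
pose q i := projT1 (cid (qP i)).
have qxb : ball (map_mx ratr (\row_i q i) : V) k.+1%:R^-1 x.
  by apply/ball_rVE => // i; rewrite !mxE; exact: projT2 (cid (qP i)).
exists (\row_i q i), k; split => // y qy; apply: eA.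
rewrite (splitr e); apply: (@ball_triangle _ _ (map_mx ratr (\row_i q i) : V)).
  exact/ball_sym/(le_ball (ltW k2)).
exact/(le_ball (ltW k2)).
Qed.

Lemma open_rV_measurable (U : set V) : open U -> measurable U.
Proof.
move=> oU.
pose F (p : 'rV[rat]_n * nat) : set V :=
  if `[< ball (map_mx ratr p.1 : V) p.2.+1%:R^-1 `<=` U >]
  then ball (map_mx ratr p.1 : V) p.2.+1%:R^-1 else set0.
rewrite (_ : U = \bigcup_p F p).
  apply: countable_bigcupT_measurable; first exact: countableP.
  move=> p; rewrite /F; case: ifP => _ //; exact: ball_rV_measurable.
apply/seteqP; split=> x.
  move=> Ux; have /rat_ball[q [k [qx qU]]] : nbhs x U by exact: open_nbhs_nbhs.
  by exists (q, k) => //; rewrite /F/= asboolT.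
by move=> [p _]; rewrite /F; case: ifP => // /asboolP; apply.
Qed.

Lemma closed_rV_measurable (A : set V) : closed A -> measurable A.
Proof.
by move=> cA; rewrite -[A]setCK; apply: measurableC; apply: open_rV_measurable;
  exact: closed_openC.
Qed.

Lemma continuous_rV_measurable (f : V -> R) D :
  continuous f -> measurable D -> measurable_fun D f.
Proof.
move=> /continuousP cf mD; apply: (measurability _ (RGenOpens.measurableE R)).
move=> _ [_ [a [b ->] <-]]; apply: measurableI => //.
by apply: open_rV_measurable; apply: cf; exact: interval_open.
Qed.

(** Open sets are stable under intersection, so this description of the sigma-algebra lets a Dynkin
    induction start from open sets. *)
Lemma rV_measurable_open : @measurable _ V = <<s @open V >>.
Proof.
apply/seteqP; split; last first.
  apply: smallest_sub; last exact: open_rV_measurable.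
  exact: sigma_algebra_measurable.
apply: smallest_sub; first exact: smallest_sigma_algebra.
move=> B; rewrite -bigcup_seq/= => -[i _] [C mC <-]; rewrite setTI.
suff: @measurable _ R `<=` image_set_system setT
    (fun x : V => x ord0 i) (<<s @open V >>) by move=> /(_ _ mC); rewrite /image_set_system/= setTI.
have -> : @measurable _ R = _ := RGenOpens.measurableE R.
apply: smallest_sub; first by apply: sigma_algebra_image; exact: smallest_sigma_algebra.
move=> _ [a [b ->]]; rewrite /image_set_system/= setTI.
apply: sub_sigma_algebra; apply: open_comp; last exact: interval_open.
by move=> x _; exact: coord_continuous.
Qed.

End borel_rV.

(** * Translation invariance of Lebesgue measure on R^n *)

Section lebesgue_rV_theory.
Context (R : realType).
Implicit Type n : nat.
Local Notation lambda := (@lebesgue_measure R).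

(** The pushforward under a translation gives every half-open interval its length, so uniqueness of
    Lebesgue measure identifies the two measures. *)
Lemma lebesgue_measure_shift (h : R) A : measurable A ->
  lambda ((fun x => x + h) @^-1` A) = lambda A.
Proof.
move=> mA.
have mh : measurable_fun [set: measurableTypeR R] (fun x : R => (x + h : measurableTypeR R)).
  by apply: continuous_measurable_fun => x; apply: cvgD; [exact: cvg_id|exact: cvg_cst].
have := @lebesgue_measure_unique R
  (measure_function_pushforward__canonical__measure_function_Measure lambda mh).
move=> /(_ _ A mA) -> // _ [[a b] _ <-].
transitivity (lambda `]a - h, b - h]%classic); last first.
  congr (lambda _).
  by apply/seteqP; split=> x /=; rewrite !in_itv/= ltrBlDr lerBrDr.
rewrite /= !lebesgue_measure_itv/= !lte_fin ltrD2r.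
by case: ifP => // _; rewrite -!EFinD opprB addrA subrK.
Qed.

Lemma measurable_shift_rV n (h : 'rV[R]_n) :
  measurable_fun [set: 'rV[R]_n] (fun x => x + h).
Proof.
apply: measurable_fun_rV => i; rewrite [X in measurable_fun _ X](_ : _ = fun x : 'rV[R]_n => x ord0 i + h ord0 i).
  by apply: measurable_funD => //; exact: measurable_coord_rV.
by apply/funext => x; rewrite mxE.
Qed.

Lemma rV_cons0 n (p : 'rV[R]_n * measurableTypeR R) : rV_cons p ord0 ord0 = p.2.
Proof.
rewrite /rV_cons (_ : ord0 = lshift n (@ord0 0)); last exact/val_inj.
by apply: (etrans (row_mxEl _ _ _ _)); rewrite mxE eqxx mulr1n.
Qed.

Lemma rV_cons_lift n (p : 'rV[R]_n * measurableTypeR R) j :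
  rV_cons p ord0 (lift ord0 j) = p.1 ord0 j.
Proof.
rewrite /rV_cons (_ : lift ord0 j = rshift 1 j); last exact/val_inj.
exact: row_mxEr.
Qed.

Lemma rV_consD n (v : 'rV[R]_n) (t : R) (h : 'rV[R]_n.+1) :
  rV_cons (v, t) + h = rV_cons (v + rsubmx (h : 'rV_(1 + n)), t + h ord0 ord0).
Proof.
apply/rowP => i; rewrite mxE; have [j ->|->] := unliftP ord0 i.
  rewrite !rV_cons_lift !mxE; congr (_ + h _ _); exact/val_inj.
by rewrite !rV_cons0.
Qed.

Lemma lebesgue_rVS n (A : set 'rV[R]_n.+1) :
  lebesgue_rV R n.+1 A = (\int[lebesgue_rV R n]_v lambda (xsection (@rV_cons R n @^-1` A) v))%E.
Proof. by []. Qed.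

(** Induction on the dimension. In each section the shift of the first coordinate disappears by the
    one-dimensional case; the shift of the other coordinates is a change of variables in the outer
    integral, whose pushforward measure is the original one by induction. *)
Lemma lebesgue_rV_shift n (h : 'rV[R]_n) A : measurable A ->
  lebesgue_rV R n ((fun x => x + h) @^-1` A) = lebesgue_rV R n A.
Proof.
elim: n h A => [|n IH] h A mA.
  congr (lebesgue_rV R 0 _); apply/seteqP.
  by split => x /=; rewrite (thinmx0 x) (thinmx0 (_ + h)).
rewrite !lebesgue_rVS.
pose B := @rV_cons R n @^-1` A.
have mB : measurable B by rewrite -[B]setTI; exact: measurable_rV_cons.
pose F v := lambda (xsection B v).
have mF : measurable_fun setT F by exact: measurable_fun_xsection.
transitivity (\int[lebesgue_rV R n]_v F ((v : 'rV[R]_n) + rsubmx (h : 'rV_(1 + n)))%R)%E.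
  apply: eq_integral => v _.
  rewrite /F -(@lebesgue_measure_shift (h ord0 ord0) (xsection B _)); last exact: measurable_xsection.
  by congr (lambda _); apply/seteqP; split=> t /=; rewrite /xsection/= !inE /B/= rV_consD.
have mh := measurable_shift_rV (rsubmx (h : 'rV_(1 + n))).
transitivity (\int[pushforward (lebesgue_rV R n) (fun v : 'rV[R]_n => v + rsubmx (h : 'rV_(1 + n)))%R]_v F v)%E.
  by rewrite (ge0_integral_pushforward mh)// => v _; exact: measure_ge0.
by apply: eq_measure_integral => C mC _; exact: IH.
Qed.

Lemma lebesgue_rV_box n (r : R) : 0 <= r ->
  lebesgue_rV R n [set x | forall i, `|x ord0 i| < r] = ((r *+ 2) ^+ n)%:E.
Proof.
move=> r0; elim: n => [|n IH].
  by rewrite /= diracE mem_set//= => -[].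
transitivity ((lebesgue_rV R n \x lambda)
    ([set x : 'rV[R]_n | forall i, (`|x ord0 i| < r)%R] `*` ball (0%R : R) r))%E.
  congr ((lebesgue_rV R n \x lambda) _)%E; apply/seteqP; split=> [[v t]/= h|[v t]/= [h ht] i].
    split=> [i|]; first by rewrite -(rV_cons_lift (v, t)); exact: h.
    by have := h ord0; rewrite rV_cons0 /ball/= sub0r normrN.
  have [j ->|->] := unliftP ord0 i; first by rewrite rV_cons_lift; exact: h.
  by move: ht; rewrite rV_cons0 /ball/= sub0r normrN.
rewrite product_measure1E//; last exact: measurable_ball.
  by rewrite [X in (X * _)%E]IH [X in (_ * X)%E]lebesgue_measure_ball// -EFinM exprSr.
rewrite (_ : mkset _ = \bigcap_(i in [set: 'I_n])
    ((fun y : 'rV[R]_n => y ord0 i) @^-1` ball 0 r)).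
  apply: fin_bigcap_measurable => // i _; rewrite -[X in measurable X]setTI.
  by apply: measurable_coord_rV => //; exact: measurable_ball.
by apply/seteqP; split=> y h i => [_|]; have := h i; rewrite /ball/= sub0r normrN//; exact.
Qed.

Lemma lebesgue_rV_ball n (x : 'rV[R]_n) (r : R) : 0 < r ->
  lebesgue_rV R n (ball x r) = ((r *+ 2) ^+ n)%:E.
Proof.
move=> r0; rewrite -(lebesgue_rV_shift x); last exact: ball_rV_measurable.
rewrite -lebesgue_rV_box ?ltW//; congr (lebesgue_rV R n _).
apply/seteqP; split=> [y /ball_rVE - /(_ r0) h i|y /= h].
  by have := h i; rewrite mxE opprD addrCA subrr addr0 normrN.
by apply/ball_rVE => // i; rewrite mxE opprD addrCA subrr addr0 normrN.
Qed.

Lemma lebesgue_rV_open_gt0 n (A : set 'rV[R]_n) : open A -> A !=set0 ->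
  (0 < lebesgue_rV R n A)%E.
Proof.
move=> oA [x Ax]; have /nbhs_ballP[r /= r0 rA] : nbhs x A by exact: open_nbhs_nbhs.
apply: (@lt_le_trans _ _ (lebesgue_rV R n (ball x r))).
  by rewrite lebesgue_rV_ball// lte_fin exprn_gt0// pmulrn_lgt0.
by apply: le_measure => //; rewrite inE; [exact: ball_rV_measurable|exact: open_rV_measurable].
Qed.

Lemma bounded_rV_ball n (A : set 'rV[R]_n) : bounded_set A ->
  exists2 r, 0 < r & A `<=` ball 0 r.
Proof.
move=> /pinfty_ex_gt0[M M0 MA]; exists (M + 1); first by rewrite addr_gt0.
move=> x /MA xM; rewrite -ball_normE/= sub0r normrN.
by rewrite (le_lt_trans xM)// ltrDl.
Qed.

Lemma lebesgue_rV_bounded n (A : set 'rV[R]_n) : measurable A -> bounded_set A ->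
  (lebesgue_rV R n A < +oo)%E.
Proof.
move=> mA /bounded_rV_ball[r r0 Ar].
apply: (@le_lt_trans _ _ (lebesgue_rV R n (ball 0 r))).
  by apply: le_measure => //; rewrite inE//; exact: ball_rV_measurable.
by rewrite lebesgue_rV_ball// ltry.
Qed.

Lemma ge0_integral_rV_shift n (h : 'rV[R]_n) D (f : 'rV[R]_n -> \bar R) :
  measurable D -> measurable_fun setT f -> (forall x, (0 <= f x)%E) ->
  (\int[lebesgue_rV R n]_(x in (fun x => x + h)%R @^-1` D) f (x + h)%R =
   \int[lebesgue_rV R n]_(x in D) f x)%E.
Proof.
move=> mD mf f0; have mh := measurable_shift_rV h.
transitivity (\int[pushforward (lebesgue_rV R n) (fun v : 'rV[R]_n => v + h)%R]_(x in D) f x)%E.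
  by rewrite (ge0_integral_pushforward mh)//; exact: measurable_funTS.
by apply: eq_measure_integral => C mC _; exact: lebesgue_rV_shift.
Qed.

Lemma integral_rV_shift n (h : 'rV[R]_n) (f : 'rV[R]_n -> \bar R) :
  measurable_fun setT f ->
  (\int[lebesgue_rV R n]_x f (x + h)%R = \int[lebesgue_rV R n]_x f x)%E.
Proof.
move=> mf; rewrite integralE [RHS]integralE; congr (_ - _)%E.
- have := @ge0_integral_rV_shift n h setT (f^\+)%E; rewrite preimage_setT.
  move=> H; apply: etrans (H _ _ _) => //; last exact: measurable_funepos.
  by apply: eq_integral => x _; rewrite !funeposE.
- have := @ge0_integral_rV_shift n h setT (f^\-)%E; rewrite preimage_setT.
  move=> H; apply: etrans (H _ _ _) => //; last exact: measurable_funeneg.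
  by apply: eq_integral => x _; rewrite !funenegE.
Qed.

End lebesgue_rV_theory.

(** * C^k functions *)

Section line_derivative.
Context (R : realType) (V : normedModType R).
Implicit Types (f g : V -> R) (x v : V).

(** Reduces directional derivatives to derivatives in one real variable, where the chain rule and
    the mean value theorem apply. *)
Lemma is_derive_line f x v d : is_derive x v f d <->
  is_derive (0 : R) (1 : R) (fun s : R => f (s *: v + x)) d.
Proof.
have e : (fun h : R => h^-1 *: (f (h *: v + x) - f x)) =
    (fun h : R => h^-1 *: (((fun s : R => f (s *: v + x)) \o shift (0 : R)) (h *: (1 : R)) -
      (fun s : R => f (s *: v + x)) 0)).
  by apply/funext => h /=; rewrite addr0 scale0r add0r [_%:A]mulr1.
have ed : derivable f x v <-> derivable (fun s : R => f (s *: v + x)) 0 1.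
  exact: derivable1P.
have eD : 'D_v f x = 'D_1 (fun s : R => f (s *: v + x)) 0 by rewrite /derive -e.
split=> -[h <-]; first by split; [exact: ed.1 h|exact/esym].
by split; [exact: ed.2 h|exact: eD].
Qed.

Lemma is_derive_comp1 f x v d (h : R -> R) d' :
  is_derive x v f d -> is_derive (f x) (1 : R) h d' ->
  is_derive x v (h \o f) (d' * d).
Proof.
move=> /is_derive_line fd hd; apply/is_derive_line.
have hd' : is_derive (f (0 *: v + x)) (1 : R) h d' by rewrite scale0r add0r.
exact: (@is_derive1_comp _ h (fun s : R => f (s *: v + x)) 0 d' d).
Qed.

Lemma is_derive_shift_line f x v s d : is_derive (s *: v + x) v f d ->
  is_derive s (1 : R) (fun t : R => f (t *: v + x)) d.
Proof.
move=> /is_derive_line fd.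
have e : (fun t : R => f (t *: v + x)) =
    (fun u : R => f (u *: v + (s *: v + x))) \o (fun t => t - s).
  by apply/funext => t /=; rewrite addrA -scalerDl subrK.
rewrite e -[d]mulr1.
apply: (@is_derive1_comp _ (fun u : R => f (u *: v + (s *: v + x))) (fun t => t - s)).
  by rewrite subrr.
by apply: is_derive_eq; rewrite ?subr0.
Qed.

End line_derivative.

(** Only points of [I] are constrained, so that real powers qualify on t > 0. The derivative is an
    existential witness, which lets inductions work with closed formulas. *)
Fixpoint Ck_on (R : realType) (I : set R) (k : nat) (h : R -> R) : Prop :=
  (forall t, I t -> {for t, continuous h}) /\
  if k is k'.+1 then
    exists2 h' : R -> R, (forall t, I t -> is_derive t (1 : R) h (h' t)) & Ck_on I k' h'
  else True.

Section Ck_theory.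
Context (R : realType) (n : nat).
Local Notation V := 'rV[R]_n.
Implicit Types (f g : V -> R) (x v : V).
Local Notation "''e_' i" := (delta_mx ord0 i : V) (at level 8, i at level 2, format "''e_' i").

Lemma Ck_continuous k f : Ck k f -> continuous f.
Proof. by case: k => [|k] []. Qed.

Lemma CkS k f : Ck k.+1 f -> Ck k f.
Proof.
elim: k f => [|k IH] f [cf h]; first by split.
by split=> // i; have [df /IH Cf] := h i.
Qed.

Lemma Ck_derivable k f i x : Ck k.+1 f -> is_derive x 'e_i f (partial i f x).
Proof. by move=> [_ /(_ i)[df _]]; apply: derivableP. Qed.

Lemma Ck_partial k f i : Ck k.+1 f -> Ck k (partial i f).
Proof. by move=> [_ /(_ i)[]]. Qed.

Lemma CkP k f (df : 'I_n -> V -> R) : continuous f ->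
  (forall i x, is_derive x 'e_i f (df i x)) -> (forall i, Ck k (df i)) ->
  Ck k.+1 f.
Proof.
move=> cf fdf Cdf; split=> // i; split=> [x|]; first by have [] := fdf i x.
suff -> : partial i f = df i by exact: Cdf.
by apply/funext => x; have [_ <-] := fdf i x.
Qed.

Lemma Ck_cst k (c : R) : Ck k (cst c : V -> R).
Proof.
elim: k c => [|k IH] c; first by split=> //; exact: cst_continuous.
apply: (@CkP _ _ (fun _ => cst 0)) => //; exact: cst_continuous.
Qed.

Lemma is_derive_coord (j : 'I_n) x v :
  is_derive x v (fun y : V => y ord0 j) (v ord0 j).
Proof.
apply/is_derive_line; rewrite [X in is_derive _ _ X _](_ : _ = fun s : R => s * v ord0 j + x ord0 j).
  apply: is_derive_eq; rewrite addr0 scaler0 add0r; exact: mulr1.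
by apply/funext => s; rewrite !mxE.
Qed.

Lemma Ck_coord k (j : 'I_n) : Ck k (fun x : V => x ord0 j).
Proof.
case: k => [|k]; first by split=> // x; exact: coord_continuous.
apply: (@CkP _ _ (fun i => cst (('e_i : V) ord0 j))).
- by move=> x; exact: coord_continuous.
- by move=> i x; exact: is_derive_coord.
- by move=> i; exact: Ck_cst.
Qed.

Lemma CkD k f g : Ck k f -> Ck k g -> Ck k (fun x => f x + g x).
Proof.
elim: k f g => [|k IH] f g Cf Cg.
  by split=> // x; apply: (@continuousD _ _ _ f g x); [exact: (Ck_continuous Cf)|exact: (Ck_continuous Cg)].
apply: (@CkP _ _ (fun i x => partial i f x + partial i g x)).
- by move=> x; apply: (@continuousD _ _ _ f g x); [exact: (Ck_continuous Cf)|exact: (Ck_continuous Cg)].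
- by move=> i x; exact: is_deriveD (Ck_derivable _ _ Cf) (Ck_derivable _ _ Cg).
- by move=> i; apply: IH; exact: Ck_partial.
Qed.

Lemma CkM k f g : Ck k f -> Ck k g -> Ck k (fun x => f x * g x).
Proof.
elim: k f g => [|k IH] f g Cf Cg.
  by split=> // x; apply: (@continuousM _ _ f g); [exact: (Ck_continuous Cf)|exact: (Ck_continuous Cg)].
apply: (@CkP _ _ (fun i x => f x * partial i g x + g x * partial i f x)).
- by move=> x; apply: (@continuousM _ _ f g); [exact: (Ck_continuous Cf)|exact: (Ck_continuous Cg)].
- by move=> i x; exact: is_deriveM (Ck_derivable _ _ Cf) (Ck_derivable _ _ Cg).
- by move=> i; apply: CkD; apply: IH; try exact: Ck_partial; exact: CkS.
Qed.

Lemma CkZ k (c : R) f : Ck k f -> Ck k (fun x => c * f x).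
Proof. by move=> Cf; apply: CkM => //; exact: Ck_cst. Qed.

Lemma CkB k f g : Ck k f -> Ck k g -> Ck k (fun x => f x - g x).
Proof.
move=> Cf Cg; rewrite (_ : (fun x => _) = fun x => f x + -1 * g x).
  by apply: CkD => //; exact: CkZ.
by apply/funext => x; rewrite mulN1r.
Qed.

Lemma Ck_sum k (I : Type) (r : seq I) (P : pred I) (f : I -> V -> R) :
  (forall i, P i -> Ck k (f i)) -> Ck k (fun x => \sum_(i <- r | P i) f i x).
Proof.
move=> Cf; elim: r => [|i r IH].
  by under eq_fun do rewrite big_nil; exact: Ck_cst.
under eq_fun do rewrite big_cons.
by case Pi : (P i) => //; apply: CkD => //; exact: Cf.
Qed.

Lemma Ck_comp k (I : set R) (h : R -> R) f : Ck_on I k h ->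
  (forall x, I (f x)) -> Ck k f -> Ck k (h \o f).
Proof.
move=> + If; elim: k h f If => [|k IH] h f If Ch Cf.
  by split=> // x; apply: continuous_comp; [exact: (Ck_continuous Cf)|apply: Ch.1].
have [ch [h' hh' Ch']] := Ch.
apply: (@CkP _ _ (fun i x => h' (f x) * partial i f x)).
- by move=> x; apply: continuous_comp; [exact: (Ck_continuous Cf)|apply: ch].
- move=> i x; apply: is_derive_comp1; last exact: hh'.
  exact: Ck_derivable Cf.
- move=> i; apply: CkM; last exact: Ck_partial.
  by apply: (IH h' f) => //; exact: CkS.
Qed.

End Ck_theory.

(** * Smoothness of real powers and of exp(-1/t) *)

Section smooth_real.
Context (R : realType).
Implicit Types (I : set R) (h : R -> R).

Lemma Ck_onD I k h g : Ck_on I k h -> Ck_on I k g -> Ck_on I k (fun t => h t + g t).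
Proof.
elim: k h g => [|k IH] h g [ch dh] [cg dg]; split.
- by move=> t It; apply: cvgD; [exact: ch|exact: cg].
- by [].
- by move=> t It; apply: cvgD; [exact: ch|exact: cg].
- have [h' hd Ch] := dh; have [g' gd Cg] := dg.
  exists (fun t => h' t + g' t); last exact: IH.
  by move=> t It; apply: is_deriveD; [exact: hd|exact: gd].
Qed.

Lemma Ck_onZ I k c h : Ck_on I k h -> Ck_on I k (fun t => c * h t).
Proof.
elim: k h => [|k IH] h [ch dh]; split.
- by move=> t It; apply: cvgMr; exact: ch.
- by [].
- by move=> t It; apply: cvgMr; exact: ch.
- have [h' hd Ch] := dh; exists (fun t => c * h' t); last exact: IH.
  by move=> t It; apply: is_deriveZ; exact: hd.
Qed.

Lemma is_derive1_continuous h t d : is_derive t (1 : R) h d -> {for t, continuous h}.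
Proof. by move=> [hd _]; apply/differentiable_continuous/derivable1_diffP. Qed.

(** Differentiation lowers the exponent by 1, so the induction on k treats all exponents at once. *)
Lemma Ck_on_powR k (a : R) : Ck_on [set t | 0 < t] k (@powR R ^~ a).
Proof.
elim: k a => [|k IH] a; (split; first by move=> t t0; apply: is_derive1_continuous (is_derive1_powR a t0)).
  by [].
exists (fun t => a * t `^ (a - 1)); last exact: Ck_onZ.
by move=> t t0; exact: is_derive1_powR.
Qed.

(* On t > 0, flat m = t^(1-m) exp(-1/t).  Its derivative is
   (1 - m) flat (m+1) + flat (m+2), so that all of them are smooth by a single
   induction; flat 1 is the usual exp(-1/t). *)
Definition flat (m : nat) (t : R) : R :=
  if 0 < t then t `^ (1 - m%:R) * expR (- t^-1) else 0.

(** With y = s / (k+1), exp(s) is the (k+1)-th power of exp(y), and exp(y) >= 1 + y >= y. *)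
Lemma expR_ge_pow (k : nat) (s : R) : 0 <= s ->
  (s / k.+1%:R) ^+ k.+1 <= expR s.
Proof.
move=> s0; have k0 : (0 : R) < k.+1%:R by [].
rewrite -[in leRHS](divfK (lt0r_neq0 k0) s) [in leRHS]mulrC expRM_natl.
have sk : 0 <= s / k.+1%:R by rewrite divr_ge0.
apply: lerXn2r; rewrite ?nnegrE ?expR_ge0//.
by apply: le_trans (expR_ge1Dx _); rewrite lerDr.
Qed.

Lemma powR_1Bn m (t : R) : 0 < t -> t `^ (1 - m%:R) = t * t^-1 ^+ m.
Proof.
by move=> t0; rewrite powRD ?lt0r_neq0 ?implybT// powRr1 ?ltW// powRN powR_mulrn ?ltW// exprVn.
Qed.

(** The previous bound at s = 1/t gives exp(-1/t) <= ((m+1) t)^(m+1), and the factor t^(1-m) leaves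
    t^2. Order two is exactly what makes the derivative at 0 exist and vanish. *)
Lemma flat_bound m t : 0 < t ->
  0 <= flat m t <= m.+1%:R ^+ m.+1 * t ^+ 2.
Proof.
move=> t0; rewrite /flat t0 powR_1Bn//; have k0 : (0 : R) < m.+1%:R by [].
have ti : 0 < t^-1 by rewrite invr_gt0.
apply/andP; split.
  by rewrite !mulr_ge0 ?expR_ge0 ?exprn_ge0 ?ltW.
have := @expR_ge_pow m _ (ltW ti).
have p0 : 0 < (t^-1 / m.+1%:R) ^+ m.+1 by rewrite exprn_gt0// divr_gt0.
rewrite -lef_pV2 ?posrE ?expR_gt0// -expRN => h.
rewrite (le_trans (ler_wpM2l _ h))//; first by rewrite mulr_ge0 ?exprn_ge0 ?ltW.
rewrite expr_div_n exprS; set P := t^-1 ^+ m; set C := _ ^+ m.+1.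
have P0 : P != 0 by rewrite lt0r_neq0// exprn_gt0.
have C0 : C != 0 by rewrite lt0r_neq0// exprn_gt0.
rewrite le_eqVlt; apply/orP; left; apply/eqP; field.
by rewrite P0 C0 lt0r_neq0.
Qed.

Lemma is_derive_flat m t :
  is_derive t (1 : R) (flat m) ((1 - m%:R) * flat m.+1 t + flat m.+2 t).
Proof.
have [t0|t0|t0] := ltgtP 0 t.
- apply: (@near_eq_is_derive R R R (fun u => u `^ (1 - m%:R) * expR (- u^-1))).
    near=> u; rewrite /flat ifT//; near: u; exact: lt_nbhsr.
  have t1 : t != 0 by rewrite lt0r_neq0.
  have dV := @is_deriveV R id t 1 1 t1 (is_derive_id t 1).
  have dE : is_derive t (1 : R) (fun u => expR (- u^-1)) (expR (- t^-1) * t ^- 2).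
    apply: (@is_derive1_comp _ expR (fun u => - u^-1)).
    by apply: is_derive_eq; rewrite scaleNr opprK [LHS]mulr1.
  have dP := is_derive1_powR (1 - m%:R) t0.
  apply: (is_derive_eq (is_deriveM dP dE)).
  rewrite /flat t0.
  have -> : t `^ (1 - m.+1%:R) = t `^ (1 - m%:R - 1) by congr (_ `^ _); rewrite -natr1; ring.
  have -> : t `^ (1 - m.+2%:R) = t `^ (1 - m%:R) * t ^- 2.
    by rewrite !powR_1Bn// -addn2 exprD !exprVn mulrA.
  rewrite /GRing.scale/=; ring.
- apply: (@near_eq_is_derive R R R (cst 0)).
    near=> u; rewrite /flat ltNge ifF//; apply/negbTE; rewrite negbK; apply/ltW.
    near: u; exact: lt_nbhsl.
  by rewrite /flat !ltNge !(ltW t0)/= mulr0 addr0; exact: is_derive_cst.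
(* At 0 the difference quotient is 0 from the left, and from the right at most a constant times h by
   [flat_bound]. *)
- rewrite -t0 /flat ltxx mulr0 addr0.
  suff H : (fun h : R => h^-1 *: ((flat m \o shift 0) (h *: 1) - flat m 0)) @ 0^' --> (0 : R).
    by split; [exact: (cvgP 0)|exact/cvg_lim].
  apply/cvgrPdist_le => e e0; near=> h.
  rewrite /= addr0 [h *: 1]mulr1 {2}/flat ltxx subr0 sub0r normrN /GRing.scale/= normrM normfV.
  have h1 : h != 0 by near: h; exact: nbhs_dnbhs_neq.
  have [h0|h0] := ltP 0 h; last by rewrite /flat ltNge h0/= normr0 mulr0 ltW.
  rewrite (gtr0_norm h0) ler_pdivrMl//.
  have /andP[f0 fb] := flat_bound m h0; rewrite ger0_norm// (le_trans fb)// expr2 mulrCA ler_pM2l//.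
  rewrite -ler_pdivlMl ?exprn_gt0// (le_trans (ler_norm _))//; near: h.
  apply: nbhs_dnbhs; apply: (@nbhs0_le R R); first by rewrite mulr_gt0// invr_gt0 exprn_gt0.
Unshelve. all: by end_near. Qed.

Lemma Ck_on_flat k m : Ck_on setT k (flat m).
Proof.
elim: k m => [|k IH] m; (split; first by move=> t _; apply: is_derive1_continuous (is_derive_flat m t)).
  by [].
exists (fun t => (1 - m%:R) * flat m.+1 t + flat m.+2 t).
  by move=> t _; exact: is_derive_flat.
by apply: Ck_onD => //; exact: Ck_onZ.
Qed.

End smooth_real.

(** * The Euclidean norm *)

Section enorm_theory.
Context (R : realType) (n : nat).
Local Notation V := 'rV[R]_n.
Implicit Types x y : V.

Lemma sqr_sum_ge0 x : 0 <= \sum_i x ord0 i ^+ 2.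
Proof. by apply: sumr_ge0 => i _; exact: sqr_ge0. Qed.

Lemma sqr_enorm x : enorm x ^+ 2 = \sum_i x ord0 i ^+ 2.
Proof. by rewrite sqr_sqrtr// sqr_sum_ge0. Qed.

Lemma enorm_ge0 x : 0 <= enorm x. Proof. exact: sqrtr_ge0. Qed.

Lemma ler_coord_enorm x i : `|x ord0 i| <= enorm x.
Proof.
rewrite -sqrtr_sqr ler_sqrt ?sqr_sum_ge0// (bigD1 i)//= lerDl.
by apply: sumr_ge0 => j _; exact: sqr_ge0.
Qed.

Lemma enorm0 : enorm (0 : V) = 0.
Proof.
rewrite /enorm (_ : \sum_i _ = 0) ?sqrtr0//.
by apply: big1 => i _; rewrite mxE expr0n.
Qed.

Lemma enorm_eq0 x : enorm x = 0 -> x = 0.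
Proof.
move=> x0; apply/rowP => i; rewrite mxE; apply/eqP; rewrite -normr_le0.
by rewrite -x0 ler_coord_enorm.
Qed.

Lemma enormZ (a : R) x : enorm (a *: x) = `|a| * enorm x.
Proof.
rewrite /enorm -sqrtr_sqr -sqrtrM ?sqr_ge0// mulr_sumr; congr Num.sqrt.
by apply: eq_bigr => i _; rewrite mxE exprMn.
Qed.

Lemma enormN x : enorm (- x) = enorm x.
Proof. by rewrite -scaleN1r enormZ normrN1 mul1r. Qed.

Lemma enormB x y : enorm (x - y) = enorm (y - x).
Proof. by rewrite -enormN opprB. Qed.

Lemma enorm_CS x y : \sum_i x ord0 i * y ord0 i <= enorm x * enorm y.
Proof.
have [x0|x0] := eqVneq (enorm x) 0.
  rewrite x0 mul0r (enorm_eq0 x0) big1// => i _; by rewrite mxE mul0r.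
have [y0|y0] := eqVneq (enorm y) 0.
  rewrite y0 mulr0 (enorm_eq0 y0) big1// => i _; by rewrite mxE mulr0.
have ab0 : 0 < enorm x * enorm y by rewrite mulr_gt0// lt_neqAle eq_sym ?x0 ?y0 enorm_ge0.
(* Expanded, this sum is 2 |x||y| (|x||y| - x.y), so its sign gives the inequality once both norms
   are nonzero. *)
have : 0 <= \sum_i (enorm y * x ord0 i - enorm x * y ord0 i) ^+ 2.
  by apply: sumr_ge0 => i _; exact: sqr_ge0.
rewrite (_ : \sum_i _ = (enorm x * enorm y) * (2 * (enorm x * enorm y - \sum_i x ord0 i * y ord0 i))).
  by rewrite pmulr_rge0// pmulr_rge0// subr_ge0.
transitivity (enorm y ^+ 2 * (\sum_i x ord0 i ^+ 2) + enorm x ^+ 2 * (\sum_i y ord0 i ^+ 2)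
   - (enorm x * enorm y) * 2 * \sum_i x ord0 i * y ord0 i).
  rewrite !mulr_sumr -big_split/= -sumrB; apply: eq_bigr => i _; ring.
rewrite -!sqr_enorm; ring.
Qed.

Lemma enorm_CS_norm x y : `|\sum_i x ord0 i * y ord0 i| <= enorm x * enorm y.
Proof.
rewrite ler_norml enorm_CS andbT lerNl -[enorm x]enormN.
apply: le_trans (enorm_CS _ _); rewrite -sumrN le_eqVlt; apply/orP; left.
by apply/eqP/eq_bigr => i _; rewrite mxE mulNr.
Qed.

Lemma ler_enormD x y : enorm (x + y) <= enorm x + enorm y.
Proof.
rewrite -(@ler_pXn2r _ 2) ?nnegrE ?addr_ge0 ?enorm_ge0//.
rewrite sqrrD !sqr_enorm.
rewrite (_ : \sum_i (x + y) ord0 i ^+ 2 = \sum_i x ord0 i ^+ 2 +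
   (\sum_i x ord0 i * y ord0 i) *+ 2 + \sum_i y ord0 i ^+ 2).
  by rewrite lerD2r lerD2l lerMn2r enorm_CS orbT.
rewrite -sumrMnl -!big_split/=; apply: eq_bigr => i _; rewrite mxE; ring.
Qed.

Lemma ler_enormB x y : `|enorm x - enorm y| <= enorm (x - y).
Proof.
rewrite ler_distl; apply/andP; split.
  by rewrite lerBlDr -[leLHS](congr1 (@enorm R n) (subrK x y)) addrC enormB ler_enormD.
by rewrite addrC -[leLHS](congr1 (@enorm R n) (subrK y x)) ler_enormD.
Qed.

Lemma continuous_enorm : continuous (@enorm R n).
Proof.
move=> x; apply: (@continuous_comp _ _ _ (fun y : V => \sum_i y ord0 i ^+ 2) Num.sqrt).
  apply: (@Ck_continuous R n 0).
  by apply: Ck_sum => i _; under eq_fun do rewrite expr2; apply: CkM; exact: Ck_coord.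
exact: sqrt_continuous.
Qed.

Lemma ler_norm_enorm x : `|x| <= enorm x.
Proof.
rewrite [leLHS]mx_normrE; apply/bigmax_leP; split; first exact: enorm_ge0.
by move=> [i j] _ /=; rewrite (ord1 i) ler_coord_enorm.
Qed.

Lemma enorm_ball_nbhs x r : 0 < r -> nbhs x [set y | enorm (y - x) < r].
Proof.
move=> r0; have c : continuous (fun y : V => enorm (y - x)).
  move=> y; apply: (@continuous_comp _ _ _ (fun y : V => y - x) (@enorm R n)); last exact: continuous_enorm.
  by apply: (@continuousB _ _ _ id (cst x)); [exact: cvg_id|exact: cst_continuous].
have := c x; move/cvgrPdist_lt => /(_ r r0); apply: filterS => y /=.
by rewrite subrr enorm0 sub0r normrN ger0_norm ?enorm_ge0.
Qed.

Lemma enorm_bounded (A : set V) (r : R) : (forall x, A x -> enorm x <= r) -> bounded_set A.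
Proof.
move=> Ar; exists r; split; first exact: num_real.
by move=> M rM x Ax /=; rewrite (le_trans (ler_norm_enorm x))// (le_trans (Ar _ Ax))// ltW.
Qed.

End enorm_theory.

(** * Directional derivatives of C^1 functions *)

Section C1.
Context (R : realType) (n : nat).
Local Notation V := 'rV[R]_n.
Implicit Types (f : V -> R) (x y v w : V).

Lemma MVT_line f (df : V -> R) v y (c : R) :
  (forall s : R, is_derive (s *: v + y) v f (df (s *: v + y))) ->
  exists2 s : R, `|s| <= `|c| & f (c *: v + y) - f y = df (s *: v + y) * c.
Proof.
move=> fd; pose g (s : R) := f (s *: v + y).
have gd s : is_derive s (1 : R) g (df (s *: v + y)) by exact: is_derive_shift_line.
have cg : continuous g by move=> s; exact: is_derive1_continuous (gd s).
have g0 : g 0 = f y by rewrite /g scale0r add0r.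
have [c0|/ltW c0] := leP 0 c.
  have [s + E] := @MVT_segment R g (fun s => df (s *: v + y)) 0 c c0
     (fun s _ => gd s) (continuous_subspaceT cg).
  rewrite in_itv/= => /andP[s0 sc]; exists s; first by rewrite !ger0_norm.
  by rewrite -g0 [LHS]E subr0.
have [s + E] := @MVT_segment R g (fun s => df (s *: v + y)) c 0 c0
   (fun s _ => gd s) (continuous_subspaceT cg).
rewrite in_itv/= => /andP[s0 sc]; exists s; first by rewrite !ler0_norm// lerN2.
by rewrite -g0 -opprB [X in - X]E sub0r mulrN opprK.
Qed.

(** The increment splits at h w + x. The part along w is known; the remaining part, along the j-th
    axis, is by the mean value theorem h a times [partial j f] at a point tending to x. *)
Lemma is_derive_C1_step f x w d (a : R) (j : 'I_n) : Ck 1 f ->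
  is_derive x w f d ->
  is_derive x (w + a *: delta_mx ord0 j) f (d + a * partial j f x).
Proof.
move=> Cf [fw fd]; have cp := Ck_continuous (Ck_partial j Cf).
pose B (h : R) := h^-1 * (f ((h * a) *: delta_mx ord0 j + (h *: w + x)) - f (h *: w + x)).
have Bcvg : B @ 0^' --> a * partial j f x.
  apply/cvgrPdist_le => e e0.
  have a0 : 0 < `|a| + 1 by rewrite ltr_wpDl.
  have ea : 0 < e / (`|a| + 1) by rewrite divr_gt0.
  have /cvgrPdist_le /(_ _ ea) /nbhs_ballP [r /= r0 rP] := cp x.
  (* The intermediate point is within [|h| * K] of x; the summand 1 makes [K] positive. *)
  pose K := `|w| + `|a| * `|delta_mx ord0 j : V| + 1.
  have K0 : 0 < K by rewrite ltr_wpDl// addr_ge0// mulr_ge0.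
  near=> h.
  have h0 : h != 0 by near: h; exact: nbhs_dnbhs_neq.
  have hK : `|h| * K < r.
    rewrite -ltr_pdivlMr//; near: h; apply: nbhs_dnbhs; apply: (@nbhs0_lt R R).
    by rewrite divr_gt0.
  have [s sh E] := @MVT_line f (partial j f) (delta_mx ord0 j) (h *: w + x) (h * a)
    (fun s => @Ck_derivable _ _ _ _ _ _ Cf).
  rewrite /B E mulrCA mulKf//  mulrC -mulrBl normrM.
  have rx : ball x r (s *: delta_mx ord0 j + (h *: w + x)).
    rewrite -ball_normE/= addrA opprD addrCA subrr addr0 normrN.
    apply: le_lt_trans hK; rewrite (le_trans (ler_normD _ _))// !normrZ.
    rewrite /K !mulrDr mulr1 mulrA -normrM -addrA addrC lerD//.
    by rewrite (le_trans (ler_wpM2r _ sh)) ?lerDl.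
  rewrite (le_trans (ler_wpM2r _ (rP _ rx)))// mulrAC ler_pdivrMr// ler_wpM2l ?(ltW e0)//.
  by rewrite lerDl.
have H : (fun h : R => h^-1 *: (f (h *: (w + a *: delta_mx ord0 j) + x) - f x)) @ 0^'
    --> d + a * partial j f x.
  rewrite (_ : (fun h : R => _) = fun h => h^-1 *: (f (h *: w + x) - f x) + B h).
    by apply: cvgD => //; rewrite -fd; exact: fw.
  apply/funext => h; rewrite /B -[_ *: (f _ - _)]/(_ * _).
    rewrite -[_ *: (f (h *: w + x) - _)]/(_ * _) -mulrDr; congr (_ * _).
  rewrite scalerDr scalerA [RHS]addrC addrA subrK; congr (f _ - _).
  by rewrite addrA; congr (_ + _); exact: addrC.
by split; [exact: (cvgP _ H)|exact/cvg_lim].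
Unshelve. all: by end_near. Qed.

(** Builds v up as the sum of its v_i e_i, one axis at a time, starting from the zero direction; no
    total derivative is involved. *)
Lemma is_derive_C1 f x v : Ck 1 f ->
  is_derive x v f (\sum_i v ord0 i * partial i f x).
Proof.
move=> Cf; rewrite [X in is_derive _ X](row_sum_delta v).
elim/big_rec2 : _ => [|i d w _ IH]; last first.
  rewrite [_ *: _ + w]addrC [_ * _ + d]addrC; exact: (@is_derive_C1_step _ _ _ _ (v 0 i) i).
by apply/is_derive_line; under eq_fun do rewrite scaler0 add0r; exact: is_derive_cst.
Qed.

End C1.

(** * Integration *)

Section real_dominated_convergence.
Context d (T : measurableType d) (R : realType) (mu : {measure set T -> \bar R}).

Lemma Rdominated_convergence (D : set T) (f_ : nat -> T -> R) (f g : T -> R) :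
  measurable D -> (forall m, measurable_fun D (f_ m)) ->
  (forall x, D x -> f_ m x @[m --> \oo] --> f x) ->
  mu.-integrable D (EFin \o g) ->
  (forall m x, D x -> `|f_ m x| <= g x) ->
  [/\ mu.-integrable D (EFin \o f),
      \int[mu]_(x in D) f_ m x @[m --> \oo] --> \int[mu]_(x in D) f x &
      \int[mu]_(x in D) `|f_ m x - f x| @[m --> \oo] --> 0 ].
Proof.
move=> mD mf_ f_f intg f_g.
have mf : measurable_fun D f by exact: measurable_fun_cvg f_f.
have [intf c0 c1] : [/\ mu.-integrable D (EFin \o f),
    (\int[mu]_(x in D) `|(f_ m x)%:E - (f x)%:E| @[m --> \oo] --> 0)%E &
    (\int[mu]_(x in D) (f_ m x)%:E @[m --> \oo] --> \int[mu]_(x in D) (f x)%:E)%E].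
  apply: (@dominated_convergence _ _ _ mu D mD (fun m x => (f_ m x)%:E)
    (EFin \o f) (EFin \o g)) => //.
  - by move=> m; apply/measurable_EFinP.
  - exact/measurable_EFinP.
  - apply: aeW => x Dx; apply: cvg_EFin; first by near=> m.
    exact: f_f.
  - by apply: aeW => x m Dx; rewrite lee_fin f_g.
split => //.
- by apply: fine_cvg; rewrite fineK//; exact: integrable_fin_num.
- by apply: fine_cvg.
Unshelve. all: by end_near. Qed.

Lemma integrable_Rdominated (D : set T) (f g : T -> R) : measurable D ->
  measurable_fun D f -> mu.-integrable D (EFin \o g) ->
  (forall x, D x -> `|f x| <= g x) -> mu.-integrable D (EFin \o f).
Proof.
move=> mD mf intg fg; apply: (le_integrable mD _ _ intg); first exact/measurable_EFinP.
by move=> x Dx /=; rewrite lee_fin (le_trans (fg _ Dx))// ler_norm.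
Qed.

Lemma Rintegral_sub (D K : set T) (f : T -> R) : K `<=` D ->
  (forall x, ~ K x -> f x = 0) -> \int[mu]_(x in D) f x = \int[mu]_(x in K) f x.
Proof.
move=> KD f0; rewrite Rintegral_mkcond [RHS]Rintegral_mkcond.
apply: eq_Rintegral => x _; rewrite !patchE.
have [xK|xK] := pselect (K x); first by rewrite !mem_set//; exact: KD.
by rewrite [in RHS]memNset// f0//; case: ifP.
Qed.

Lemma le_Rintegral_subset (A B : set T) (f : T -> R) : measurable A -> measurable B ->
  A `<=` B -> mu.-integrable B (EFin \o f) -> (forall x, 0 <= f x) ->
  \int[mu]_(x in A) f x <= \int[mu]_(x in B) f x.
Proof.
move=> mA mB AB intf f0; apply: fine_le.
- by apply: integrable_fin_num => //; exact: integrableS intf.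
- exact: integrable_fin_num.
- apply: ge0_subset_integral => //; first exact: measurable_int intf.
  by move=> x _; rewrite lee_fin.
Qed.

End real_dominated_convergence.

(** * Compactly supported functions and their integrals *)

Section compact_support.
Context (R : realType) (n : nat).
Local Notation V := 'rV[R]_n.
Local Notation mu := (lebesgue_rV R n).
Implicit Types (f g phi : V -> R) (K D Omega : set V) (v : V).

Lemma rV_compact_closed K : compact K -> closed K.
Proof. by apply: compact_closed; exact: norm_hausdorff. Qed.

Lemma rV_compact_measurable K : compact K -> measurable K.
Proof. by move=> /rV_compact_closed; exact: closed_rV_measurable. Qed.

Lemma rV_compact_fin K : compact K -> (mu K < +oo)%E.
Proof.
move=> cK; apply: lebesgue_rV_bounded; first exact: rV_compact_measurable.
exact: compact_bounded.
Qed.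

Lemma compact_continuous_bounded f K : continuous f -> compact K ->
  exists2 C, 0 <= C & forall x, K x -> `|f x| <= C.
Proof.
move=> cf cK; have : compact (f @` K).
  by apply: continuous_compact => //; exact: continuous_subspaceT.
move=> /compact_bounded/pinfty_ex_gt0[C C0 fC]; exists C; first exact: ltW.
by move=> x Kx; apply: fC; exists x.
Qed.

Lemma supported_bounded f K : continuous f -> compact K ->
  (forall x, ~ K x -> f x = 0) -> exists2 C, 0 <= C & forall x, `|f x| <= C.
Proof.
move=> cf cK f0; have [C C0 fC] := compact_continuous_bounded cf cK.
exists C => // x; have [Kx|Kx] := pselect (K x); first exact: fC.
by rewrite f0// normr0.
Qed.

Lemma bounded_integrable f D C : measurable D -> (mu D < +oo)%E ->
  measurable_fun D f -> (forall x, D x -> `|f x| <= C) ->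
  mu.-integrable D (EFin \o f).
Proof.
move=> mD muD mf fC; apply: measurable_bounded_integrable => //.
exists C; split; first exact: num_real.
by move=> M CM x Dx /=; rewrite (le_trans (fC _ Dx))// ltW.
Qed.

Lemma supported_integrable f K C D : measurable D -> compact K ->
  measurable_fun setT f -> (forall x, ~ K x -> f x = 0) ->
  (forall x, `|f x| <= C) -> mu.-integrable D (EFin \o f).
Proof.
move=> mD cK mf f0 fC; apply: (@integrableS _ _ _ _ setT) => //.
have mK := rV_compact_measurable cK.
have : mu.-integrable K (EFin \o f).
  apply: (@bounded_integrable _ _ C) => //; first exact: rV_compact_fin.
  exact: measurable_funTS.
move/(integrable_mkcond _ mK); congr (_.-integrable _ _).
apply/funext => x; rewrite patchE; case: ifPn => // /negP xK /=.
by rewrite f0// => /mem_set.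
Qed.

Lemma continuous_supported_integrable f K D : measurable D -> compact K ->
  continuous f -> (forall x, ~ K x -> f x = 0) -> mu.-integrable D (EFin \o f).
Proof.
move=> mD cK cf f0; have [C _ fC] := supported_bounded cf cK f0.
apply: (@supported_integrable _ K C) => //.
exact: continuous_rV_measurable.
Qed.

Lemma Rintegral_shift f v : measurable_fun setT f ->
  \int[mu]_x f (x + v) = \int[mu]_x f x.
Proof.
move=> mf; rewrite /Rintegral -(@integral_rV_shift R n v (EFin \o f))//.
exact/measurable_EFinP.
Qed.

Lemma integrable_shift f v : mu.-integrable setT (EFin \o f) ->
  mu.-integrable setT (EFin \o (fun x : V => f (v + x))).
Proof.
move=> intf; have mf := (measurable_EFinP _ _).1 (measurable_int _ intf).
have -> : (fun x : V => f (v + x)) = f \o (fun x => x + v).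
  by apply/funext => x /=; rewrite addrC.
apply/integrableP; split.
  by apply/measurable_EFinP; apply: measurableT_comp => //; exact: measurable_shift_rV.
rewrite (@integral_rV_shift R n v (fun x => `|(f x)%:E|)%E).
  by have /integrableP[_] := intf.
by apply: measurableT_comp => //; exact/measurable_EFinP.
Qed.

Lemma partial_supported f K i x : closed K -> (forall x, ~ K x -> f x = 0) ->
  ~ K x -> partial i f x = 0.
Proof.
move=> cK f0 Kx; rewrite /partial (@near_eq_derive _ _ _ _ (cst 0)) ?derive_cst//.
have : nbhs x (~` K) by apply: open_nbhs_nbhs; split => //; exact: closed_openC.
by apply: filterS => y /f0.
Qed.

(** For |t| < 1 all translates of [K] stay in one ball, which carries the dominating function when
    an integral is differentiated at t = 0. *)
Lemma compact_translates K v : compact K ->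
  exists2 r, 0 < r & forall (t : R) x, -1 < t < 1 -> K (t *: v + x) -> ball 0 r x.
Proof.
move=> /compact_bounded/bounded_rV_ball[r r0 Kr]; exists (r + `|v|).
  by rewrite ltr_wpDr.
move=> t x /andP[t1 t2] /Kr; rewrite -!ball_normE/= !sub0r !normrN => h.
rewrite -[x](addKr (t *: v)) (le_lt_trans (ler_normD _ _))// addrC ltr_leD//.
rewrite normrN normrZ ler_piMl// ler_norml !ltW//.
Qed.

Lemma closed_ball0_compact (r : R) : compact (closure (ball (0 : V) r)).
Proof.
apply: bounded_closed_compact; last exact: closed_closure.
exists r; split; first exact: num_real.
move=> M rM x /= xr; rewrite leNgt; apply/negP => Mx.
have : nbhs x [set y : V | M < `|y|].
  have := @norm_continuous _ V x; move/cvgrPdist_lt => /(_ (`|x| - M)).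
  rewrite subr_gt0 => /(_ Mx); apply: filterS => y /=.
  by move=> /(le_lt_trans (ler_norm _)); lra.
move=> /xr[y [/=]]; rewrite -ball_normE/= sub0r normrN => yr My.
by have := lt_trans yr (lt_trans rM My); rewrite ltxx.
Qed.

(** The integral of f(x + tv) over x does not depend on t, by translation invariance; its derivative
    at t = 0, taken under the integral sign, is the integral on the left. Integration by parts rests
    on this. *)
Lemma integral_derive0 f K v : Ck 1 f -> compact K ->
  (forall x, ~ K x -> f x = 0) ->
  \int[mu]_x (\sum_i v ord0 i * partial i f x) = 0.
Proof.
move=> Cf cK f0; have cf := Ck_continuous Cf.
pose Dv x := \sum_i v ord0 i * partial i f x.
have dF t x : is_derive t (1 : R) (fun t : R => f (t *: v + x)) (Dv (t *: v + x)).
  by apply: is_derive_shift_line; exact: is_derive_C1.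
have p1 t x : partial1of2 (fun (t : R) x => f (t *: v + x)) t x = Dv (t *: v + x).
  by rewrite partial1of2E; have [_ ->] := dF t x.
have cD : continuous Dv.
  apply: (@Ck_continuous _ _ 0); apply: Ck_sum => i _; apply: CkZ.
  exact: Ck_partial.
have D0 x : ~ K x -> Dv x = 0.
  move=> Kx; apply: big1 => i _; rewrite (partial_supported i _ f0) ?mulr0//.
  exact: rV_compact_closed.
have [C C0 DC] := supported_bounded cD cK D0.
have [r r0 rK] := compact_translates v cK.
have mshift t (g : V -> R) : continuous g -> measurable_fun setT (fun x => g (t *: v + x)).
  move=> cg; apply: continuous_rV_measurable => // x.
  apply: (@continuous_comp _ _ _ (fun x => t *: v + x) g) => //; last exact: cg.
  by apply: (@continuousD _ _ _ (cst _) id); [exact: cst_continuous|exact: cvg_id].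
have := @differentiation_under_integral R _ _ mu (fun (t : R) x => f (t *: v + x)) setT
  measurableT 0 (-1) 1 _ _ _ (fun x => C * \1_(ball 0 r) x).
move=> /(_ _ _ _ _ _ _)/wrap[].
- by rewrite /= in_itv/= ltrN10 ltr01.
- move=> t; rewrite /= in_itv/= => t1; have [M M0 fM] := supported_bounded cf cK f0.
  apply: (@supported_integrable _ (closure (ball 0 r)) M) => //.
  + exact: closed_ball0_compact.
  + exact: mshift.
  + move=> x xr; apply: f0 => /(rK _ _ t1) /subset_closure; exact: xr.
- by move=> t x _ _; have [] := dF t x.
- by move=> x; rewrite mulr_ge0.
- apply: (@supported_integrable _ (closure (ball 0 r)) C) => //.
  + exact: closed_ball0_compact.
  + by apply: measurable_funM => //; apply: measurable_indic; exact: ball_rV_measurable.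
  + move=> x xr; rewrite indicE memNset ?mulr0// => /subset_closure; exact: xr.
  + move=> x; rewrite indicE normrM (ger0_norm C0) ler_piMr// normr_nat lern1; by case: (_ \in _).
- move=> t x; rewrite /= in_itv/= => t1 _; rewrite p1.
  have [xr|xr] := pselect (ball 0 r x).
    by rewrite indicE mem_set// mulr1 DC.
  by rewrite D0 ?normr0 ?mulr_ge0// => /(rK _ _ t1).
rewrite (_ : (fun _ => _) = cst (\int[mu]_x f x)); last first.
  apply/funext => t; rewrite -(@Rintegral_shift f (t *: v)).
    by apply: eq_Rintegral => x _; rewrite addrC.
  exact: continuous_rV_measurable.
rewrite derive1_cst => e; rewrite [RHS]e; apply: eq_Rintegral => x _.
by rewrite p1 scale0r add0r.
Qed.

End compact_support.

(** * Test functions *)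

Section test_functions.
Context (R : realType) (n : nat).
Local Notation V := 'rV[R]_n.
Local Notation mu := (lebesgue_rV R n).
Implicit Types (f g phi : V -> R) (K D Omega U : set V) (v : V).

Lemma test_functionI Omega K phi : smooth phi -> compact K -> K `<=` Omega ->
  (forall x, ~ K x -> phi x = 0) -> test_function Omega phi.
Proof.
move=> sphi cK KO phi0.
have sK : closure [set x | phi x != 0] `<=` K.
  rewrite [X in _ `<=` X](closure_id K).1; last exact: rV_compact_closed.
  apply: closure_subset; by move=> x /= /eqP phix; apply: contrapT => /phi0.
split=> //; last exact: subset_trans sK KO.
by apply: subclosed_compact cK sK; exact: closed_closure.
Qed.

Lemma test_function_supp Omega phi : test_function Omega phi ->
  exists K, [/\ compact K, K `<=` Omega & forall x, ~ K x -> phi x = 0].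
Proof.
move=> [_ cK KO]; exists (closure [set x | phi x != 0]); split => // x Kx.
by apply/eqP; rewrite -[_ == _]negbK; apply/negP => phix; apply: Kx; exact: subset_closure.
Qed.

Lemma test_functionS Omega Omega' phi : Omega `<=` Omega' ->
  test_function Omega phi -> test_function Omega' phi.
Proof. by move=> OO [? ? h]; split => //; exact: subset_trans h OO. Qed.

Lemma test_function_comp Omega (h : R -> R) phi : (forall k, Ck_on setT k h) ->
  h 0 = 0 -> test_function Omega phi -> test_function Omega (h \o phi).
Proof.
move=> Ch h0 tphi; have [K [cK KO phi0]] := test_function_supp tphi.
apply: (@test_functionI _ K) => //; last by move=> x /phi0 /= ->.
by case: tphi => sphi _ _ k; apply: (@Ck_comp _ _ _ setT).
Qed.

Lemma test_functionZ Omega c phi : test_function Omega phi ->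
  test_function Omega (fun x => c * phi x).
Proof.
move=> tphi; have [K [cK KO phi0]] := test_function_supp tphi.
apply: (@test_functionI _ K) => //; last by move=> x /phi0 /= ->; rewrite mulr0.
by case: tphi => sphi _ _ k; exact: CkZ.
Qed.

Lemma test_function0 Omega : test_function Omega (cst 0).
Proof.
apply: (@test_functionI _ set0) => //; last exact: compact0.
by move=> k; exact: Ck_cst.
Qed.

Lemma test_functionD Omega phi psi : test_function Omega phi -> test_function Omega psi ->
  test_function Omega (fun x => phi x + psi x).
Proof.
move=> tphi tpsi; have [K [cK KO phi0]] := test_function_supp tphi.
have [L [cL LO psi0]] := test_function_supp tpsi.
apply: (@test_functionI _ (K `|` L)).
- by case: tphi => sphi _ _; case: tpsi => spsi _ _ k; exact: CkD.
- exact: compactU.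
- by move=> x [/KO|/LO].
- by move=> x /not_orP[/phi0 -> /psi0 ->]; rewrite addr0.
Qed.

Lemma test_function_sum Omega (b : nat -> V -> R) m :
  (forall j, test_function Omega (b j)) ->
  test_function Omega (fun x => \sum_(j < m) b j x).
Proof.
move=> tb; elim: m => [|m IH].
  by under eq_fun do rewrite big_ord0; exact: test_function0.
by under eq_fun do rewrite big_ord_recr; exact: test_functionD.
Qed.

Lemma flat_ge0 (m : nat) (t : R) : 0 <= flat m t.
Proof. by rewrite /flat; case: ifP => // t0; rewrite mulr_ge0 ?powR_ge0 ?expR_ge0. Qed.

Lemma flat_le0 (m : nat) (t : R) : t <= 0 -> flat m t = 0.
Proof. by move=> t0; rewrite /flat ltNge t0. Qed.

Lemma flat_gt0 (m : nat) (t : R) : 0 < t -> 0 < flat m t.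
Proof. by move=> t0; rewrite /flat t0 mulr_gt0 ?powR_gt0 ?expR_gt0. Qed.

Lemma flat1E (t : R) : 0 < t -> flat 1 t = expR (- t^-1).
Proof. by move=> t0; rewrite /flat t0 subrr powRr0 mul1r. Qed.

Lemma flat1_le1 (t : R) : flat 1 t <= 1.
Proof.
have [t0|t0] := ltP 0 t; last by rewrite flat_le0.
by rewrite flat1E// -expR0 ler_expR oppr_le0 invr_ge0 ltW.
Qed.

Lemma flat1_cvg (u : nat -> R) : u @ \oo --> +oo -> flat 1 (u k) @[k --> \oo] --> (1 : R).
Proof.
move=> uoo; apply: (@cvg_trans _ (expR (- (u k)^-1) @[k --> \oo])).
  apply: near_eq_cvg; near=> k; rewrite flat1E//.
  by near: k; apply: (cvgryPgt _).1.
have <- : expR (- 0 : R) = 1 by rewrite oppr0 expR0.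
apply: continuous_cvg; first exact: continuous_expR.
apply: cvgN; apply/gtr0_cvgV0 => //; near=> k; near: k; exact: (cvgryPgt _).1.
Unshelve. all: by end_near. Qed.

(** The classical mollifier profile exp(-1/(r^2 - |x-q|^2)), extended by 0. Squaring the norm keeps
    the argument polynomial, hence smooth at [q]. *)
Definition bump (q : V) (r : R) (x : V) : R := flat 1 (r ^+ 2 - enorm (x - q) ^+ 2).

Lemma smooth_bump q r : smooth (bump q r).
Proof.
move=> k; apply: (@Ck_comp _ _ _ setT) => //; first exact: Ck_on_flat.
under eq_fun do rewrite sqr_enorm.
apply: CkB; first exact: Ck_cst.
apply: Ck_sum => i _; under eq_fun do rewrite !mxE expr2.
by apply: CkM; apply: CkD; by [exact: Ck_coord|exact: Ck_cst].
Qed.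

Lemma bump_gt0 q r x : 0 < r -> (0 < bump q r x) = (enorm (x - q) < r).
Proof.
move=> r0; have [h|h] := ltP (enorm (x - q)) r.
  by rewrite flat_gt0// subr_gt0 ltr_pXn2r ?nnegrE ?enorm_ge0// ltW.
apply/negbTE; rewrite -leNgt /bump flat_le0// subr_le0.
by rewrite ler_pXn2r ?nnegrE ?enorm_ge0// ltW.
Qed.

Lemma compact_enorm_ball q (r : R) : compact [set x : V | enorm (x - q) <= r].
Proof.
apply: bounded_closed_compact.
  apply: (@enorm_bounded _ _ _ (enorm q + r)) => x /= xr.
  by rewrite -[x](addrNK q) addrC (le_trans (ler_enormD _ _))// lerD2l.
have c : continuous (fun x : V => enorm (x - q)).
  move=> x; apply: (@continuous_comp _ _ _ (fun x : V => x - q) (@enorm R n)).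
    by apply: (@continuousB _ _ _ id (cst q)); [exact: cvg_id|exact: cst_continuous].
  exact: continuous_enorm.
exact: (@closed_comp _ _ (fun x : V => enorm (x - q)) [set t | t <= r] (fun x _ => c x) (@closed_le _ r)).
Qed.

Lemma test_bump U q r : 0 < r -> [set x | enorm (x - q) <= r] `<=` U ->
  test_function U (bump q r).
Proof.
move=> r0 qU; apply: (test_functionI (@smooth_bump q r) (@compact_enorm_ball q r) qU).
move=> x /negP; rewrite -ltNge => rx; apply/eqP; rewrite eq_le flat_ge0 andbT.
by rewrite leNgt bump_gt0// -leNgt ltW.
Qed.

Lemma rat_enorm_ball U (x : V) : nbhs x U -> exists (q : 'rV[rat]_n) (k : nat),
  enorm (x - (map_mx ratr q : V)) < k.+1%:R^-1 /\
  [set y | enorm (y - (map_mx ratr q : V)) <= k.+1%:R^-1] `<=` U.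
Proof.
move=> /nbhs_ballP[e /= e0 eU].
have [k k2] : exists k : nat, k.+1%:R^-1 < e / 2.
  have := @near_infty_natSinv_lt R (PosNum (divr_gt0 e0 (@ltr0Sn R 1))).
  by move=> [k _ /(_ _ (leqnn _))] /=; exists k.
have k0 : (0 : R) < k.+1%:R^-1 by rewrite invr_gt0.
have [q [k' [qx qU]]] := rat_ball (enorm_ball_nbhs x k0).
have {qU} qx' : enorm ((map_mx ratr q : V) - x) < k.+1%:R^-1.
  by apply: qU; apply: ballxx; rewrite invr_gt0.
exists q, k; rewrite enormB; split=> // y /= yq; apply: eU.
rewrite -ball_normE/=; apply: le_lt_trans (ler_norm_enorm _) _.
rewrite enormB -(subrK (map_mx ratr q : V) y) -addrA.
apply: (le_lt_trans (ler_enormD _ _)).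
rewrite (splitr e) ltr_leD//; first exact: le_lt_trans k2.
exact: ltW (lt_trans qx' k2).
Qed.

(** The bumps sit on the balls of a countable base whose closed versions lie in [U], enumerated
    through [unpickle]. Codes that decode to no pair, or to a ball not inside [U], receive the zero
    function. *)
Lemma bump_cover U : open U -> exists b : nat -> V -> R,
  [/\ forall j, test_function U (b j), forall j x, 0 <= b j x &
      forall x, U x -> exists j, 0 < b j x].
Proof.
move=> oU.
pose B (p : 'rV[rat]_n * nat) : V -> R :=
  if `[< [set y | enorm (y - (map_mx ratr p.1 : V)) <= p.2.+1%:R^-1] `<=` U >]
  then bump (map_mx ratr p.1) p.2.+1%:R^-1 else cst 0.
exists (fun j => if unpickle j is Some p then B p else cst 0); split.
- move=> j; case: unpickle => [p|]; last exact: test_function0.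
  rewrite /B; case: ifPn => [/asboolP h|_]; last exact: test_function0.
  by apply: test_bump => //; rewrite invr_gt0.
- move=> j x; case: unpickle => [p|]//; rewrite /B; case: ifP => // _; exact: flat_ge0.
- move=> x Ux; have /rat_enorm_ball[q [k [qx qU]]] : nbhs x U by exact: open_nbhs_nbhs.
  exists (pickle (q, k)); rewrite pickleK /B asboolT//=.
  by rewrite bump_gt0// invr_gt0.
Qed.

(* psi_m = exp(-1/t) at t = m * \sum_(j < m) b_j, for nonnegative bumps b_j whose
   positivity sets cover U. *)
Lemma open_indicator_approx U : open U -> exists psi : nat -> V -> R,
  [/\ forall m, test_function U (psi m), forall m x, 0 <= psi m x <= 1 &
      forall x, psi m x @[m --> \oo] --> (\1_U x : R)].
Proof.
move=> /bump_cover[b [tb b0 bU]].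
exists (fun m x => flat 1 (m%:R * \sum_(j < m) b j x)); split.
- move=> m; apply: (@test_function_comp _ (flat 1)); [by move=> k; exact: Ck_on_flat|by rewrite flat_le0|].
  by apply: test_functionZ; exact: test_function_sum.
- by move=> m x; rewrite flat_ge0 flat1_le1.
- move=> x; rewrite indicE; have [xU|xU] := pselect (U x).
    rewrite mem_set//; apply: flat1_cvg.
    (* As soon as m > j the argument of [flat 1] is at least m b_j(x), which diverges; this is the
       purpose of the factor m. *)
    have [j bj] := bU _ xU; apply/cvgryPge => A; near=> m.
    apply: (@le_trans _ _ (m%:R * b j x)).
      by rewrite -ler_pdivrMr//; near: m; exact: nbhs_infty_ger.
    rewrite ler_wpM2l//.
    have jm : (j < m)%N by near: m; exact: nbhs_infty_gt.
    by rewrite (bigD1 (Ordinal jm))//= lerDl sumr_ge0.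
  rewrite memNset// (_ : (fun m => _) = cst (0 : R)); first exact: cvg_cst.
  apply/funext => m; rewrite flat_le0// big1 ?mulr0// => j _.
  have [K [cK KU bK]] := test_function_supp (tb j).
  by rewrite bK// => /KU.
Unshelve. all: by end_near. Qed.


(** The measurable sets over which [f] has zero integral are stable under complement and countable
    disjoint union, so the open sets among them generate all measurable sets. *)
Lemma integral_open_eq0 (f : V -> \bar R) : mu.-integrable setT f ->
  (forall U, open U -> (\int[mu]_(x in U) f x = 0)%E) ->
  {ae mu, forall x, f x = 0%E}.
Proof.
move=> intf f0.
have H A : measurable A -> (\int[mu]_(x in A) f x = 0)%E.
  rewrite rV_measurable_open.
  apply: (dynkin_induction (P := fun A => \int[mu]_(x in A) f x = 0)%E (@rV_measurable_open R n)).
  - by move=> B C oB oC; exact: openI.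
  - by apply: f0; exact: openT.
  - exact: f0.
  - move=> S mS S0; have := f0 _ openT.
    rewrite -(setUv S) integral_setU//.
    + by rewrite S0 add0e.
    + exact: measurableC.
    + by rewrite setUv; exact: measurable_int intf.
    + by apply/disj_setPS => x [].
  - move=> F mF tF F0; rewrite integral_bigcup//; last first.
      by apply: integrableS intf => //; exact: bigcup_measurable.
    by rewrite eseries0.
have : ae_eq mu setT f (cst 0%E).
  apply: integral_ae_eq => //; last by move=> A _ mA; rewrite H// integral0.

by apply: filterS => x; exact.
Qed.

(** The fundamental lemma of the calculus of variations, from which uniqueness of weak gradients
    follows. *)
Lemma test_function_integral_eq0 Omega f : open Omega ->
  locally_integrable_on Omega f ->
  (forall phi, test_function Omega phi -> \int[mu]_(x in Omega) (f x * phi x) = 0) ->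
  {ae mu, forall x, Omega x -> f x = 0}.
Proof.
move=> oO [mf lf] f0; have mO := open_rV_measurable oO.
(* [f] is integrable over compact subsets only, so vanishing is first shown on open sets inside a
   compact [K]. There test functions tend to the indicator of [W]&[U], with |f| as dominating
   function on [K]. *)
have local U K : open U -> compact K -> U `<=` K -> K `<=` Omega ->
    {ae mu, forall x, U x -> f x = 0}.
  move=> oU cK UK KO; have mK := rV_compact_measurable cK.
  have mU := open_rV_measurable oU.
  have intfK : mu.-integrable K (EFin \o f) by exact: lf.
  have intfU : mu.-integrable setT ((EFin \o f) \_ U).
    by apply/(integrable_mkcond _ mU); apply: integrableS intfK.
  suff H : {ae mu, forall x, ((EFin \o f) \_ U) x = 0%E}.
    apply: filterS H => x + Ux; rewrite patchE mem_set// => -[].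
    by [].
  apply: integral_open_eq0 => // W oW.
  rewrite -integral_mkcondr.
  have oWU : open (W `&` U) by exact: openI.
  have [psi [tpsi psi01 psicvg]] := open_indicator_approx oWU.
  have mpsi m D : measurable D -> measurable_fun D (psi m).
    move=> mD; apply: continuous_rV_measurable => //.
    by have [/(_ 0%N)[]] := tpsi m.
  have WUK : W `&` U `<=` K by move=> x [_ /UK].
  have mfK : measurable_fun K f by apply/measurable_EFinP; exact: measurable_int intfK.
  have intaf : mu.-integrable K (EFin \o (fun x => `|f x|)).
    exact: (integrable_abse intfK).
  have fpsi m x : K x -> `|f x * psi m x| <= `|f x|.
    by move=> _; have /andP[p0 p1] := psi01 m x; rewrite normrM (ger0_norm p0) ler_piMr.
  have [intf1 fcvg _] := @Rdominated_convergence _ _ _ mu K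
     (fun m x => f x * psi m x) (fun x => f x * \1_(W `&` U) x) (fun x => `|f x|)
     mK (fun m => measurable_funM mfK (mpsi m K mK))
     (fun x _ => cvgMr (psicvg x)) intaf fpsi.
  have int0 m : \int[mu]_(x in K) (f x * psi m x) = 0.
    rewrite -(f0 (psi m)); last by apply: test_functionS (tpsi m) => x /WUK /KO.
    apply/esym/Rintegral_sub => // x Kx.
    have [L [_ LWU psi0]] := test_function_supp (tpsi m).
    by rewrite psi0 ?mulr0// => /LWU /WUK.
  have E : \int[mu]_(x in K) (f x * \1_(W `&` U) x) = 0.
    apply: (cvg_unique _ fcvg); first exact: Rhausdorff.
    have e : (fun m => \int[mu]_(x in K) (f x * psi m x)) = cst 0 by apply/funext => m; exact: int0.
    by rewrite /= e; exact: cvg_cst.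
  rewrite -[LHS]fineK; last first.
    apply: integrable_fin_num; first exact: measurableI (open_rV_measurable oW) mU.
    apply: integrableS intfK => //; exact: measurableI (open_rV_measurable oW) mU.
  congr EFin; rewrite -[RHS]E -[in LHS](setIidr WUK).
  rewrite [LHS](Rintegral_mkcondr mu K (W `&` U) f); apply: eq_Rintegral => x _.
  by rewrite patchE indicE; case: (_ \in _); rewrite ?mulr1 ?mulr0.
(* The positivity sets of the bumps are countably many open sets covering [Omega], each inside a
   compact subset of it, so the local result spreads. *)
have [b [tb b0 bO]] := bump_cover oO.
have H j : {ae mu, forall x, 0 < b j x -> f x = 0}.
  have [K [cK KO bK]] := test_function_supp (tb j).
  apply: (local [set x | 0 < b j x] K) => //.
    have cb : continuous (b j) by have [/(_ 0%N)[]] := tb j.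
    exact: (open_comp (fun x _ => cb x) (@open_gt _ 0)).
  by move=> x /= bx; apply: contrapT => /bK bx0; move: bx; rewrite bx0 ltxx.
have := ae_foralln H; apply: filterS => x h /bO[j]; exact: h.
Unshelve. all: by end_near. Qed.

End test_functions.

(** * Weak gradients *)

Lemma cvg_bigsum (R : realType) (I : Type) (r : seq I) (a : nat -> I -> R) (l : I -> R) :
  (forall i, a k i @[k --> \oo] --> l i) ->
  \sum_(i <- r) a k i @[k --> \oo] --> \sum_(i <- r) l i.
Proof.
move=> al; elim: r => [|i r IH].
  by rewrite big_nil; under eq_fun do rewrite big_nil; exact: cvg_cst.
by rewrite big_cons; under eq_fun do rewrite big_cons; exact: cvgD.
Qed.

Section enorm_measurable.
Context (R : realType) (n : nat).
Local Notation V := 'rV[R]_n.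

Lemma ler_enorm_sum (x : V) : enorm x <= \sum_i `|x ord0 i|.
Proof.
rewrite [X in enorm X](row_sum_delta x).
elim/big_rec2 : _ => [|i s w _ IH]; first by rewrite enorm0.
rewrite (le_trans (ler_enormD _ _))// lerD// enormZ ler_piMr//.
rewrite (_ : enorm _ = 1)// /enorm (bigD1 i)//= mxE !eqxx expr1n big1 ?addr0 ?sqrtr1//.
by move=> j ji; rewrite mxE (negbTE ji) expr0n.
Qed.

Lemma measurable_enorm (d : measure_display) (T : measurableType d) (D : set T) (g : T -> V) :
  (forall i, measurable_fun D (fun x => g x ord0 i)) -> measurable_fun D (@enorm R n \o g).
Proof.
move=> mg; apply: (@measurableT_comp _ _ _ _ _ _ (@Num.sqrt R)) => //.
  by apply: continuous_measurable_fun; exact: sqrt_continuous.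
by apply: measurable_sum => i; apply: measurable_funX; exact: mg.
Qed.

End enorm_measurable.

Section Lp_norms.
Context (R : realType) (n : nat) (Omega : set 'rV[R]_n).
Local Notation V := 'rV[R]_n.
Local Notation mu := (lebesgue_rV R n).
Implicit Types (u : V -> R) (C : R).

(** [Lnorm] at infinity is the essential supremum only when the whole space has positive measure;
    this unlocks that case. *)
Lemma lebesgue_rV_setT_gt0 : (0 < mu setT)%E.
Proof. by apply: lebesgue_rV_open_gt0; [exact: openT|exists 0]. Qed.

Lemma Lp_norm1E u : Lp_norm Omega 1 u = (\int[mu]_(x in Omega) `|u x|%:E)%E.
Proof.
rewrite /Lp_norm Lnorm1 [RHS]integral_mkcond; apply: eq_integral => x _.
by rewrite /= !patchE; case: ifP => //= _; rewrite normr0.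
Qed.

Lemma Lp_normoo_leP u C : 0 <= C ->
  (Lp_norm Omega +oo u <= C%:E)%E <-> {ae mu, forall x, Omega x -> `|u x| <= C}.
Proof.
move=> C0; rewrite /Lp_norm unlock /Lnorm lebesgue_rV_setT_gt0.
split=> [/ess_supP|h].
  by apply: filterS => x + Ox; rewrite /= patchE mem_set// lee_fin.
apply/ess_supP; apply: filterS h => x h; rewrite /= lee_fin patchE.
by case: ifPn => [/set_mem/h//|_]; rewrite normr0.
Qed.

Lemma Lp_norm_ge0 p u : (0 <= Lp_norm Omega p u)%E.
Proof. exact: Lnorm_ge0. Qed.

End Lp_norms.

Section weak_gradients.
Context (R : realType) (n : nat) (Omega : set 'rV[R]_n).
Local Notation V := 'rV[R]_n.
Local Notation mu := (lebesgue_rV R n).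
Implicit Types (f u : V -> R) (g h : V -> V) (K D U : set V).
Hypothesis oO : open Omega.
Let mO : measurable Omega. Proof. exact: open_rV_measurable. Qed.

Definition grad f (x : V) : V := \row_i partial i f x.

Lemma locally_integrableB u v : locally_integrable_on Omega u ->
  locally_integrable_on Omega v -> locally_integrable_on Omega (fun x => u x - v x).
Proof.
move=> [mu_ lu] [mv lv]; split; first exact: measurable_funB.
move=> K cK KO; have mK := rV_compact_measurable cK.
exact: (integrableB mK (lu K cK KO) (lv K cK KO)).
Qed.

Lemma locally_integrable_continuous f : continuous f -> locally_integrable_on Omega f.
Proof.
move=> cf; split; first exact: continuous_rV_measurable.
move=> K cK _; have [C C0 fC] := compact_continuous_bounded cf cK.
have mK := rV_compact_measurable cK.
apply: (@bounded_integrable _ _ _ _ C) => //; first exact: rV_compact_fin.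
exact: continuous_rV_measurable.
Qed.

Lemma test_function_integrable u phi : locally_integrable_on Omega u ->
  continuous phi -> forall K, compact K -> K `<=` Omega ->
  (forall x, ~ K x -> phi x = 0) ->
  mu.-integrable Omega (EFin \o (fun x => u x * phi x)).
Proof.
move=> [mu_ lu] cphi K cK KO phi0; have mK := rV_compact_measurable cK.
have [C C0 phiC] := supported_bounded cphi cK phi0.
have H : mu.-integrable K (EFin \o (fun x => u x * phi x)).
  apply: (@integrable_Rdominated _ _ _ _ _ _ (fun x => `|u x| * C)) => //.
  - apply: measurable_funM; first exact: measurable_funS mu_.
    exact: continuous_rV_measurable.
  - have /(integrableZl mK C) := integrable_abse (lu K cK KO).
    by congr (_.-integrable _ _); apply/funext => x /=; rewrite mulrC.
  - by move=> x _; rewrite normrM ler_wpM2l.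
have -> : EFin \o (fun x => u x * phi x) = (EFin \o (fun x => u x * phi x)) \_ K.
  apply/funext => x; rewrite patchE; case: ifPn => // /negP xK /=.
  by rewrite phi0 ?mulr0// => /mem_set.
by apply: integrableS (proj1 (integrable_mkcond _ mK) H).
Qed.

Lemma test_function_continuous phi : test_function Omega phi -> continuous phi.
Proof. by move=> [/(_ 0%N)[]]. Qed.

Lemma test_function_partial_continuous phi i : test_function Omega phi ->
  continuous (partial i phi).
Proof. by move=> [/(_ 1%N) C1 _ _]; exact: Ck_continuous (Ck_partial i C1). Qed.

Lemma is_weak_gradientB u v g h : is_weak_gradient Omega u g ->
  is_weak_gradient Omega v h ->
  is_weak_gradient Omega (fun x => u x - v x) (fun x => g x - h x).
Proof.
move=> [lu lg ug] [lv lh vh]; split.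
- exact: locally_integrableB.
- move=> i; under eq_fun do rewrite !mxE.
  exact: (locally_integrableB (lg i) (lh i)).
- move=> phi i tphi; have [K [cK KO phi0]] := test_function_supp tphi.
  have cphi := test_function_continuous tphi.
  have cdphi := test_function_partial_continuous (i := i) tphi.
  have dphi0 x : ~ K x -> partial i phi x = 0.
    by apply: partial_supported => //; exact: rV_compact_closed.
  under eq_Rintegral do rewrite mulrBl.
  under [in RHS]eq_Rintegral do rewrite !mxE mulrBl.
  rewrite !RintegralB//; do ?by apply: (test_function_integrable _ _ cK).
  by rewrite ug// vh// opprB opprK addrC.
Qed.

Lemma weak_gradient_unique u g h : is_weak_gradient Omega u g ->
  is_weak_gradient Omega u h -> {ae mu, forall x, Omega x -> g x = h x}.
Proof.
move=> [lu lg ug] [_ lh uh].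
have H i : {ae mu, forall x, Omega x -> g x ord0 i - h x ord0 i = 0}.
  apply: (test_function_integral_eq0 oO); first exact: locally_integrableB (lg i) (lh i).
  move=> phi tphi; have [K [cK KO phi0]] := test_function_supp tphi.
  have cphi := test_function_continuous tphi.
  under eq_Rintegral do rewrite mulrBl.
  rewrite RintegralB//; do ?by apply: (test_function_integrable _ _ cK).
  by apply/eqP; rewrite subr_eq0 -eqr_opp -ug// -uh.
(* The coordinates are reindexed by [nat], trivially beyond n, to intersect the a.e. statements with
   [ae_foralln]. *)
pose H' (k : nat) (x : V) := if insub k is Some i then Omega x -> g x ord0 i - h x ord0 i = 0 else True.
have /ae_foralln : forall k, {ae mu, forall x, H' k x}.
  by move=> k; rewrite /H'; case: insubP => [i _ _|_]; [exact: H|exact: aeW].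
apply: filterS => x hx Ox; apply/rowP => i; apply/eqP; rewrite -subr_eq0; apply/eqP.
by have := hx i; rewrite /H' valK; exact.
Qed.

Lemma is_weak_gradient_weak_gradient u g : is_weak_gradient Omega u g ->
  is_weak_gradient Omega u (weak_gradient Omega u).
Proof. by move=> ug; apply: (@xgetPex _ _ [set g | is_weak_gradient Omega u g]); exists g. Qed.

Lemma weak_gradient_ae u g : is_weak_gradient Omega u g ->
  {ae mu, forall x, Omega x -> weak_gradient Omega u x = g x}.
Proof.
by move=> ug; exact: weak_gradient_unique (is_weak_gradient_weak_gradient ug) ug.
Qed.

Lemma integral_partial0 f K i : Ck 1 f -> compact K ->
  (forall x, ~ K x -> f x = 0) -> \int[mu]_x partial i f x = 0.
Proof.
move=> Cf cK f0; rewrite -[RHS](integral_derive0 (delta_mx ord0 i) Cf cK f0).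
apply: eq_Rintegral => x _; rewrite (bigD1 i)//= mxE !eqxx mul1r big1 ?addr0//.
by move=> j ji; rewrite mxE (negbTE ji) mul0r.
Qed.

(** The product of [f] with a test function is C^1 with compact support in [Omega], so the integral
    of its partial derivative vanishes; the product rule splits it into the two sides. *)
Lemma is_weak_gradient_C1 f : Ck 1 f -> is_weak_gradient Omega f (grad f).
Proof.
move=> Cf; have cf := Ck_continuous Cf.
have cdf i : continuous (partial i f) by exact: Ck_continuous (Ck_partial i Cf).
split.
- exact: locally_integrable_continuous.
- by move=> i; under eq_fun do rewrite mxE; exact: locally_integrable_continuous.
move=> phi i tphi; have [K [cK KO phi0]] := test_function_supp tphi.
have Cphi : Ck 1 phi by case: tphi.
have cphi := test_function_continuous tphi.
have cdphi := test_function_partial_continuous (i := i) tphi.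
have dphi0 x : ~ K x -> partial i phi x = 0.
  by apply: partial_supported => //; exact: rV_compact_closed.
under [in RHS]eq_Rintegral do rewrite mxE.
have int1 := test_function_integrable (locally_integrable_continuous cf) cdphi cK KO dphi0.
have int2 := test_function_integrable (locally_integrable_continuous (cdf i)) cphi cK KO phi0.
apply/eqP; rewrite -subr_eq0 opprK -RintegralD//.
rewrite -[X in _ == X](@integral_partial0 (fun x => f x * phi x) K i _ cK); last 2 first.
- exact: CkM.
- by move=> x /phi0 ->; rewrite mulr0.
rewrite (@Rintegral_sub _ _ _ mu setT Omega (partial i (fun x => f x * phi x)))//; last first.
  move=> x Ox; apply: (@partial_supported _ _ _ K); first exact: rV_compact_closed.
    by move=> y /phi0 ->; rewrite mulr0.
  by move=> /KO.
apply/eqP; apply: eq_Rintegral => x _.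
have [_ D] := is_deriveM (Ck_derivable i x Cf) (Ck_derivable i x Cphi).
by rewrite [RHS]D; congr (_ + _); exact: mulrC.
Qed.

(** * Weak gradients of bounded pointwise limits of C^1 functions *)

Section limits.
Hypothesis bO : bounded_set Omega.
Variables (f_ : nat -> V -> R) (u : V -> R) (g : V -> V) (C : R).
Hypotheses (C0 : 0 <= C) (Cf : forall k, Ck 1 (f_ k)).
Hypothesis fC : forall k x, Omega x -> `|f_ k x| <= C.
Hypothesis dfC : forall k i x, Omega x -> `|partial i (f_ k) x| <= C.
Hypothesis f_u : forall x, Omega x -> f_ k x @[k --> \oo] --> u x.
Hypothesis df_g : forall x i, Omega x -> partial i (f_ k) x @[k --> \oo] --> g x ord0 i.

Let finO : (mu Omega < +oo)%E. Proof. exact: lebesgue_rV_bounded. Qed.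

Let mf k : measurable_fun Omega (f_ k).
Proof. by apply: continuous_rV_measurable => //; exact: Ck_continuous (Cf k). Qed.

Let mdf k i : measurable_fun Omega (partial i (f_ k)).
Proof. by apply: continuous_rV_measurable => //; exact: Ck_continuous (Ck_partial i (Cf k)). Qed.

Let muO : measurable_fun Omega u.
Proof. by apply: (measurable_fun_cvg mf) => x Ox; exact: f_u. Qed.

Let mg i : measurable_fun Omega (fun x => g x ord0 i).
Proof. by apply: (measurable_fun_cvg (mdf^~ i)) => x Ox; exact: df_g. Qed.

Lemma limit_bounded x : Omega x -> `|u x| <= C.
Proof.
move=> Ox; apply: (cvgr_to_le (cvg_norm (f_u Ox))).
by apply: nearW => k; exact: fC.
Qed.

Lemma limit_grad_bounded x i : Omega x -> `|g x ord0 i| <= C.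
Proof.
move=> Ox; apply: (cvgr_to_le (cvg_norm (df_g (i := i) Ox))).
by apply: nearW => k; exact: dfC.
Qed.

Let cst_integrable (c : R) : mu.-integrable Omega (EFin \o (fun=> c)).
Proof. by apply: (@bounded_integrable _ _ _ _ `|c|) => //; exact: measurable_cst. Qed.

(** Both sides of the integration by parts for [f_ k] converge by dominated convergence, constants
    being integrable on the bounded set [Omega]. *)
Lemma is_weak_gradient_limit : is_weak_gradient Omega u g.
Proof.
split.
- split=> // K cK KO; have mK := rV_compact_measurable cK.
  apply: (@bounded_integrable _ _ _ _ C) => //; first exact: rV_compact_fin.
    exact: measurable_funS muO.
  by move=> x /KO; exact: limit_bounded.
- move=> i; split=> // K cK KO; have mK := rV_compact_measurable cK.
  apply: (@bounded_integrable _ _ _ _ C) => //; first exact: rV_compact_fin.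
    exact: measurable_funS (mg i).
  by move=> x /KO Ox; exact: limit_grad_bounded.
move=> phi i tphi; have [K [cK KO phi0]] := test_function_supp tphi.
have cphi := test_function_continuous tphi.
have cdphi := test_function_partial_continuous (i := i) tphi.
have dphi0 x : ~ K x -> partial i phi x = 0.
  by apply: partial_supported => //; exact: rV_compact_closed.
have [A A0 phiA] := supported_bounded cphi cK phi0.
have [B B0 dphiB] := supported_bounded cdphi cK dphi0.
have [_ cvg1 _] := @Rdominated_convergence _ _ _ mu Omega
  (fun k x => f_ k x * partial i phi x) (fun x => u x * partial i phi x) (fun=> C * B)
  mO (fun k => measurable_funM (mf k) (continuous_rV_measurable cdphi mO))
  (fun x Ox => cvgMl (f_u Ox)) (cst_integrable _)
  (fun k x Ox => (eq_ind_r (fun z => z <= C * B)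
    (ler_pM (normr_ge0 _) (normr_ge0 _) (fC k Ox) (dphiB x)) (normrM _ _))).
have [_ cvg2 _] := @Rdominated_convergence _ _ _ mu Omega
  (fun k x => partial i (f_ k) x * phi x) (fun x => g x ord0 i * phi x) (fun=> C * A)
  mO (fun k => measurable_funM (mdf k i) (continuous_rV_measurable cphi mO))
  (fun x Ox => cvgMl (df_g (i := i) Ox)) (cst_integrable _)
  (fun k x Ox => (eq_ind_r (fun z => z <= C * A)
    (ler_pM (normr_ge0 _) (normr_ge0 _) (dfC k i Ox) (phiA x)) (normrM _ _))).
apply: (cvg_unique _ cvg1); first exact: Rhausdorff.
have e : (fun k => \int[mu]_(x in Omega) (f_ k x * partial i phi x)) =
         (fun k => - \int[mu]_(x in Omega) (partial i (f_ k) x * phi x)).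
  apply/funext => k; have [_ _ ->//] := is_weak_gradient_C1 (Cf k).
  by congr (- _); apply: eq_Rintegral => x _; rewrite mxE.
by rewrite /= e; exact: cvgN cvg2.
Qed.

Let ler_enorm_grad_cst x : Omega x -> enorm (g x) <= n%:R * C.
Proof.
move=> Ox; apply: le_trans (ler_enorm_sum _) _.
apply: (@le_trans _ _ (\sum_(i < n) C)); first by apply: ler_sum => i _; exact: limit_grad_bounded.
by rewrite sumr_const card_ord mulr_natl.
Qed.

Lemma sobolev_bounded p : p = 1%E \/ p = +oo%E -> sobolev Omega p u.
Proof.
have wg := is_weak_gradient_limit.
have [_ lwg _] := is_weak_gradient_weak_gradient wg.
have menorm : measurable_fun Omega (@enorm R n \o weak_gradient Omega u).
  by apply: measurable_enorm => i; have [] := lwg i.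
have nC0 : 0 <= n%:R * C by rewrite mulr_ge0.
have wgC : {ae mu, forall x, Omega x -> `|enorm (weak_gradient Omega u x)| <= n%:R * C}.
  apply: filterS (weak_gradient_ae wg) => x + Ox => ->//.
  by rewrite ger0_norm ?enorm_ge0// ler_enorm_grad_cst.
case=> ->; split.
- exact: muO.
- rewrite Lp_norm1E.
  have /integrable_abse/integral_fune_lt_pinfty : mu.-integrable Omega (EFin \o u).
    exact: (bounded_integrable mO finO muO limit_bounded).
  exact.
- by exists g.
- rewrite /grad_norm Lp_norm1E.
  apply: (@le_lt_trans _ _ (\int[mu]_(x in Omega) (n%:R * C)%:E)%E).
    apply: ae_ge0_le_integral => //.
    by apply/measurable_EFinP; exact: measurableT_comp.
  exact: integral_fune_lt_pinfty (cst_integrable _).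
- exact: muO.
- apply: (@le_lt_trans _ _ C%:E); last by rewrite ltry.
  by apply/Lp_normoo_leP => //; apply: aeW => x; exact: limit_bounded.
- by exists g.
- apply: (@le_lt_trans _ _ (n%:R * C)%:E); last by rewrite ltry.
  exact/Lp_normoo_leP.
Qed.

(** The [f_ k] themselves approximate [u] in W^{1,1}: both |f_k - u| and |g - grad f_k| tend to 0
    pointwise and are bounded, so their integrals tend to 0, although uniform convergence of the
    gradients may fail. *)
Lemma sobolev0_infty_limit : (forall k, test_function Omega (f_ k)) ->
  sobolev0_infty Omega u.
Proof.
move=> tf; have wg := is_weak_gradient_limit.
split; first by apply: sobolev_bounded; right.
split=> [|e e0]; first by apply: sobolev_bounded; left.
have e20 : 0 < e / 2 by rewrite divr_gt0.
have [_ _ cvg1] := @Rdominated_convergence _ _ _ mu Omega f_ u (fun=> C)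
  mO mf f_u (cst_integrable _) fC.
have sumC k x : Omega x -> enorm (g x - grad (f_ k) x) <=
    \sum_i `|partial i (f_ k) x - g x ord0 i|.
  move=> Ox; apply: (le_trans (ler_enorm_sum _)); apply: ler_sum => i _.
  by rewrite !mxE distrC.
have mgrad k : measurable_fun Omega (fun x => enorm (g x - grad (f_ k) x)).
  apply: (measurable_enorm (g := fun x => g x - grad (f_ k) x)) => i.
  by under eq_fun do rewrite !mxE; exact: measurable_funB.
have enorm_cvg x : Omega x -> enorm (g x - grad (f_ k) x) @[k --> \oo] --> (0 : R).
  move=> Ox; apply: (@squeeze_cvgr _ _ _ _ (fun=> 0)
      (fun k => \sum_i `|partial i (f_ k) x - g x ord0 i|)).
  - by apply: nearW => k; rewrite enorm_ge0 sumC.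
  - exact: cvg_cst.
  have z : \sum_(i < n) (0 : R) = 0 by rewrite big1.
  suff : \sum_i `|partial i (f_ k) x - g x ord0 i| @[k --> \oo] --> \sum_(i < n) (0 : R).
    by rewrite z.
  apply: cvg_bigsum => i; apply/norm_cvg0P.
  have h : (fun k => partial i (f_ k) x - g x ord0 i) @ \oo -->
      g x ord0 i - g x ord0 i by apply: cvgB; [exact: df_g|exact: cvg_cst].
  by rewrite subrr in h.
have enorm_bound k x : Omega x -> `|enorm (g x - grad (f_ k) x)| <= n%:R * (C + C).
  move=> Ox; rewrite ger0_norm ?enorm_ge0// (le_trans (sumC k x Ox))//.
  rewrite -[n in n%:R]card_ord mulr_natl -sumr_const; apply: ler_sum => i _.
  by rewrite (le_trans (ler_normB _ _))// lerD// ?dfC// limit_grad_bounded.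
have [_ cvg2 _] := @Rdominated_convergence _ _ _ mu Omega
  (fun k x => enorm (g x - grad (f_ k) x)) (fun=> 0) (fun=> n%:R * (C + C))
  mO mgrad enorm_cvg (cst_integrable _) enorm_bound.
have [k [k1 k2]] : exists k, `|\int[mu]_(x in Omega) `|f_ k x - u x| | < e / 2 /\
    `|\int[mu]_(x in Omega) enorm (g x - grad (f_ k) x)| < e / 2.
  have /cvgr0Pnorm_lt/(_ _ e20) h1 := cvg1.
  have : \int[mu]_(x in Omega) enorm (g x - grad (f_ k) x) @[k --> \oo] --> (0 : R).
    by move: cvg2; rewrite Rintegral_cst// mul0r.
  move=> /cvgr0Pnorm_lt/(_ _ e20) h2.
  have [k _ /(_ k (leqnn k))[? ?]] := filterI h1 h2.
  by exists k.
exists (f_ k); first exact: tf.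
have wgk := is_weak_gradientB wg (is_weak_gradient_C1 (Cf k)).
have [_ lwgk _] := is_weak_gradient_weak_gradient wgk.
rewrite /sobolev_norm /grad_norm !Lp_norm1E (splitr e) EFinD.
apply: lteD.
- rewrite (_ : (\int[mu]_(x in Omega) _)%E = (\int[mu]_(x in Omega) `|f_ k x - u x|)%:E).
    by rewrite lte_fin; exact: le_lt_trans (ler_norm _) k1.
  rewrite /Rintegral fineK.
    by apply: eq_integral => x _; rewrite distrC.
  apply: integrable_fin_num => //.
  apply: (bounded_integrable mO finO (C := C + C)).
    by apply: measurableT_comp => //; exact: measurable_funB.
  move=> x Ox; rewrite normr_id (le_trans (ler_normB _ _))// lerD// ?fC// limit_bounded//.
- rewrite (_ : (\int[mu]_(x in Omega) _)%E =
     (\int[mu]_(x in Omega) enorm (g x - grad (f_ k) x))%:E).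
    by rewrite lte_fin; exact: le_lt_trans (ler_norm _) k2.
  rewrite /Rintegral fineK; last first.
    by apply: integrable_fin_num => //; exact: (bounded_integrable mO finO (mgrad k) (enorm_bound k)).
  apply: ae_eq_integral => //.
  + apply/measurable_EFinP; apply: measurableT_comp => //.
    by apply: measurable_enorm => i; have [] := lwgk i.
  + by apply/measurable_EFinP; exact: mgrad.
  + apply: filterS (weak_gradient_ae wgk) => x h Ox; rewrite /= h//.
    by rewrite ger0_norm ?enorm_ge0.
Qed.

End limits.

End weak_gradients.

(** * The lower bound for the gradient *)

Section lower_bound.
Context (R : realType) (n : nat) (Omega : set 'rV[R]_n).
Local Notation V := 'rV[R]_n.
Local Notation mu := (lebesgue_rV R n).
Hypothesis oO : open Omega.
Let mO : measurable Omega. Proof. exact: open_rV_measurable. Qed.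

(** Measures by how much an approximant violates the bound that holds for its limit. If |grad phi|
    <= L, it is at most |grad phi - grad psi|, so it is small in L^1. *)
Definition grad_excess (L : R) (psi : V -> R) (x : V) : R :=
  Num.max 0 (enorm (grad psi x) - L).

Lemma continuous_grad_excess L psi : Ck 1 psi -> continuous (grad_excess L psi).
Proof.
move=> Cpsi.
have c : continuous (fun x => \sum_i partial i psi x ^+ 2).
  apply: (@Ck_continuous _ _ 0); apply: Ck_sum => i _; under eq_fun do rewrite expr2.
  by apply: CkM; exact: Ck_partial.
have -> : grad_excess L psi = fun x => Num.max 0 (Num.sqrt (\sum_i partial i psi x ^+ 2) - L).
  apply/funext => x; rewrite /grad_excess /enorm; congr (Num.max _ (Num.sqrt _ - _)).
  by apply: eq_bigr => i _; rewrite mxE.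
move=> x; apply: (@continuous_max _ _ (cst 0) (fun x => Num.sqrt (\sum_i partial i psi x ^+ 2) - L)).
  exact: cst_continuous.
apply: (@continuousB _ _ _ (fun x => Num.sqrt (\sum_i partial i psi x ^+ 2)) (cst L)); last exact: cst_continuous.
by apply: continuous_comp; [exact: c|exact: sqrt_continuous].
Qed.

(* Lambda(t) = int_A psi(x + tv) dx vanishes at t = 1, and |Lambda'(t)| is at most
   |v| times the integral of |grad psi| <= L + excess over A + tv. *)
Lemma smooth_translation_bound psi (A : set V) (v : V) (L : R) :
  test_function Omega psi -> 0 <= L -> measurable A -> (mu A < +oo)%E ->
  (forall x, A x -> ~ Omega (v + x)) ->
  `|\int[mu]_(x in A) psi x| <=
    enorm v * (L * fine (mu A) + \int[mu]_x grad_excess L psi x).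
Proof.
move=> tpsi L0 mA finA AO; have [K [cK KO psi0]] := test_function_supp tpsi.
have Cpsi : Ck 1 psi by case: tpsi.
have cpsi := Ck_continuous Cpsi.
have dpsi0 i x : ~ K x -> partial i psi x = 0.
  by apply: partial_supported => //; exact: rV_compact_closed.
pose D x := \sum_i v ord0 i * partial i psi x.
have cD : continuous D.
  apply: (@Ck_continuous _ _ 0); apply: Ck_sum => i _; apply: CkZ; exact: Ck_partial.
have D0 x : ~ K x -> D x = 0.
  by move=> Kx; apply: big1 => i _; rewrite dpsi0// mulr0.
have cW := continuous_grad_excess (L := L) Cpsi.
have W0 x : ~ K x -> grad_excess L psi x = 0.
  move=> Kx; rewrite /grad_excess (_ : grad psi x = 0) ?enorm0 ?sub0r ?max_l ?oppr_le0//.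
  by apply/rowP => i; rewrite !mxE dpsi0.
have Wge0 x : 0 <= grad_excess L psi x by rewrite le_max lexx.
have DW x : `|D x| <= enorm v * (L + grad_excess L psi x).
  have -> : D x = \sum_i v ord0 i * grad psi x ord0 i.
    by apply: eq_bigr => i _; rewrite mxE.
  apply: le_trans (enorm_CS_norm _ _) _; rewrite ler_wpM2l ?enorm_ge0//.
  by rewrite -lerBlDl le_max lexx orbT.
have [C C0 DC] := supported_bounded cD cK D0.
have [B B0 psiB] := supported_bounded cpsi cK psi0.
have [B' B'0 WB'] := supported_bounded cW cK W0.
have cshift t (f : V -> R) : continuous f -> continuous (fun x => f (t *: v + x)).
  move=> cf x; apply: (@continuous_comp _ _ _ (fun x => t *: v + x) f) => //; last exact: cf.
  by apply: (@continuousD _ _ _ (cst _) id); [exact: cst_continuous|exact: cvg_id].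
have mshift t (f : V -> R) : continuous f -> measurable_fun A (fun x => f (t *: v + x)).
  by move=> cf; apply: continuous_rV_measurable => //; exact: cshift.
have dF t x : is_derive t (1 : R) (fun t : R => psi (t *: v + x)) (D (t *: v + x)).
  by apply: is_derive_shift_line; exact: is_derive_C1.
pose F (t : R) := \int[mu]_(x in A) psi (t *: v + x).
have intF t : mu.-integrable A (EFin \o (fun x => psi (t *: v + x))).
  by apply: (bounded_integrable mA finA (C := B)) => //; exact: mshift.
have intD t : mu.-integrable A (EFin \o (fun x => D (t *: v + x))).
  by apply: (bounded_integrable mA finA (C := C)) => //; exact: mshift.
have intc (c : R) : mu.-integrable A (EFin \o (fun=> c)).
  by apply: (bounded_integrable mA finA (C := `|c|)) => //; exact: measurable_cst.
have p1 t x : partial1of2 (fun (t : R) x => psi (t *: v + x)) t x = D (t *: v + x).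
  by rewrite partial1of2E; have [_ ->] := dF t x.
have Fd t : is_derive t (1 : R) F (\int[mu]_(x in A) D (t *: v + x)).
  have It : `]t - 1, t + 1[%classic t by rewrite /= in_itv/= ltrBlDr ltrDl ltr01.
  have bd (s : R) x : `]t - 1, t + 1[%classic s -> A x ->
      `|partial1of2 (fun (t : R) x => psi (t *: v + x)) s x| <= C.
    by move=> _ _; rewrite p1.
  have dd (s : R) x : `]t - 1, t + 1[%classic s -> A x ->
      derivable (fun t : R => psi (t *: v + x)) s 1.
    by move=> _ _; have [] := dF s x.
  split.
    exact: (@derivable_under_integral R _ _ mu (fun (t : R) x => psi (t *: v + x)) A mA
      t _ _ It (fun s _ => intF s) dd (fun=> C) (fun=> C0) (intc C) bd).
  rewrite -derive1E (@differentiation_under_integral R _ _ mu (fun (t : R) x => psi (t *: v + x)) A mA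
      t _ _ It (fun s _ => intF s) dd (fun=> C) (fun=> C0) (intc C) bd).
  by apply: eq_Rintegral => x _; rewrite p1.
have F1 : F 1 = 0.
  rewrite /F (_ : \int[mu]_(x in A) _ = \int[mu]_(x in A) (cst 0 x)).
    by rewrite Rintegral_cst// mul0r.
  apply: eq_Rintegral => x /set_mem Ax; rewrite scale1r psi0// => /KO; exact: AO.
have [c _ Fc] := @MVT_segment R F _ 0 1 ler01 (fun t _ => Fd t)
   (continuous_subspaceT (fun t => is_derive1_continuous (Fd t))).
have -> : \int[mu]_(x in A) psi x = F 0.
  by apply: eq_Rintegral => x _; rewrite scale0r add0r.
rewrite -normrN; move: Fc; rewrite F1 sub0r subr0 mulr1 => ->.
apply: le_trans (le_normr_Rintegral mA (intD c)) _.
have intW : mu.-integrable A (EFin \o (fun x => grad_excess L psi (c *: v + x))).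
  by apply: (bounded_integrable mA finA (C := B')) => //; exact: mshift.
have intLW : mu.-integrable A (EFin \o (fun x => L + grad_excess L psi (c *: v + x))).
  exact: (integrableD mA (intc L) intW).
apply: (@le_trans _ _ (\int[mu]_(x in A) (enorm v * (L + grad_excess L psi (c *: v + x))))).
  apply: le_Rintegral => //.
  - exact: (integrable_abse (intD c)).
  - exact: (integrableZl mA (enorm v) intLW).
have -> : \int[mu]_(x in A) (enorm v * (L + grad_excess L psi (c *: v + x))) =
    enorm v * \int[mu]_(x in A) (L + grad_excess L psi (c *: v + x)).
  exact: (RintegralZl _ mA intLW).
have -> : \int[mu]_(x in A) (L + grad_excess L psi (c *: v + x)) =
    \int[mu]_(x in A) (cst L x) + \int[mu]_(x in A) grad_excess L psi (c *: v + x).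
  exact: (RintegralD mA (intc L) intW).
have -> : \int[mu]_(x in A) (cst L x) = L * fine (mu A) by exact: Rintegral_cst.
apply: ler_wpM2l; first exact: enorm_ge0.
rewrite lerD2l.
(* The excess is integrated over the shifted set A + cv with c unknown; enlarging to the whole space
   and translating back removes c. *)
have intWT : mu.-integrable setT (EFin \o grad_excess L psi).
  exact: (continuous_supported_integrable measurableT cK).
have intWs := integrable_shift (c *: v) intWT.
apply: le_trans (le_Rintegral_subset mA measurableT (@subsetT _ A) intWs (fun x => Wge0 _)) _.
rewrite -[leRHS](@Rintegral_shift R n (grad_excess L psi) (c *: v)); last first.
  exact: (continuous_rV_measurable cW measurableT).
by under eq_Rintegral do rewrite addrC.
Qed.

Lemma continuous_addl (v : V) : continuous (fun x : V => v + x).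
Proof.
by move=> x; apply: (@continuousD _ _ _ (cst v) id); [exact: cst_continuous|exact: cvg_id].
Qed.

Lemma sobolev1_integrable u : sobolev Omega 1 u -> mu.-integrable Omega (EFin \o u).
Proof.
move=> [mu_ + _ _]; rewrite Lp_norm1E => u_fin; apply/integrableP; split => //.
exact/measurable_EFinP.
Qed.

(** Passes to the W^{1,1} limit in [smooth_translation_bound], where the excess term disappears. *)
Lemma sobolev0_translation_bound phi (A : set V) (v : V) (L : R) :
  sobolev0 Omega 1 phi -> 0 <= L ->
  {ae mu, forall x, Omega x -> enorm (weak_gradient Omega phi x) <= L} ->
  measurable A -> (mu A < +oo)%E -> A `<=` Omega ->
  (forall x, A x -> ~ Omega (v + x)) ->
  `|\int[mu]_(x in A) phi x| <= enorm v * (L * fine (mu A)).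
Proof.
move=> [Sphi dphi] L0 gL mA finA AO AvO; apply/ler_addgt0Pr => e e0.
have v1 : 0 < enorm v + 1 by rewrite ltr_wpDl ?enorm_ge0.
(* Replacing [phi] by [psi] in the integral costs e', and the excess costs |v| e'; with e' = e /
   (|v| + 1) the total is e. *)
have [psi tpsi] := dphi _ (divr_gt0 e0 v1); set e' := e / _.
rewrite /sobolev_norm => h.
have Cpsi : Ck 1 psi by case: tpsi.
have [K [cK KO psi0]] := test_function_supp tpsi.
have cpsi := Ck_continuous Cpsi.
have [mphi _ [g wg] _] := Sphi.
have wgd := is_weak_gradientB oO (is_weak_gradient_weak_gradient wg) (is_weak_gradient_C1 oO Cpsi).
have intphi := sobolev1_integrable Sphi.
have intpsi : mu.-integrable Omega (EFin \o psi) by exact: (continuous_supported_integrable mO cK).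
have intd : mu.-integrable Omega (EFin \o (fun x => phi x - psi x)).
  exact: (integrableB mO intphi intpsi).
have intnd : mu.-integrable Omega (EFin \o (fun x => `|phi x - psi x|)).
  exact: (integrable_abse intd).
have intnd0 x : 0 <= `|phi x - psi x| by [].
have intW : mu.-integrable setT (EFin \o grad_excess L psi).
  apply: (continuous_supported_integrable measurableT cK).
    exact: continuous_grad_excess.
  move=> x Kx; rewrite /grad_excess (_ : grad psi x = 0) ?enorm0 ?sub0r ?max_l ?oppr_le0//.
  apply/rowP => i; rewrite !mxE (@partial_supported _ _ _ K)//; exact: rV_compact_closed.
have a_eq : Lp_norm Omega 1 (fun x => phi x - psi x) =
    (\int[mu]_(x in Omega) `|phi x - psi x|)%:E.
  rewrite Lp_norm1E /Rintegral fineK//; exact: (integrable_fin_num mO intnd).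
have b_ge : ((\int[mu]_x grad_excess L psi x)%:E <=
    grad_norm Omega 1 (fun x => phi x - psi x)%R)%E.
  rewrite (@Rintegral_sub _ _ _ mu setT Omega)//; last first.
    move=> x Ox; rewrite /grad_excess (_ : grad psi x = 0) ?enorm0 ?sub0r ?max_l ?oppr_le0//.
    apply/rowP => i; rewrite !mxE (@partial_supported _ _ _ K)//; first exact: rV_compact_closed.
    by move=> /KO.
  rewrite /grad_norm Lp_norm1E /Rintegral fineK; last first.
    by apply: (integrable_fin_num mO); exact: integrableS intW.
  have [_ lwgd _] := is_weak_gradient_weak_gradient wgd.
  apply: ae_ge0_le_integral => //.
  - by move=> x _; rewrite lee_fin le_max lexx.
  - by apply: measurable_int; apply: integrableS intW.
  - apply/measurable_EFinP; apply: measurableT_comp => //.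
    by apply: measurable_enorm => i; have [] := lwgd i.
  (* Pointwise, |grad psi| - L <= |grad psi| - |grad phi| <= |grad phi - grad psi|. *)
  - have := weak_gradient_ae oO wgd; apply: filterS2 gL => x gLx wgx Ox.
    rewrite lee_fin /= wgx// ger0_norm ?enorm_ge0// ge_max enorm_ge0/= lerBlDl.
    have := gLx Ox; have := ler_enormB (weak_gradient Omega phi x) (grad psi x).
    by rewrite ler_norml => /andP[+ _]; lra.
have /andP[a_lt b_lt] : (\int[mu]_(x in Omega) `|phi x - psi x| < e') &&
    (\int[mu]_x grad_excess L psi x < e').
  rewrite -!lte_fin; apply/andP; split; apply: le_lt_trans h.
    by rewrite a_eq leeDl// Lp_norm_ge0.
  by rewrite (le_trans b_ge)// leeDr// Lp_norm_ge0.
have -> : \int[mu]_(x in A) phi x = \int[mu]_(x in A) (phi x - psi x) + \int[mu]_(x in A) psi x.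
  have iA f : mu.-integrable Omega (EFin \o f) -> mu.-integrable A (EFin \o f).
    exact: integrableS.
  rewrite (RintegralB mA (iA _ intphi) (iA _ intpsi)); ring.
apply: le_trans (ler_normD _ _) _.
have h1 : `|\int[mu]_(x in A) (phi x - psi x)| <= e'.
  have intdA : mu.-integrable A (EFin \o (fun x => phi x - psi x)) by exact: integrableS intd.
  apply: le_trans (le_normr_Rintegral mA intdA) _.
  exact: le_trans (le_Rintegral_subset mA mO AO intnd intnd0) (ltW a_lt).
have h2 := smooth_translation_bound tpsi L0 mA finA AvO.
have -> : enorm v * (L * fine (mu A)) + e = e' + enorm v * (L * fine (mu A) + e').
  have ee : e' * (enorm v + 1) = e by rewrite divfK// lt0r_neq0.
  by rewrite -[X in _ + X = _]ee; ring.
apply: lerD h1 (le_trans h2 _).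
by rewrite ler_wpM2l ?enorm_ge0// lerD2l ltW.
Qed.

Lemma ae_not_of_integral_le0 (A : set V) (f : V -> R) : measurable A ->
  mu.-integrable A (EFin \o f) -> (forall x, A x -> 0 < f x) ->
  \int[mu]_(x in A) f x <= 0 -> {ae mu, forall x, ~ A x}.
Proof.
move=> mA intf f0 If.
have : ae_eq mu A (EFin \o f) (cst 0%E).
  apply/(ae_eq_integral_abs mu mA); first exact: measurable_int intf.
  rewrite (eq_integral (EFin \o f)); last first.
    by move=> x /set_mem Ax; rewrite /= gtr0_norm// f0.
  rewrite -[LHS]fineK; last exact: integrable_fin_num.
  congr EFin; apply/eqP; rewrite eq_le [X in X && _]If/=.
  by apply: Rintegral_ge0 => x Ax; rewrite ltW// f0.
by apply: filterS => x h Ax; have [] := h Ax => fx0; have := f0 _ Ax; rewrite fx0 ltxx.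
Qed.

(* The previous bound applied to the two sets A = {x in Omega | x + v not in Omega,
   +phi x > |v| L} and the same with -phi contradicts the definition of A unless A
   is null. *)
Lemma sobolev0_translation_ae phi (v : V) (L : R) : (mu Omega < +oo)%E ->
  sobolev0 Omega 1 phi -> 0 <= L ->
  {ae mu, forall x, Omega x -> enorm (weak_gradient Omega phi x) <= L} ->
  {ae mu, forall x, Omega x -> ~ Omega (v + x) -> `|phi x| <= enorm v * L}.
Proof.
move=> finO Sphi L0 gL; have intphi := sobolev1_integrable Sphi.1.
have [mphi _ _ _] := Sphi.1.
have mvO : measurable [set x : V | ~ Omega (v + x)].
  apply: closed_rV_measurable; apply: open_closedC.
  exact: (open_comp (fun x _ => @continuous_addl v x) oO).
suff H (s : R) : `|s| = 1 ->
    {ae mu, forall x, ~ (Omega x /\ ~ Omega (v + x) /\ enorm v * L < s * phi x)}.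
  have h1 := H 1 (normr1 _); have h2 := H (-1) (normrN1 _).
  apply: filterS2 h1 h2 => x h1 h2 Ox vOx; rewrite ler_norml; apply/andP; split.
    rewrite lerNl leNgt; apply/negP => lt; apply: h2; split => //; split => //.
    by rewrite mulN1r.
  by rewrite leNgt; apply/negP => lt; apply: h1; split => //; split => //; rewrite mul1r.
move=> s1.
pose A := [set x | Omega x /\ ~ Omega (v + x) /\ enorm v * L < s * phi x].
suff : {ae mu, forall x, ~ A x} by [].
have ms : measurable_fun Omega (fun x => s * phi x) by exact: measurable_funM.
have mA : measurable A.
  rewrite (_ : A = [set x : V | ~ Omega (v + x)] `&`
      (Omega `&` (fun x => s * phi x) @^-1` `]enorm v * L, +oo[)).
    by apply: measurableI => //; apply: ms => //; exact: measurable_itv.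
  apply/seteqP; split=> x /=; rewrite in_itv/= andbT.
    by move=> [? []].
  by move=> [? []].
have AO : A `<=` Omega by move=> x [].
have finA : (mu A < +oo)%E.
  by apply: le_lt_trans finO; apply: le_measure; rewrite ?inE.
have intphiA : mu.-integrable A (EFin \o phi) by exact: integrableS intphi.
have intsA : mu.-integrable A (EFin \o (fun x => s * phi x)).
  exact: (integrableZl mA s intphiA).
have intcA : mu.-integrable A (EFin \o (fun=> enorm v * L)).
  by apply: (bounded_integrable mA finA (C := `|enorm v * L|)) => //; exact: measurable_cst.
apply: (@ae_not_of_integral_le0 A (fun x => s * phi x - enorm v * L) mA).
- exact: (integrableB mA intsA intcA).
- by move=> x [_ [_ lt]]; rewrite subr_gt0.
rewrite (RintegralB mA intsA intcA) subr_le0.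
have -> : \int[mu]_(x in A) (s * phi x) = s * \int[mu]_(x in A) phi x.
  exact: (RintegralZl _ mA intphiA).
have -> : \int[mu]_(x in A) (enorm v * L) = enorm v * L * fine (mu A).
  exact: Rintegral_cst.
apply: le_trans (ler_norm _) _; rewrite normrM s1 mul1r -mulrA.
apply: sobolev0_translation_bound => //.
by move=> x [_ []].
Qed.

End lower_bound.

Section minimality.
Context (R : realType) (n : nat) (Omega : set 'rV[R]_n).
Local Notation V := 'rV[R]_n.
Local Notation mu := (lebesgue_rV R n).

(* Rational translations v suffice: the points z outside Omega form a
   neighbourhood, so each x in Omega has a rational v with x + v outside Omega and
   |v| < M + e. *)
Lemma grad_norm_lower_bound (M : R) phi : open Omega -> bounded_set Omega ->
  0 < M ->
  (forall x e, Omega x -> 0 < e -> exists2 z, enorm (z - x) < M + e & nbhs z (~` Omega)) ->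
  sobolev0_infty Omega phi -> Lp_norm Omega +oo phi = 1%E ->
  (M^-1%:E <= grad_norm Omega +oo phi)%E.
Proof.
move=> oO bO M0 ext [[mphi _ [g wg] gfin] S0] phi1.
have finO : (mu Omega < +oo)%E.
  by apply: lebesgue_rV_bounded => //; exact: open_rV_measurable.
have [L L0 Lg] : exists2 L : R, 0 <= L & grad_norm Omega +oo phi = L%:E.
  exists (fine (grad_norm Omega +oo phi)).
    by rewrite fine_ge0// Lp_norm_ge0.
  by rewrite fineK// ge0_fin_numE// Lp_norm_ge0.
rewrite Lg lee_fin.
have gL : {ae mu, forall x, Omega x -> enorm (weak_gradient Omega phi x) <= L}.
  have /(Lp_normoo_leP _ _ L0) : (grad_norm Omega +oo phi <= L%:E)%E by rewrite Lg.
  by apply: filterS => x h /h /=; rewrite ger0_norm ?enorm_ge0.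
suff H e : 0 < e -> 1 <= (M + e) * L.
  rewrite -(ler_pM2l M0) divff ?lt0r_neq0//; apply/ler_addgt0Pr => e e0.
  (* Applying [H] to e / (L + 1) keeps the error below e; the + 1 covers L = 0. *)
  have L1 : 0 < L + 1 by rewrite ltr_wpDl.
  rewrite (le_trans (H _ (divr_gt0 e0 L1)))// mulrDl lerD2l mulrAC ler_pdivrMr//.
  by rewrite ler_pM2l// lerDl.
move=> e0.
have ML0 : 0 <= (M + e) * L by apply: mulr_ge0 => //; rewrite ltW// addr_gt0.
rewrite -lee_fin -phi1; apply/Lp_normoo_leP => //.
pose P (k : nat) (x : V) := if unpickle k is Some q then
   Omega x -> ~ Omega ((map_mx ratr (q : 'rV[rat]_n) : V) + x) ->
   `|phi x| <= enorm (map_mx ratr q : V) * L else True.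
have /ae_foralln : forall k, {ae mu, forall x, P k x}.
  move=> k; rewrite /P; case: unpickle => [q|]; last exact: aeW.
  exact: sobolev0_translation_ae.
apply: filterS => x hx Ox.
have [z zx zO] := ext _ _ Ox e0.
have nz : nbhs (z - x) [set h : V | enorm h < M + e /\ ~ Omega (h + x)].
  apply: filterI.
    have := @continuous_enorm R n (z - x); move/cvgrPdist_lt => /(_ (M + e - enorm (z - x))).
    rewrite subr_gt0 => /(_ zx); apply: filterS => y /=.
    by rewrite distrC => /(le_lt_trans (ler_norm _)); rewrite ltrD2r.
  have c : {for z - x, continuous (fun h : V => h + x)}.
    by apply: (@continuousD _ _ _ id (cst x)); [exact: cvg_id|exact: cst_continuous].
  by have := c (~` Omega); rewrite /= subrK; exact.
have [q [k [_ qU]]] := rat_ball nz.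
have [qM qO] : enorm (map_mx ratr q : V) < M + e /\ ~ Omega ((map_mx ratr q : V) + x).
  by apply: qU; apply: ballxx; rewrite invr_gt0.
have := hx (pickle q); rewrite /P pickleK => /(_ Ox qO) h.
by apply: le_trans h _; rewrite ler_wpM2r// ltW.
Qed.

End minimality.

(** * The extremal functions *)

Section real_lemmas.
Context (R : realType).

(** The error q * 2 / 2^k is the tail of the dominating geometric series. [tail] also subtracts the
    part still to come, so that its induction closes. *)
Lemma geometric_bound_cvg (a : nat -> R) (q : R) : (forall j, `|a j| <= q / 2 ^+ j) ->
  exists l, \sum_(j < k) a j @[k --> \oo] --> l /\
    forall k, `|l - \sum_(j < k) a j| <= q * 2 / 2 ^+ k.
Proof.
move=> aq.
have q0 : 0 <= q by have := le_trans (normr_ge0 _) (aq 0%N); rewrite expr0 divr1.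
have cs : cvgn (series a).
  apply: normed_cvg; apply: (@series_le_cvg _ _ (geometric q 2^-1)) => //.
  - by move=> j; exact: normr_ge0.
  - by move=> j; rewrite /geometric/= mulr_ge0// exprn_ge0// invr_ge0.
  - by move=> j; rewrite /geometric/= exprVn.
  - apply: is_cvg_geometric_series; rewrite ger0_norm ?invr_ge0// invf_lt1//; lra.
have E : series a = (fun k => \sum_(j < k) a j) by apply/funext => k; rewrite /series/= big_mkord.
exists (limn (series a)); split; first by rewrite -[X in X @ _]E.
have tail k m : `|\sum_(j < k + m) a j - \sum_(j < k) a j| <= q * 2 / 2 ^+ k - q * 2 / 2 ^+ (k + m).
  elim: m => [|m IH]; first by rewrite addn0 !subrr normr0.
  rewrite addnS big_ord_recr/= addrAC; apply: le_trans (ler_normD _ _) _.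
  apply: le_trans (lerD IH (aq _)) _.
  rewrite exprS invfM; set z := (2 ^+ (k + m))^-1; lra.
move=> k; have c : (series a m - \sum_(j < k) a j) @[m --> \oo] --> limn (series a) - \sum_(j < k) a j.
  by apply: cvgB => //; exact: cvg_cst.
apply: (cvgr_to_le (cvg_norm c)); near=> m.
have km : (k <= m)%N by near: m; exact: nbhs_infty_ge.
rewrite E -(subnKC km); apply: le_trans (tail _ _) _; rewrite gerBl.
by rewrite divr_ge0// ?mulr_ge0// exprn_ge0.
Unshelve. all: by end_near. Qed.

Lemma flat0E (s : R) : flat 0 s = s * flat 1 s.
Proof.
have [s0|s0] := ltP 0 s; last by rewrite !flat_le0// mulr0.
by rewrite flat1E// /flat s0 subr0 powRr1// ltW.
Qed.

Lemma flat2E (s : R) : flat 2 s = s^-1 * flat 1 s.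
Proof.
have [s0|s0] := ltP 0 s; last by rewrite !flat_le0// mulr0.
rewrite flat1E// /flat s0; congr (_ * _).
by rewrite (powR_1Bn 2 s0) expr2 mulrA divff ?mul1r// lt0r_neq0.
Qed.

(* posflat k t tends to max(0, t), its derivative dposflat k t is bounded and
   tends to the indicator of t > 0, and both vanish for t <= 1/(k+1). *)
Definition posflat (k : nat) (t : R) : R := k.+1%:R^-1 * flat 0 (k.+1%:R * t - 1).

Definition dposflat (k : nat) (t : R) : R :=
  flat 1 (k.+1%:R * t - 1) + flat 2 (k.+1%:R * t - 1).

(** At m = 0 the derivative formula of [flat] reads flat 1 + flat 2, and the inner slope k+1 cancels
    the prefactor. *)
Lemma is_derive_posflat k t : is_derive t (1 : R) (posflat k) (dposflat k t).
Proof.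
have df : is_derive t (1 : R) (fun t => flat 0 (k.+1%:R * t - 1)) (dposflat k t * k.+1%:R).
  apply: (@is_derive1_comp _ (flat 0) (fun t => k.+1%:R * t - 1)).
    by apply: is_derive_eq; first exact: is_derive_flat; rewrite subr0 mul1r.
  apply: is_derive_eq; rewrite ?subr0 ?scaler0 ?addr0 ?add0r; exact: mulr1.
apply: (is_derive_eq (is_deriveZ k.+1%:R^-1 df)).
by rewrite /GRing.scale/= mulrC mulfK.
Qed.

Lemma Ck_posflat n m k (f : 'rV[R]_n -> R) : Ck m f -> Ck m (fun x => posflat k (f x)).
Proof.
move=> Cf; apply: CkZ; apply: (@Ck_comp _ _ _ setT (flat 0) (fun x => k.+1%:R * f x - 1)) => //.
  exact: Ck_on_flat.
by apply: CkB; [exact: CkZ|exact: Ck_cst].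
Qed.

Lemma posflat_eq0 k t : k.+1%:R * t <= 1 -> posflat k t = 0 /\ dposflat k t = 0.
Proof. by move=> kt; rewrite /posflat /dposflat !flat_le0 ?subr_le0// mulr0 addr0. Qed.

Lemma posflat_bound k t : 0 <= posflat k t <= Num.max 0 t.
Proof.
have k0 : (0 : R) < k.+1%:R by [].
rewrite mulr_ge0 ?flat_ge0//=; have [kt|kt] := leP (k.+1%:R * t) 1.
  by rewrite (posflat_eq0 kt).1 le_max lexx.
rewrite le_max; apply/orP; right; rewrite /posflat ler_pdivrMl// flat0E.
have s0 : 0 < k.+1%:R * t - 1 by rewrite subr_gt0.
rewrite (le_trans (ler_piMr (ltW s0) (flat1_le1 _)))//; lra.
Qed.

(** With y = 1/s the upper bound is (1 + y) exp(-y) <= 1. *)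
Lemma dposflat_bound k t : 0 <= dposflat k t <= 1.
Proof.
rewrite /dposflat addr_ge0 ?flat_ge0//=; set s := _ - 1.
have [s0|s0] := ltP 0 s; last by rewrite !flat_le0// addr0.
rewrite flat2E flat1E// -[X in X + _]mul1r -mulrDl expRN ler_pdivrMr ?expR_gt0// mul1r.
exact: expR_ge1Dx.
Qed.

Lemma cvgrny_scaled (t_ : nat -> R) (t : R) : 0 < t -> t_ k @[k --> \oo] --> t ->
  (k.+1%:R * t_ k - 1) @[k --> \oo] --> +oo.
Proof.
move=> t0 tt; apply/cvgryPge => A; near=> k.
have h : t / 2 < t_ k.
  near: k; apply: (cvgr_gt t) => //; lra.
rewrite lerBrDr (@le_trans _ _ (k.+1%:R * (t / 2)))//; last by rewrite ler_wpM2l// ltW.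
have t20 : 0 < t / 2 by lra.
rewrite -ler_pdivrMr// (le_trans _ (_ : k%:R <= k.+1%:R))// ?ler_nat//.
near: k; exact: nbhs_infty_ger.
Unshelve. all: by end_near. Qed.

Lemma posflat_cvg (t_ : nat -> R) (t : R) : 0 < t -> t_ k @[k --> \oo] --> t ->
  posflat k (t_ k) @[k --> \oo] --> t.
Proof.
move=> t0 tt; have ks := cvgrny_scaled t0 tt.
have E k : posflat k (t_ k) = (t_ k - k.+1%:R^-1) * flat 1 (k.+1%:R * t_ k - 1).
  by rewrite /posflat flat0E mulrA mulrBr mulKf// mulr1.
under eq_fun do rewrite E.
have h : ((t_ k - k.+1%:R^-1) * flat 1 (k.+1%:R * t_ k - 1)) @[k --> \oo] --> ((t - 0) * 1 : R).
  apply: cvgM; last exact: flat1_cvg.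
  by apply: cvgB => //; exact: cvg_harmonic.
by rewrite subr0 mulr1 in h.
Qed.

Lemma dposflat_cvg (t_ : nat -> R) (t : R) : 0 < t -> t_ k @[k --> \oo] --> t ->
  dposflat k (t_ k) @[k --> \oo] --> (1 : R).
Proof.
move=> t0 tt; have ks := cvgrny_scaled t0 tt.
have f1 := flat1_cvg ks.
have V : (k.+1%:R * t_ k - 1)^-1 @[k --> \oo] --> (0 : R).
  by apply/gtr0_cvgV0 => //; near=> k; near: k; exact: (cvgryPgt _).1.
have h : (flat 1 (k.+1%:R * t_ k - 1) + (k.+1%:R * t_ k - 1)^-1 * flat 1 (k.+1%:R * t_ k - 1))
   @[k --> \oo] --> (1 + 0 * 1 : R) by apply: cvgD => //; exact: cvgM.
rewrite mul0r addr0 in h; apply: cvg_trans h; apply: near_eq_cvg.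
by apply: nearW => k; rewrite /dposflat flat2E.
Unshelve. all: by end_near. Qed.

End real_lemmas.

Section radial_root.
Context (R : realType) (n : nat) (x0 : 'rV[R]_n) (M : R).
Hypothesis M0 : 0 < M.
Local Notation V := 'rV[R]_n.

(* sqrt (|x - x0|^2 / M^2 + 1/(k+1)^2), written as a real power because powR is
   the function whose smoothness was established. *)
Definition smooth_cone (k : nat) (x : V) : R :=
  (enorm (x - x0) ^+ 2 / M ^+ 2 + k.+1%:R^-1 ^+ 2) `^ 2^-1.

Let spos k x : 0 < enorm (x - x0) ^+ 2 / M ^+ 2 + k.+1%:R^-1 ^+ 2.
Proof. by rewrite ltr_wpDl// divr_ge0 ?exprn_ge0 ?enorm_ge0// ltW. Qed.

Lemma smooth_coneE k x : smooth_cone k x = Num.sqrt (enorm (x - x0) ^+ 2 / M ^+ 2 + k.+1%:R^-1 ^+ 2).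
Proof. by rewrite /smooth_cone powR12_sqrt// ltW. Qed.

Lemma smooth_cone_gt0 k x : 0 < smooth_cone k x.
Proof. by rewrite powR_gt0. Qed.

Lemma sqr_smooth_cone k x :
  smooth_cone k x ^+ 2 = enorm (x - x0) ^+ 2 / M ^+ 2 + k.+1%:R^-1 ^+ 2.
Proof. by rewrite smooth_coneE sqr_sqrtr// ltW. Qed.

(** Used twice: 1 - [smooth_cone] lies below the cone, which confines supports to the ball, and the
    quotient giving the partials is at most 1/M in absolute value. *)
Lemma smooth_cone_ge k x : enorm (x - x0) / M <= smooth_cone k x.
Proof.
have e0 : 0 <= enorm (x - x0) / M by rewrite divr_ge0 ?enorm_ge0// ltW.
have s0 := ltW (smooth_cone_gt0 k x).
rewrite -(@ler_pXn2r _ 2) ?nnegrE//.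
by rewrite sqr_smooth_cone expr_div_n lerDl ltW.
Qed.

Let sqrtf k (x : V) := M ^- 2 * (\sum_i (x - x0) ord0 i * (x - x0) ord0 i) + k.+1%:R^-1 ^+ 2.

Let sqrtfE k x : enorm (x - x0) ^+ 2 / M ^+ 2 + k.+1%:R^-1 ^+ 2 = sqrtf k x.
Proof. by rewrite /sqrtf sqr_enorm mulrC; under eq_bigr do rewrite expr2. Qed.

Let Ck_sqrtf k m : Ck m (sqrtf k).
Proof.
apply: CkD; last exact: Ck_cst.
apply: CkZ; apply: Ck_sum => i _; under eq_fun do rewrite !mxE.
by apply: CkM; apply: CkD; by [exact: Ck_coord|exact: Ck_cst].
Qed.

Lemma Ck_smooth_cone k m : Ck m (smooth_cone k).
Proof.
have -> : smooth_cone k = (fun t : R => t `^ 2^-1) \o sqrtf k.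
  by apply/funext => x; rewrite /= -sqrtfE.
apply: (@Ck_comp _ _ _ [set t | 0 < t]); [exact: Ck_on_powR| |exact: Ck_sqrtf].
by move=> x; rewrite -sqrtfE; exact: spos.
Qed.

Lemma partial_smooth_cone k i x :
  partial i (smooth_cone k) x = (x - x0) ord0 i / M ^+ 2 / smooth_cone k x.
Proof.
have dc j : is_derive x (delta_mx ord0 i : V) (fun x : V => (x - x0) ord0 j) ((j == i)%:R : R).
  have -> : (fun x : V => (x - x0) ord0 j) = (fun x : V => x ord0 j) - cst (x0 ord0 j).
    by apply/funext => y; rewrite !mxE.
  apply: (is_derive_eq (is_deriveB (is_derive_coord j x _) (is_derive_cst _ _ _))).
  by rewrite mxE eqxx/= subr0.
have ds : is_derive x (delta_mx ord0 i : V) (sqrtf k) (M ^- 2 * ((x - x0) ord0 i *+ 2)).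
  have h := is_derive_sum (fun j => is_deriveM (dc j) (dc j)).
  have := is_deriveD (is_deriveZ (M ^- 2) h) (is_derive_cst (k.+1%:R^-1 ^+ 2 : R) x (delta_mx ord0 i : V)).
  rewrite addr0 => H; apply: is_derive_eq.
    have -> : sqrtf k = M ^- 2 \*: \sum_(j < n) (fun x1 : V => (x1 - x0) ord0 j) *
        (fun x1 : V => (x1 - x0) ord0 j) + cst (k.+1%:R^-1 ^+ 2).
      by apply/funext => y; rewrite /sqrtf !fctE /= fct_sumE.
    exact: H.
  rewrite /GRing.scale/=; congr (_ * _); rewrite (bigD1 i)//= big1 ?addr0.
    by rewrite eqxx mulr1 mulr2n.
  by move=> j /negbTE ->; rewrite !mulr0 addr0.
have := is_derive_comp1 ds (is_derive1_powR 2^-1 _); rewrite -sqrtfE => /(_ (spos k x)).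
have -> : (@powR R)^~ 2^-1 \o sqrtf k = smooth_cone k.
  by apply/funext => y; rewrite /smooth_cone sqrtfE.
move=> [_ ]; rewrite /partial => ->.
have -> : (2^-1 - 1 : R) = - 2^-1 by lra.
rewrite powRN -/(smooth_cone k x) -mulr_natl; set s := (smooth_cone k x)^-1.
have M2 : M ^+ 2 != 0 by rewrite expf_neq0// lt0r_neq0.
by field; rewrite lt0r_neq0.
Qed.

End radial_root.

Section partial_rules.
Context (R : realType) (n : nat).
Local Notation V := 'rV[R]_n.
Implicit Types f g : V -> R.

Lemma partialE f i x d : is_derive x (delta_mx ord0 i : V) f d -> partial i f x = d.
Proof. by case. Qed.

Lemma partialZ f (c : R) i x : Ck 1 f -> partial i (fun x => c * f x) x = c * partial i f x.
Proof. by move=> Cf; apply: partialE; exact: is_deriveZ (Ck_derivable i x Cf). Qed.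

Lemma partialD f g i x : Ck 1 f -> Ck 1 g ->
  partial i (fun x => f x + g x) x = partial i f x + partial i g x.
Proof.
by move=> Cf Cg; apply: partialE; exact: is_deriveD (Ck_derivable i x Cf) (Ck_derivable i x Cg).
Qed.

Lemma partialB f g i x : Ck 1 f -> Ck 1 g ->
  partial i (fun x => f x - g x) x = partial i f x - partial i g x.
Proof.
by move=> Cf Cg; apply: partialE; exact: is_deriveB (Ck_derivable i x Cf) (Ck_derivable i x Cg).
Qed.

Lemma partial_cst (c : R) i (x : V) : partial i (fun=> c) x = 0.
Proof. by apply: partialE; exact: is_derive_cst. Qed.

Lemma partial_sum m (b : nat -> V -> R) i x : (forall j, Ck 1 (b j)) ->
  partial i (fun x => \sum_(j < m) b j x) x = \sum_(j < m) partial i (b j) x.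
Proof.
move=> Cb; elim: m => [|m IH].
  by rewrite big_ord0; under eq_fun do rewrite big_ord0; exact: partial_cst.
under eq_fun do rewrite big_ord_recr/=.
by rewrite partialD//; [rewrite big_ord_recr/= IH|apply: Ck_sum].
Qed.

Lemma partial_posflat k f i x : Ck 1 f ->
  partial i (fun x => posflat k (f x)) x = dposflat k (f x) * partial i f x.
Proof.
move=> Cf; apply: partialE.
exact: (is_derive_comp1 (Ck_derivable i x Cf) (is_derive_posflat k (f x))).
Qed.

End partial_rules.

Definition cone (R : realType) (n : nat) (x0 : 'rV[R]_n) (M : R) (x : 'rV[R]_n) : R :=
  1 - enorm (x - x0) / M.

Definition peak (R : realType) (n : nat) (x0 : 'rV[R]_n) (M : R) (w : 'rV[R]_n -> R)
  (x : 'rV[R]_n) : R := Num.max (cone x0 M x) (w x).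

Section construction.
Context (R : realType) (n : nat) (Omega : set 'rV[R]_n).
Local Notation V := 'rV[R]_n.
Local Notation mu := (lebesgue_rV R n).
Hypotheses (oO : open Omega) (bO : bounded_set Omega).

(** A positive factor preserves the positivity set, so each covering bump can be shrunk until its
    values and partials are summable geometrically. *)
Lemma small_bumps (q : R) : 0 < q -> exists b : nat -> V -> R,
  [/\ forall j, test_function Omega (b j),
      forall j x, 0 <= b j x <= q / 2 ^+ j,
      forall j i x, `|partial i (b j) x| <= q / 2 ^+ j &
      forall x, Omega x -> exists j, 0 < b j x].
Proof.
move=> q0; have [b [tb b0 bO']] := bump_cover oO.
have /choice[B HB] : forall j, exists C : R, 0 <= C /\
    forall x, `|b j x| <= C /\ forall i, `|partial i (b j) x| <= C.
  move=> j; have [K [cK KO bK]] := test_function_supp (tb j).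
  have [C C0 bC] := supported_bounded (test_function_continuous (tb j)) cK bK.
  have /choice[D HD] : forall i, exists C : R, 0 <= C /\ forall x, `|partial i (b j) x| <= C.
    move=> i; have [|C' C'0 h] := supported_bounded (test_function_partial_continuous (i := i) (tb j)) cK.
      by move=> x; apply: partial_supported => //; exact: rV_compact_closed.
    by exists C'.
  have D0 : 0 <= \sum_i D i by apply: sumr_ge0 => i _; have [] := HD i.
  exists (C + \sum_i D i); split; first exact: addr_ge0.
  move=> x; split; first by rewrite (le_trans (bC x))// lerDl.
  move=> i; have [_ h] := HD i; rewrite (le_trans (h x))// (bigD1 i)//= addrCA lerDl.
  by rewrite addr_ge0// sumr_ge0// => k _; have [] := HD k.
have B1 j : 0 < B j + 1 by have [B0 _] := HB j; rewrite ltr_wpDl.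
(* [B j] bounds the j-th bump and all its partials; the + 1 avoids dividing by 0 for a zero bump. *)
pose c j := q / 2 ^+ j / (B j + 1).
have qj j : 0 < q / 2 ^+ j by rewrite divr_gt0// exprn_gt0.
have c0 j : 0 < c j by rewrite divr_gt0.
have cB j t : `|t| <= B j -> `|c j * t| <= q / 2 ^+ j.
  move=> tB; rewrite normrM gtr0_norm// /c mulrAC ler_pdivrMr//; apply: ler_wpM2l; first exact: ltW.
  by rewrite (le_trans tB)// lerDl.
exists (fun j x => c j * b j x); split.
- by move=> j; exact: test_functionZ.
- move=> j x; apply/andP; split; first by apply: mulr_ge0 => //; exact: ltW.
  apply: le_trans (ler_norm _) _; apply: cB.
  by have [_ /(_ x)[]] := HB j.
- move=> j i x; rewrite partialZ; last by have [] := tb j.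
  by apply: cB; have [_ /(_ x)[_ ]] := HB j; exact.
- by move=> x /bO'[j bj]; exists j; rewrite mulr_gt0.
Qed.

Variables (x0 : V) (M : R).
Hypotheses (Ox0 : Omega x0) (M0 : 0 < M) (ballO : forall x, enorm (x - x0) < M -> Omega x).

(* With w_k the partial sums of w and c_k = 1 - smooth_cone k, the functions
   psi_k = w_k + posflat k (c_k - w_k) are test functions because c_k <= cone <= 0
   off the ball B(x0, M) and posflat k vanishes slightly above 0.  The tail w - w_k
   is at most 1/(k+1), so that the cut-off is inactive where cone <= w. *)
Lemma cone_bump_limit (b : nat -> V -> R) (q : R) (w : V -> R) (G : V -> V) :
  0 < q -> q * 2 <= 2^-1 -> n%:R * (q * 2) <= M^-1 ->
  (forall j, test_function Omega (b j)) ->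
  (forall j x, 0 <= b j x <= q / 2 ^+ j) ->
  (forall j i x, `|partial i (b j) x| <= q / 2 ^+ j) ->
  (forall x, \sum_(j < k) b j x @[k --> \oo] --> w x /\
    forall k, `|w x - \sum_(j < k) b j x| <= q * 2 / 2 ^+ k) ->
  (forall i x, \sum_(j < k) partial i (b j) x @[k --> \oo] --> G x ord0 i /\
    forall k, `|G x ord0 i - \sum_(j < k) partial i (b j) x| <= q * 2 / 2 ^+ k) ->
  sobolev0_infty Omega (peak x0 M w) /\
  (grad_norm Omega +oo (peak x0 M w) <= M^-1%:E)%E.
Proof.
move=> q0 q2 nq tb b01 dbq wP GP.
have Cb m j : Ck m (b j) by have [] := tb j.
pose W k x := \sum_(j < k) b j x.
have CW m k : Ck m (W k) by apply: Ck_sum.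
have pW k i x : partial i (W k) x = \sum_(j < k) partial i (b j) x.
  exact: partial_sum.
have tails (a : nat -> R) l : (forall k, `|l - \sum_(j < k) a j| <= q * 2 / 2 ^+ k) ->
    `|l| <= q * 2.
  by move=> /(_ 0%N); rewrite big_ord0 subr0 expr0 divr1.
have sumq (a : nat -> R) k : (forall j, `|a j| <= q / 2 ^+ j) -> `|\sum_(j < k) a j| <= q * 2.
  move=> aq; suff : `|\sum_(j < k) a j| <= q * 2 - q * 2 / 2 ^+ k.
    move=> /le_trans; apply; rewrite gerBl divr_ge0 ?exprn_ge0// mulr_ge0// ltW//.
  elim: k => [|k IH]; first by rewrite big_ord0 expr0 divr1 subrr normr0.
  rewrite big_ord_recr/= (le_trans (ler_normD _ _))// (le_trans (lerD IH (aq _)))//.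
  rewrite exprS invfM; set z := (2 ^+ k)^-1; lra.
pose c k x := 1 - smooth_cone x0 M k x.
have Cc m k : Ck m (c k) by apply: CkB; [exact: Ck_cst|exact: Ck_smooth_cone].
pose psi k x := W k x + posflat k (c k x - W k x).
have Cpsi m k : Ck m (psi k) by apply: CkD => //; apply: Ck_posflat; exact: CkB.
have ppsi k i x : partial i (psi k) x = partial i (W k) x +
    dposflat k (c k x - W k x) * (partial i (c k) x - partial i (W k) x).
  have Ccw : Ck 1 (fun x => c k x - W k x) by exact: CkB.
  rewrite (partialD _ _ (CW 1%N k) (Ck_posflat k Ccw)) (partial_posflat _ _ _ Ccw).
  by rewrite (partialB _ _ (Cc 1%N k) (CW 1%N k)).
have pc k i x : partial i (c k) x = - ((x - x0) ord0 i / M ^+ 2 / smooth_cone x0 M k x).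
  rewrite partialB; [|exact: Ck_cst|exact: Ck_smooth_cone].
  by rewrite partial_cst sub0r partial_smooth_cone.
pose c_ := cone x0 M.
have W0 k x : 0 <= W k x by apply: sumr_ge0 => j _; have /andP[] := b01 j x.
have cone_cvg x : smooth_cone x0 M k x @[k --> \oo] --> enorm (x - x0) / M.
  have -> : enorm (x - x0) / M = Num.sqrt (enorm (x - x0) ^+ 2 / M ^+ 2 + 0 ^+ 2).
    rewrite expr0n addr0 -expr_div_n sqrtr_sqr ger0_norm//.
    by rewrite divr_ge0 ?enorm_ge0// ltW.
  under eq_fun do rewrite smooth_coneE//.
  have h : (enorm (x - x0) ^+ 2 / M ^+ 2 + k.+1%:R^-1 ^+ 2) @[k --> \oo] -->
      (enorm (x - x0) ^+ 2 / M ^+ 2 + 0 ^+ 2 : R).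
    apply: cvgD; first exact: cvg_cst.
    under eq_fun do rewrite expr2.
    by rewrite expr2; apply: cvgM; exact: cvg_harmonic.
  by apply: (cvg_comp _ _ h); exact: sqrt_continuous.
have c_cvg x : c k x @[k --> \oo] --> c_ x by apply: cvgB => //; exact: cvg_cst.
have cle k x : c k x <= c_ x by rewrite lerB// smooth_cone_ge.
have tk_cvg x : c k x - W k x @[k --> \oo] --> c_ x - w x.
  by apply: cvgB => //; exact: (wP x).1.
(* The difference is at most the tail q * 2 / 2^k, which is below 1/(k+1) since q * 2 <= 1 and k + 1
   <= 2^k. *)
have small k x : c_ x <= w x -> k.+1%:R * (c k x - W k x) <= 1.
  move=> cw; rewrite mulrC -ler_pdivlMr// mul1r.
  apply: (@le_trans _ _ (w x - W k x)); first by rewrite lerB// (le_trans (cle k x)).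
  rewrite (le_trans (ler_norm _))// (le_trans ((wP x).2 k))//.
  have k2 : (k.+1%:R : R) <= 2 ^+ k by rewrite -natrX ler_nat ltn_expl.
  rewrite ler_pdivrMr ?exprn_gt0// ler_pdivlMl//.
  by rewrite (le_trans _ k2)// ler_piMr//; lra.
(* The pointwise limit of the gradients; ties belong to the second branch. At x0 the vector x - x0
   is zero, so [g] is 0 there, which is also the value of all partials of [c k] at x0. *)
pose g x : V := if w x < c_ x then - (M * enorm (x - x0))^-1 *: (x - x0) else G x.
have u_cvg x : psi k x @[k --> \oo] --> Num.max (c_ x) (w x).
  have [cw|wc] := leP (c_ x) (w x).
    have -> : (fun k => psi k x) = (fun k => W k x); last exact: (wP x).1.
    by apply/funext => k; rewrite /psi (posflat_eq0 (small k x cw)).1 addr0.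
  have -> : c_ x = w x + (c_ x - w x) by rewrite addrC subrK.
  apply: cvgD; first exact: (wP x).1.
  by apply: posflat_cvg => //; rewrite subr_gt0.
have du_cvg x i : partial i (psi k) x @[k --> \oo] --> g x ord0 i.
  under eq_fun do rewrite ppsi pW.
  rewrite /g; have [wc|cw] := ltP (w x) (c_ x); last first.
    have -> : (fun k => \sum_(j < k) partial i (b j) x + dposflat k (c k x - W k x) *
       (partial i (c k) x - \sum_(j < k) partial i (b j) x)) = (fun k => \sum_(j < k) partial i (b j) x).
      by apply/funext => k; rewrite (posflat_eq0 (small k x cw)).2 mul0r addr0.
    exact: (GP i x).1.
  have dc : partial i (c k) x @[k --> \oo] --> ((- (M * enorm (x - x0))^-1 *: (x - x0)) ord0 i : R).
    under eq_fun do rewrite pc.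
    rewrite mxE mulNr; apply: cvgN.
    have [e0|e0] := eqVneq (enorm (x - x0)) 0.
      have xi0 : (x - x0) ord0 i = 0 by rewrite (enorm_eq0 e0) mxE.
      by rewrite xi0 mulr0; under eq_fun do rewrite !mul0r; exact: cvg_cst.
    have -> : (M * enorm (x - x0))^-1 * (x - x0) ord0 i =
        (x - x0) ord0 i / M ^+ 2 * (enorm (x - x0) / M)^-1.
      by field; rewrite e0 lt0r_neq0.
    apply: cvgMr; apply: cvgV; last exact: cone_cvg.
    by rewrite mulf_neq0// invr_neq0// lt0r_neq0.
  have G1 := (GP i x).1.
  have D1 : dposflat k (c k x - W k x) @[k --> \oo] --> (1 : R).
    by apply: (dposflat_cvg (t := c_ x - w x)) => //; rewrite subr_gt0.
  have -> : (- (M * enorm (x - x0))^-1 *: (x - x0)) ord0 i =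
     G x ord0 i + 1 * ((- (M * enorm (x - x0))^-1 *: (x - x0)) ord0 i - G x ord0 i).
    by rewrite mul1r [RHS]addrC subrK.
  apply: cvgD; first exact: G1.
  by apply: cvgM => //; apply: cvgB.
have tpsi k : test_function Omega (psi k).
  apply: test_functionD; first exact: test_function_sum.
  (* Beyond this radius the cone is at most 1/(k+1), where [posflat k] vanishes; as r < M, the
     support is compact inside the ball. *)
  pose r := M * (1 - k.+1%:R^-1).
  have rM : r < M by rewrite /r gtr_pMr// gtrBl invr_gt0.
  apply: (@test_functionI _ _ _ [set x | enorm (x - x0) <= r]).
  - by move=> m; apply: Ck_posflat; exact: CkB.
  - exact: compact_enorm_ball.
  - by move=> x /= xr; apply: ballO; exact: le_lt_trans rM.
  - move=> x /= /negP; rewrite -ltNge => xr; apply: (posflat_eq0 _).1.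
    rewrite mulrC -ler_pdivlMr// mul1r (@le_trans _ _ (c_ x))//.
      by rewrite (le_trans _ (cle k x))// gerBl.
    rewrite /c_ /cone lerBlDr -lerBlDl; rewrite ler_pdivlMr//; apply: ltW.
    by rewrite mulrC.
have cone_abs k x i : `|partial i (c k) x| <= M^-1.
  rewrite pc normrN normrM normfV (gtr0_norm (smooth_cone_gt0 _ M0 _ _)).
  rewrite ler_pdivrMr ?smooth_cone_gt0//.
  apply: le_trans (ler_wpM2l _ (smooth_cone_ge _ M0 _ _)); last by rewrite invr_ge0 ltW.
  rewrite normrM normfV (ger0_norm (exprn_ge0 2 (ltW M0))) mulrCA -invfM -expr2.
  apply: ler_wpM2r; last exact: ler_coord_enorm.
  by rewrite invr_ge0 exprn_ge0// ltW.
have M1 : 0 < M^-1 by rewrite invr_gt0.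
(* One constant for both bounds: the values stay below 2q + 1, the partials below 2q + (1/M +
   2q). *)
pose C := 2 + M^-1 + q * 4.
have C0 : 0 <= C by rewrite /C; lra.
have psiC k x : Omega x -> `|psi k x| <= C.
  move=> _; have Wq : `|W k x| <= q * 2.
    by apply: (sumq (fun j => b j x)) => j; have /andP[b0 b1] := b01 j x; rewrite ger0_norm.
  have /andP[p0 p1] := posflat_bound k (c k x - W k x).
  have p2 : posflat k (c k x - W k x) <= 1.
    rewrite (le_trans p1)// ge_max ler01/= /c.
    have := smooth_cone_gt0 x0 M0 k x; have := W0 k x; lra.
  rewrite (le_trans (ler_normD _ _))// (ger0_norm p0) /C; lra.
have dpsiC k i x : Omega x -> `|partial i (psi k) x| <= C.
  move=> _; rewrite ppsi pW.
  have pWq : `|\sum_(j < k) partial i (b j) x| <= q * 2.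
    exact: (sumq (fun j => partial i (b j) x)).
  have /andP[p0 p1] := dposflat_bound k (c k x - W k x).
  rewrite (le_trans (ler_normD _ _))// normrM (ger0_norm p0).
  have h : `|partial i (c k) x - \sum_(j < k) partial i (b j) x| <= M^-1 + q * 2.
    by rewrite (le_trans (ler_normB _ _))// lerD.
  have := ler_piMl (normr_ge0 (partial i (c k) x - \sum_(j < k) partial i (b j) x)) p1.
  rewrite /C; lra.
have Su : sobolev0_infty Omega (peak x0 M w).
  by apply: (sobolev0_infty_limit oO bO C0 (Cpsi 1%N) psiC dpsiC (g := g)).
split; first exact: Su.
have wg : is_weak_gradient Omega (peak x0 M w) g.
  by apply: (is_weak_gradient_limit oO bO (Cpsi 1%N) psiC dpsiC).
apply/Lp_normoo_leP; first exact: ltW.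
apply: filterS (weak_gradient_ae oO wg) => x + Ox => /= ->//.
rewrite ger0_norm ?enorm_ge0// /g; case: ifP => _.
  rewrite enormZ normrN ger0_norm ?invr_ge0 ?mulr_ge0 ?enorm_ge0 ?(ltW M0)//.
  have [->|e0] := eqVneq (enorm (x - x0)) 0; first by rewrite mulr0 ltW.
  by rewrite invfM mulfVK.
apply: le_trans (ler_enorm_sum _) _; apply: le_trans nq.
rewrite mulr_natl -[n in _ *+ n]card_ord -sumr_const; apply: ler_sum => i _.
exact: (tails (fun j => partial i (b j) x)) (GP i x).2.
Qed.

Lemma peak_exists : exists w : V -> R, [/\ continuous w,
  forall x, 0 <= w x <= 2^-1, forall x, Omega x -> 0 < w x,
  sobolev0_infty Omega (peak x0 M w) &
  (grad_norm Omega +oo (peak x0 M w) <= M^-1%:E)%E].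
Proof.
have M1 : 0 < M^-1 by rewrite invr_gt0.
have n1 : (0 : R) < n.+1%:R * 2 by rewrite mulr_gt0.
(* 1/4 gives w <= 2q <= 1/2. The second term makes the n partials of w, each at most 2q, add up to
   at most 1/M; n+1 keeps the denominator nonzero. *)
pose q := Num.min 4^-1 (M^-1 / (n.+1%:R * 2)).
have q0 : 0 < q by rewrite lt_min invr_gt0 ltr0n/= divr_gt0.
have q4 : q <= 4^-1 by rewrite ge_min lexx.
have q2 : q * 2 <= 2^-1 by lra.
have qn : q * (n.+1%:R * 2) <= M^-1 by rewrite -ler_pdivlMr// ge_min lexx orbT.
have nq : n%:R * (q * 2) <= M^-1.
  apply: le_trans qn; rewrite mulrCA; apply: ler_wpM2l; first exact: ltW.
  by rewrite ler_wpM2r// ler_nat.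
have [b [tb b01 dbq bO']] := small_bumps q0.
have bq j x : `|b j x| <= q / 2 ^+ j by have /andP[h1 h2] := b01 j x; rewrite ger0_norm.
have [w wP] : exists w : V -> R, forall x, \sum_(j < k) b j x @[k --> \oo] --> w x /\
    forall k, `|w x - \sum_(j < k) b j x| <= q * 2 / 2 ^+ k.
  have H x : exists l : R, \sum_(j < k) b j x @[k --> \oo] --> l /\
      forall k, `|l - \sum_(j < k) b j x| <= q * 2 / 2 ^+ k.
    exact: geometric_bound_cvg (fun j => bq j x).
  by exists (fun x => projT1 (cid (H x))) => x; exact: projT2 (cid (H x)).
have [Gf GfP] : exists Gf : 'I_n * V -> R, forall p,
    \sum_(j < k) partial p.1 (b j) p.2 @[k --> \oo] --> Gf p /\
    forall k, `|Gf p - \sum_(j < k) partial p.1 (b j) p.2| <= q * 2 / 2 ^+ k.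
  have H (p : 'I_n * V) : exists l : R,
      \sum_(j < k) partial p.1 (b j) p.2 @[k --> \oo] --> l /\
      forall k, `|l - \sum_(j < k) partial p.1 (b j) p.2| <= q * 2 / 2 ^+ k.
    exact: geometric_bound_cvg (fun j => dbq j p.1 p.2).
  by exists (fun p => projT1 (cid (H p))) => p; exact: projT2 (cid (H p)).
pose G x : V := \row_i Gf (i, x).
have GP i x : \sum_(j < k) partial i (b j) x @[k --> \oo] --> G x ord0 i /\
    forall k, `|G x ord0 i - \sum_(j < k) partial i (b j) x| <= q * 2 / 2 ^+ k.
  by rewrite mxE; exact: (GfP (i, x)).
have [Sw gw] := cone_bump_limit q0 q2 nq tb b01 dbq wP GP.
(* Nonnegative terms make each partial sum a lower bound, so w is positive wherever some bump is. *)
have sum_le k x : \sum_(j < k) b j x <= w x.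
  have [c _] := wP x; apply: (cvgr_to_ge c); near=> m.
  have km : (k <= m)%N by near: m; exact: nbhs_infty_ge.
  rewrite -(subnKC km) big_split_ord/= lerDl; apply: sumr_ge0 => j _.
  by have /andP[] := b01 (k + j)%N x.
exists w; split => //.
- move=> x; apply/(@cvgrPdist_lt R R V (nbhs (x : V)) (nbhs_filter (x : V))) => e e0.
  have e3 : 0 < e / 3 by rewrite divr_gt0.
  have [k kq] : exists k : nat, q * 2 / 2 ^+ k < e / 3.
    have := @cvg_geometric R (q * 2) 2^-1; rewrite ger0_norm ?invr_ge0// invf_lt1// ltr1n.
    move=> /(_ isT) /cvgr0Pnorm_lt /(_ _ e3)[k _ /(_ k (leqnn k))] h.
    by exists k; move: h; rewrite /= exprVn; apply: le_lt_trans; exact: ler_norm.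
  have cW : continuous (fun x => \sum_(j < k) b j x).
    by apply: (@Ck_continuous _ _ 0); apply: Ck_sum => j _; have [] := tb j.
  have := cW x; move/cvgrPdist_lt => /(_ _ e3); apply: filterS => y xy.
  have h1 := le_lt_trans ((wP x).2 k) kq; have h2 := le_lt_trans ((wP y).2 k) kq.
  have -> : w x - w y = (w x - \sum_(j < k) b j x) +
      (\sum_(j < k) b j x - \sum_(j < k) b j y) - (w y - \sum_(j < k) b j y) by ring.
  apply: (le_lt_trans (ler_normB _ _)); have := ler_normD (w x - \sum_(j < k) b j x)
      (\sum_(j < k) b j x - \sum_(j < k) b j y).
  lra.
- move=> x; have := sum_le 0%N x; rewrite big_ord0 => -> /=.
  have := (wP x).2 0%N; rewrite big_ord0 subr0 expr0 divr1 => /(le_trans (ler_norm _)) h.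
  exact: le_trans h q2.
- move=> x /bO'[j bj]; apply: lt_le_trans (sum_le j.+1 x).
  rewrite big_ord_recr/= ltr_wpDl// sumr_ge0// => i _.
  by have /andP[] := b01 i x.
Unshelve. all: by end_near. Qed.

Lemma continuous_peak (w : V -> R) : continuous w -> continuous (peak x0 M w).
Proof.
move=> cw x; apply: (@continuous_max _ _ (cone x0 M) w); last exact: cw.
have -> : cone x0 M = (cst 1 : V -> R) - (fun x : V => enorm (x - x0) / M) by [].
apply: continuousB; first exact: cst_continuous.
have ce : {for x, continuous (fun x : V => enorm (x - x0))}.
  apply: (@continuous_comp _ _ _ (fun x : V => x - x0) (@enorm R n)).
    by apply: (@continuousB _ _ _ id (cst x0)); [exact: cvg_id|exact: cst_continuous].
  exact: continuous_enorm.
by apply: (cvgMl ce).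
Qed.

Lemma peak_extremal :
  (forall x e, Omega x -> 0 < e -> exists2 z, enorm (z - x) < M + e & nbhs z (~` Omega)) ->
  exists u : V -> R, extremal Omega u /\ forall x, u x = 1 <-> x = x0.
Proof.
move=> ext; have [w [cw w01 w0 Sw gw]] := peak_exists.
have u1 x : peak x0 M w x = 1 <-> x = x0.
  split=> [|->].
    rewrite /peak; have /andP[_ w2] := w01 x; case: (leP (cone x0 M x) (w x)) => _.
      by move=> wx; exfalso; move: w2; rewrite wx; lra.
    rewrite /cone => /eqP; rewrite addrC -subr_eq0 addrK oppr_eq0 mulf_eq0 invr_eq0 (gt_eqF M0) orbF.
    by move=> /eqP/enorm_eq0/eqP; rewrite subr_eq0 => /eqP.
  rewrite /peak /cone subrr enorm0 mul0r subr0 max_l//.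
  by have /andP[_ w2] := w01 x0; lra.
have cone1 x : cone x0 M x <= 1.
  by rewrite /cone gerBl divr_ge0 ?enorm_ge0// ltW.
have u01 x : Omega x -> 0 < peak x0 M w x <= 1.
  move=> Ox; rewrite /peak lt_max w0// orbT/= ge_max cone1/=.
  by have /andP[_ w2] := w01 x; lra.
have cu := continuous_peak cw.
have Lu : Lp_norm Omega +oo (peak x0 M w) = 1%E.
  apply/eqP; rewrite eq_le; apply/andP; split.
    apply/Lp_normoo_leP => //; apply: aeW => x Ox.
    by have /andP[/ltW h1 h2] := u01 x Ox; rewrite ger0_norm.
  (* If the norm were C < 1, the part of [Omega] where the peak exceeds C would be null, yet it is
     open and contains x0. *)
  rewrite leNgt; apply/negP => lt1.
  pose C := fine (Lp_norm Omega +oo (peak x0 M w)).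
  have C0 : 0 <= C by rewrite fine_ge0// Lp_norm_ge0.
  have EC : Lp_norm Omega +oo (peak x0 M w) = C%:E.
    by rewrite fineK// ge0_fin_numE ?Lp_norm_ge0// (lt_trans lt1)// ltry.
  have C1 : C < 1 by rewrite -lte_fin -EC.
  have /(Lp_normoo_leP _ _ C0)[N [mN N0 subN]] : (Lp_norm Omega +oo (peak x0 M w) <= C%:E)%E by rewrite EC.
  pose A := Omega `&` [set x | C < peak x0 M w x].
  have oA : open A.
    apply: openI => //; exact: (open_comp (fun x _ => cu x) (@open_gt _ C)).
  have A0 : A !=set0 by exists x0; split => //=; rewrite (u1 x0).2.
  have := lebesgue_rV_open_gt0 oA A0; rewrite (_ : mu A = 0%E) ?ltxx//.
  apply: (subset_measure0 (open_rV_measurable oA) mN _ N0).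
  move=> x [Ox Cx]; apply: subN => /= /(_ Ox); rewrite leNgt => /negP; apply.
  by rewrite (lt_le_trans Cx)// ler_norm.
exists (peak x0 M w); split => //; split => //.
- exact: continuous_subspaceT.
- split; first by exists (peak x0 M w).
  move=> _ [phi [Sphi phi1] <-].
  by apply: le_trans gw _; exact: (grad_norm_lower_bound oO bO M0 ext).
Qed.

End construction.

(** * Boundary distance and the annulus *)

Lemma continuous_col' (R : realType) (n : nat) (i : 'I_n) :
  continuous (fun p : 'rV[R]_n => col' i p).
Proof.
move=> p A /nbhs_ballP[e /= e0 eA]; apply/nbhs_ballP; exists e => // q.
move=> /(ball_rVE _ _ e0) pq; apply: eA; apply/(ball_rVE _ _ e0) => j.
by rewrite !mxE; exact: pq.
Qed.

Lemma enorm_delta (R : realType) (n : nat) (i : 'I_n) :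
  enorm (delta_mx ord0 i : 'rV[R]_n) = 1.
Proof.
rewrite /enorm (bigD1 i)//= mxE !eqxx expr1n big1 ?addr0 ?sqrtr1// => j ji.
by rewrite mxE (negPf ji) andbF expr0n.
Qed.

Section boundary_geometry.
Context (R : realType) (n : nat) (Omega : set 'rV[R]_n).
Local Notation V := 'rV[R]_n.
Implicit Types x y z : V.
Hypothesis oO : open Omega.

Lemma boundary_notin x : boundary Omega x -> ~ Omega x.
Proof. by move=> [_]; rewrite ((@interior_id _ Omega).1 oO). Qed.

(** The point at the supremum of the parameters whose point lies in [Omega] is a limit of points of
    [Omega]; were it inside, openness would allow a larger parameter. *)
Lemma segment_boundary x z : Omega x -> ~ Omega z ->
  exists2 y, boundary Omega y & enorm (y - x) <= enorm (z - x).
Proof.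
move=> Ox Oz; pose p (t : R) : V := x + t *: (z - x).
pose T := [set t : R | 0 <= t <= 1 /\ Omega (p t)].
have p0 : p 0 = x by rewrite /p scale0r addr0.
have p1 : p 1 = z by rewrite /p scale1r addrC subrK.
have T0 : T 0 by split; [rewrite lexx ler01|rewrite p0].
have hT : has_sup T by split; [exists 0|exists 1 => t [/andP[]]].
have sT0 : 0 <= sup T by apply: ub_le_sup => //; exact: hT.2.
have sT1 : sup T <= 1 by apply: ge_sup; [exists 0|move=> t [/andP[]]].
have cp : continuous p.
  by move=> t; apply: (@cvgD R V); [exact: cvg_cst|exact: scalel_continuous].
exists (p (sup T)); last first.
  by rewrite /p addrC addKr enormZ ger0_norm// ler_piMl// enorm_ge0.
split.
  move=> B pB; have : nbhs (sup T) (p @^-1` B) by exact: cp.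
  move=> /nbhs_ballP[e /= e0 eB]; have [t Tt st] := sup_adherent e0 hT.
  exists (p t); split; first by case: Tt.
  apply: eB; rewrite -ball_normE/= ltr_distl; apply/andP; split.
    by rewrite ltrBlDr (le_lt_trans _ (_ : sup T < sup T + e)) ?ltrDl// ub_le_sup//; exact: hT.2.
  by rewrite -ltrBlDr.
rewrite ((@interior_id _ Omega).1 oO) => OpT.
have s1 : sup T < 1.
  by rewrite lt_neqAle sT1 andbT; apply/negP => /eqP e; apply: Oz; rewrite -p1 -e.
have : nbhs (sup T) (p @^-1` Omega) by apply: cp; exact: open_nbhs_nbhs.
move=> /nbhs_ballP[e /= e0 eO].
pose t := Num.min 1 (sup T + e / 2).
have e2 : 0 < e / 2 by rewrite divr_gt0.
have st : sup T < t by rewrite lt_min s1 ltrDl.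
have t1 : t <= 1 by rewrite ge_min lexx.
have : T t.
  split; first by rewrite t1 (le_trans sT0)// ltW.
  apply: eO; rewrite -ball_normE/= distrC gtr0_norm ?subr_gt0// ltrBlDl.
  rewrite (@le_lt_trans _ _ (sup T + e / 2)) ?ge_min ?lexx ?orbT// ltrD2l; lra.
by move=> /(ub_le_sup hT.2); rewrite leNgt st.
Qed.

(** A whole neighbourhood of z must avoid [Omega]. An isolated removed point is in the boundary but
    fails this, and such a point is invisible to the a.e. lower bound. *)
Definition exterior_dense := forall y (e : R), boundary Omega y -> 0 < e ->
  exists2 z, enorm (z - y) < e & nbhs z (~` Omega).

(** Moving y down the graph axis by d leaves [gamma] unchanged and lowers the height by d, so z lies
    strictly under the graph, an open condition. Taking d below e and r keeps z near y and in the
    chart. *)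
Lemma smooth_boundary_exterior : smooth_boundary Omega -> exterior_dense.
Proof.
move=> sO y e By e0; have [r [i [s [gamma [r0 sg ep]]]]] := sO y By.
have Oy := boundary_notin By.
pose c : R := (-1) ^+ s.
have c1 : `|c| = 1 by rewrite normrX normrN1 expr1n.
have cc : c * c = 1 by rewrite -expr2 sqrr_sign.
have gy : c * y ord0 i <= gamma (col' i y).
  rewrite leNgt; apply/negP => gy; apply/Oy/(ep y) => //.
  by rewrite subrr enorm0.
pose d := Num.min (e / 2) (r / 2).
have d0 : 0 < d by rewrite lt_min !divr_gt0.
have de : d < e by rewrite gt_min; apply/orP; left; lra.
have dr : d < r by rewrite gt_min; apply/orP; right; lra.
pose z : V := y - (c * d) *: delta_mx ord0 i.
have zy : enorm (z - y) = d.
  rewrite /z addrC addKr enormN enormZ normrM c1 mul1r (gtr0_norm d0).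
  by rewrite enorm_delta mulr1.
exists z; first by rewrite zy.
have colz : col' i z = col' i y.
  by apply/rowP => j; rewrite !mxE [lift i j == i]eq_sym (negPf (neq_lift _ _)) mulr0 subr0.
have cg : continuous (fun p : V => gamma (col' i p) - c * p ord0 i).
  have cg1 : continuous (fun p : V => gamma (col' i p)).
    move=> p; apply: (@continuous_comp V 'rV[R]_n.-1 R (fun p : V => col' i p) gamma).
      exact: continuous_col'.
    exact: (sg 0%N).1.
  have cg2 : continuous (fun p : V => c * p ord0 i).
    exact: Ck_continuous (CkZ c (@Ck_coord R n 0 i)).
  by move=> p; exact: continuousB (cg1 p) (cg2 p).
have gz : 0 < gamma (col' i z) - c * z ord0 i.
  rewrite colz !mxE !eqxx mulr1 mulrBr mulrA cc mul1r; move: gy d0; lra.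
have n1 : nbhs z [set p | 0 < gamma (col' i p) - c * p ord0 i].
  apply: (cg z [set t | 0 < t]); apply: open_nbhs_nbhs.
  by split; [exact: open_gt|exact: gz].
have n2 : nbhs z [set p | enorm (p - y) < r].
  have rd : 0 < r - d by rewrite subr_gt0.
  apply: filterS (enorm_ball_nbhs z rd) => p /= pz.
  have -> : p - y = (p - z) + (z - y) by rewrite addrA subrK.
  by rewrite (le_lt_trans (ler_enormD _ _))// zy -ltrBrDr.
apply: filterS2 n1 n2 => p /= p0 pr /(ep p pr).1.
rewrite -/c => pc; move: p0 pc; lra.
Qed.

Hypotheses (bO : bounded_set Omega) (n0 : (0 < n)%N).

Lemma bounded_exterior : exists z, ~ Omega z.
Proof.
have [r r0 Or] := bounded_rV_ball bO.
exists (const_mx r) => /Or /(ball_rVE _ _ r0) /(_ (Ordinal n0)).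
by rewrite !mxE sub0r normrN gtr0_norm// ltxx.
Qed.

Lemma boundary_nonempty x : Omega x -> boundary Omega !=set0.
Proof.
move=> Ox; have [z Oz] := bounded_exterior.
by have [y ? _] := segment_boundary Ox Oz; exists y.
Qed.

Lemma boundary_dist_le x y : boundary Omega y -> boundary_dist Omega x <= enorm (y - x).
Proof.
move=> By; apply: ge_inf; last by exists y.
by exists 0 => _ [z _ <-]; exact: enorm_ge0.
Qed.

Lemma le_boundary_dist x (r : R) : Omega x ->
  (forall y, boundary Omega y -> r <= enorm (y - x)) -> r <= boundary_dist Omega x.
Proof.
move=> Ox ry; apply: lb_le_inf; last by move=> _ [y By <-]; exact: ry.
by have [y By] := boundary_nonempty Ox; exists (enorm (y - x)), y.
Qed.

Lemma boundary_dist_gt0 x : Omega x -> 0 < boundary_dist Omega x.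
Proof.
move=> Ox; have /nbhs_ballP[r /= r0 rO] : nbhs x Omega by exact: open_nbhs_nbhs.
apply: (lt_le_trans r0); apply: le_boundary_dist => // y /boundary_notin Oy.
rewrite leNgt; apply/negP => yr; apply: Oy; apply: rO.
by rewrite -ball_normE/= (le_lt_trans (ler_norm_enorm _))// enormB.
Qed.

Lemma boundary_dist_ball x y : Omega x -> enorm (y - x) < boundary_dist Omega x -> Omega y.
Proof.
move=> Ox yx; apply: contrapT => Oy; have [z Bz zy] := segment_boundary Ox Oy.
by have := boundary_dist_le x Bz; rewrite leNgt (le_lt_trans zy).
Qed.

(** Some boundary point is within M + e/2 of x, and some exterior point within e/2 of that one. This
    is the geometric input of the lower bound. *)
Lemma exterior_near (M : R) : exterior_dense ->
  (forall x, Omega x -> boundary_dist Omega x <= M) ->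
  forall x e, Omega x -> 0 < e -> exists2 z, enorm (z - x) < M + e & nbhs z (~` Omega).
Proof.
move=> ext rM x e Ox e0; have e2 : 0 < e / 2 by rewrite divr_gt0.
have hi : has_inf [set enorm (y - x) | y in boundary Omega].
  split; first by have [y By] := boundary_nonempty Ox; exists (enorm (y - x)), y.
  by exists 0 => _ [z _ <-]; exact: enorm_ge0.
have [_ [y By <-] ye] := inf_adherent e2 hi.
have [z zy zO] := ext y _ By e2; exists z => //.
have -> : z - x = (z - y) + (y - x) by rewrite addrA subrK.
rewrite (le_lt_trans (ler_enormD _ _))//.
have := rM x Ox; rewrite /boundary_dist in ye *; move: zy ye; lra.
Qed.

(** The map sending a function to its point of value 1 recovers x0 from the restriction to the
    closure, the extension by 0 adding no such point. A finite family would thus leave finitely many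
    maximum points. *)
Lemma extremal_family : exterior_dense -> infinite_set (max_points_dist Omega) ->
  exists F : set (V -> R), infinitely_many_on_closure Omega F /\
    forall u, F u -> extremal Omega u /\
      exists2 x0, max_points_dist Omega x0 & forall x, u x = 1 <-> x = x0.
Proof.
move=> ext infO.
exists [set u | extremal Omega u /\
   exists2 x0, max_points_dist Omega x0 & forall x, u x = 1 <-> x = x0]; split; last first.
  by move=> u [].
move=> finF; apply: infO.
apply: (sub_finite_set _ (finite_image (fun f : V -> R => xget 0 [set x | f x = 1]) finF)).
move=> x0 mx0; have [Ox0 maxx0] := mx0.
have M0 := boundary_dist_gt0 Ox0.
have [u [Eu u1]] := peak_extremal oO bO Ox0 M0 (fun x => @boundary_dist_ball x0 x Ox0)
  (exterior_near ext maxx0).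
exists (u \_ (closure Omega)); first by exists u => //; split => //; exists x0.
apply: xget_unique => /=.
  by rewrite patchE mem_set; [exact: (u1 x0).2|exact: subset_closure].
move=> y; rewrite patchE; case: ifP => _; first by move=> /(u1 y).1.
by move=> /eqP; rewrite eq_sym oner_eq0.
Qed.

End boundary_geometry.

(** * The annulus *)

Section annulus.
Context (R : realType) (n : nat) (a b : R).
Local Notation V := 'rV[R]_n.
Local Notation A := (annulus a b : set V).
Hypotheses (a0 : 0 < a) (ab : a < b).

Lemma open_annulus : open A.
Proof.
rewrite (_ : A = @enorm R n @^-1` `]a, b[%classic); last first.
  by apply/seteqP; split => x /=; rewrite in_itv.
by apply: open_comp => [x _|]; [exact: continuous_enorm|exact: itv_open].
Qed.

Lemma bounded_annulus : bounded_set A.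
Proof. by apply: (@enorm_bounded _ _ _ b) => x /andP[_ /ltW]. Qed.

Lemma notin_annulus (x : V) : ~ A x -> enorm x <= a \/ b <= enorm x.
Proof.
move=> Ax; case: (leP (enorm x) a) => xa; [by left|right].
by rewrite leNgt; apply/negP => xb; apply: Ax; rewrite /annulus/= xa.
Qed.

(** A boundary point of norm at most a is shrunk towards the origin, one of norm at least b is
    dilated; the strict norm inequality so gained is open. *)
Lemma annulus_exterior : exterior_dense A.
Proof.
move=> y e /(boundary_notin open_annulus) /notin_annulus[ya|yb] e0.
  (* 1/2 keeps the factor 1 - d nonnegative, and e / (2a) bounds the displacement d |y| by e/2. *)
  pose d := Num.min (1 / 2) (e / (2 * a)).
  have d0 : 0 < d by rewrite lt_min !divr_gt0// mulr_gt0.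
  have d1 : d <= 1 / 2 by rewrite ge_min lexx.
  have da : d * a <= e / 2.
    rewrite (le_trans (_ : _ <= e / (2 * a) * a))//.
      by rewrite ler_pM2r// ge_min lexx orbT.
    by rewrite le_eqVlt; apply/orP; left; apply/eqP; field; rewrite gt_eqF.
  have dy : d * enorm y <= d * a by rewrite ler_pM2l.
  exists ((1 - d) *: y).
    rewrite scalerBl scale1r addrC addKr enormN enormZ gtr0_norm//.
    move: dy da e0; lra.
  have : nbhs ((1 - d) *: y) [set p : V | enorm p < a].
    apply: open_nbhs_nbhs; split.
      apply: (@open_comp _ _ (@enorm R n) [set t | t < a]); last exact: open_lt.
      by move=> x _; exact: continuous_enorm.
    rewrite /= enormZ ger0_norm; last by move: d1; lra.
    rewrite (@le_lt_trans _ _ ((1 - d) * a))//.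
      by rewrite ler_wpM2l//; move: d1; lra.
    by rewrite mulrBl mul1r ltrBlDr ltrDl mulr_gt0.
  apply: filterS => p /= pa; rewrite /annulus/= => /andP[ap _].
  by move: (lt_trans pa ap); rewrite ltxx.
have y0 : 0 < enorm y by rewrite (lt_le_trans _ yb)// (lt_trans a0).
pose d := e / (2 * enorm y).
have d0 : 0 < d by rewrite divr_gt0// mulr_gt0.
exists ((1 + d) *: y).
  rewrite scalerDl scale1r addrC addKr enormZ gtr0_norm//.
  rewrite (_ : d * enorm y = e / 2); first by move: e0; lra.
  by rewrite /d; field; rewrite gt_eqF.
have : nbhs ((1 + d) *: y) [set p : V | b < enorm p].
  apply: open_nbhs_nbhs; split.
    apply: (@open_comp _ _ (@enorm R n) [set t | b < t]); last exact: open_gt.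
    by move=> x _; exact: continuous_enorm.
  rewrite /= enormZ gtr0_norm ?addr_gt0// (le_lt_trans yb)//.
  by rewrite mulrDl mul1r ltrDl mulr_gt0.
apply: filterS => p /= pb; rewrite /annulus/= => /andP[_ bp].
by move: (lt_trans pb bp); rewrite ltxx.
Qed.

Hypothesis n0 : (0 < n)%N.

(** Moving x along its ray to the nearer bounding sphere leaves the annulus, so the segment meets
    the boundary no farther away. *)
Lemma annulus_boundary_dist_le (x : V) : A x -> boundary_dist A x <= (b - a) / 2.
Proof.
move=> Ax; have /andP[ax xb] := Ax.
have x0 : 0 < enorm x by exact: lt_trans ax.
have ray (c : R) : 0 < c -> (c <= a \/ b <= c) -> boundary_dist A x <= `|c - enorm x|.
  move=> c0 cab; have cx : enorm ((c / enorm x) *: x) = c.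
    by rewrite enormZ gtr0_norm ?divr_gt0// divfK// gt_eqF.
  have Ac : ~ A ((c / enorm x) *: x).
    rewrite /annulus/= cx => /andP[ac cb]; case: cab.
      by rewrite leNgt ac.
    by rewrite leNgt cb.
  have [y By yx] := segment_boundary open_annulus Ax Ac.
  apply: (le_trans (boundary_dist_le _ By)); apply: (le_trans yx).
  rewrite -[X in _ - X]scale1r -scalerBl enormZ -[X in _ * X](gtr0_norm x0) -normrM.
  by rewrite mulrBl mul1r divfK// gt_eqF.
case: (leP (enorm x) ((a + b) / 2)) => xm.
  apply: (le_trans (ray a _ _)) => //; first by left.
  by rewrite ltr0_norm ?subr_lt0//; move: xm; lra.
apply: (le_trans (ray b _ _)); [exact: lt_trans ab|by right|].
by rewrite gtr0_norm ?subr_gt0//; move: xm; lra.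
Qed.

Lemma annulus_max_points (x : V) : enorm x = (a + b) / 2 -> max_points_dist A x.
Proof.
move=> xm; have Ax : A x by rewrite /annulus/= xm; apply/andP; split; move: ab; lra.
split => // y Ay; apply: (le_trans (annulus_boundary_dist_le Ay)).
apply: (le_boundary_dist open_annulus bounded_annulus n0) => // z.
move=> /(boundary_notin open_annulus) /notin_annulus zab.
apply: le_trans (ler_enormB _ _); rewrite xm.
case: zab => zab.
  by rewrite distrC; apply: le_trans (ler_norm _); move: zab; lra.
by apply: le_trans (ler_norm _); move: zab; lra.
Qed.

End annulus.

(** The vectors e_0 + k e_1 rescaled to norm r are pairwise distinct: the first coordinate reveals
    the scale, then the second reveals k. *)
Lemma infinite_sphere (R : realType) (n : nat) (r : R) : (2 <= n)%N -> 0 < r ->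
  infinite_set [set x : 'rV[R]_n | enorm x = r].
Proof.
move=> n2 r0 fin; apply: infinite_nat.
pose i0 : 'I_n := Ordinal (ltnW n2); pose i1 : 'I_n := Ordinal n2.
pose v (k : nat) : 'rV[R]_n := delta_mx ord0 i0 + k%:R *: delta_mx ord0 i1.
have v0 k : v k ord0 i0 = 1.
  by rewrite !mxE !eqxx/= mulr0 addr0.
have v1 k : v k ord0 i1 = k%:R.
  by rewrite !mxE !eqxx/= mulr1 add0r.
have vgt0 k : 0 < enorm (v k).
  rewrite lt_neqAle enorm_ge0 andbT eq_sym; apply/eqP => /enorm_eq0 vk.
  by have := v0 k; rewrite vk mxE => /eqP; rewrite eq_sym oner_eq0.
pose q k := (r / enorm (v k)) *: v k.
have qr k : enorm (q k) = r.
  by rewrite enormZ gtr0_norm ?divr_gt0// divfK// gt_eqF.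
have qinj : injective q.
  move=> k l kl; have /(congr1 (fun x : 'rV_n => x ord0 i0)) := kl.
  rewrite [LHS]mxE [RHS]mxE !v0 !mulr1 => ekl.
  have /(congr1 (fun x : 'rV_n => x ord0 i1)) := kl.
  rewrite [LHS]mxE [RHS]mxE v1 v1 ekl => h.
  have /eqP : k%:R = l%:R :> R by apply: mulfI h; rewrite gt_eqF// divr_gt0.
  by rewrite eqr_nat => /eqP.
rewrite (_ : [set: nat] = q @^-1` [set x | enorm x = r]).
  by apply: finite_preimage => // k l _ _; exact: qinj.
by apply/seteqP; split => // k _; exact: qr.
Qed.

Theorem corollary3p16 (R : realType) (N : nat) (hN : (2 <= N)%N) :
  (forall Omega : set 'rV[R]_N,
     domain Omega -> bounded_set Omega -> smooth_boundary Omega ->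
     infinite_set (max_points_dist Omega) ->
     exists F : set ('rV[R]_N -> R),
       infinitely_many_on_closure Omega F /\
       forall u, F u ->
         extremal Omega u /\
         exists2 x0, max_points_dist Omega x0 &
           forall x, closure Omega x -> (u x = 1 <-> x = x0)) /\
  (forall a b : R, 0 < a -> a < b ->
     exists F : set ('rV[R]_N -> R),
       infinitely_many_on_closure (annulus a b) F /\
       forall u, F u ->
         extremal (annulus a b) u /\ ~ radial (annulus a b) u).
Proof.
have N0 : (0 < N)%N by exact: ltnW.
split=> [D [oO _ _] bO sO infO|a b a0 ab].
  have [F [infF FE]] := extremal_family oO bO N0 (smooth_boundary_exterior oO sO) infO.
  exists F; split => // u /FE[Eu [x0 mx0 ux0]]; split => //.
  by exists x0 => // x _.
have infA : infinite_set (max_points_dist (annulus a b : set 'rV[R]_N)).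
  move=> fin; apply: (@infinite_sphere R N ((a + b) / 2) hN); first by move: a0 ab; lra.
  by apply: sub_finite_set fin => x; exact: annulus_max_points.
have [F [infF FE]] := extremal_family (@open_annulus R N a b) (@bounded_annulus R N a b) N0
  (annulus_exterior a0 ab) infA.
exists F; split => // u /FE[Eu [x0 [Ax0 _] ux0]]; split => // -[h uh].
have /andP[ax0 x0b] := Ax0.
have Nx0 : - x0 = x0.
  apply/ux0; rewrite uh; last by rewrite /annulus/= enormN.
  by rewrite enormN -uh//; exact/ux0.
have x00 : x0 = 0.
  apply/rowP => i; have /rowP/(_ i) := Nx0; rewrite !mxE; lra.
by move: ax0; rewrite x00 enorm0 ltNge (ltW a0).
Qed.
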